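(* Let $\rho$ be an absolutely continuous probability measure on $\mathbb{R}$ whose support is a bounded interval and whose density (also denoted $\rho$) is continuous on $\operatorname{spt}\rho$ and satisfies $\rho_{\min}\le\rho(x)\le\rho_{\max}$ for every $x\in\operatorname{spt}\rho$, for some finite constants $\rho_{\min},\rho_{\max}>0$. Let $y_1<\dots<y_N$ be real numbers and let $\alpha_1,\dots,\alpha_N>0$ with $\sum_{i=1}^N\alpha_i<1$. With $\mathcal{K}$, $\mathcal{K}^\varepsilon$, $G^\varepsilon$ defined as in the context, there exists $\varepsilon_0>0$ such that the following hold. (1) For any $\varepsilon\in(0,\varepsilon_0)$, the functional $\mathcal{K}^\varepsilon$ has a unique maximizer $\psi^\varepsilon\in\mathbb{R}^N$. (2) The function $\varepsilon\mapsto\psi^\varepsilon$ is of class $\mathcal{C}^1$ on $(0,\varepsilon_0)$, and on this interval $$[D_\psi G^\varepsilon(\psi^\varepsilon)]\,\dot\psi^\varepsilon+(\partial_\varepsilon G^\varepsilon)(\psi^\varepsilon)=0,$$ where $D_\psi G^\varepsilon=-D^2\mathcal{K}^\varepsilon$ and $\dot\psi^\varepsilon=\frac{d}{d\varepsilon}\psi^\varepsilon$. (3) There is a constant $C$ depending only on $\rho$, on the $y_i$ and on the $\alpha_i$ such that for all $\varepsilon\in(0,\varepsilon_0)$ $$\|\psi^\varepsilon-\psi^*\|\le C\,\varepsilon^2,$$ where $\psi^*\in(0,+\infty)^N$ is the maximizer of the unregularized functional $\mathcal{K}$.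
   Context: The Laguerre cells of $\psi\in\mathbb{R}^N$ are $\mathrm{Lag}_i(\psi)=\{x\in\mathbb{R}: |x-y_i|^2-\psi_i\le|x-y_j|^2-\psi_j\ \text{for all } j\in\{1,\dots,N\}\}$. The unregularized functional (dual of semi-discrete partial optimal transport with quadratic cost) is $$\mathcal{K}(\psi)=\int_{\mathbb{R}}\min\Big(0,\min_{1\le i\le N}\big[|x-y_i|^2-\psi_i\big]\Big)\,d\rho(x)+\sum_{i=1}^N\alpha_i\psi_i .$$ It has a unique maximizer $\psi^*$ on $(0,\infty)^N$. Let $f^*(t)=0$ for $t<0$, $f^*(t)=\frac23t^{3/2}$ for $0\le t\le1$, $f^*(t)=t-\frac13$ for $t>1$, so that $(f^* )'(t)=\min\{\sqrt t,1\}$ for $t>0$ and $(f^* )'(t)=0$ for $t\le 0$. For $\varepsilon>0$ the regularized functional $\mathcal{K}^\varepsilon:\mathbb{R}^N\to\mathbb{R}$ is $$\mathcal{K}^\varepsilon(\psi)=-\varepsilon^2\int_{\mathbb{R}}f^*\Big(\varepsilon^{-2}\max_{1\le i\le N}(\psi_i-|x-y_i|^2)\Big)\,d\rho(x)+\sum_{i=1}^N\alpha_i\psi_i,$$ and $G^\varepsilon=(G_1^\varepsilon,\dots,G_N^\varepsilon)$ is the vector of regularized masses $$G_i^\varepsilon(\psi)=\int_{\mathrm{Lag}_i(\psi)}(f^* )'\big(\varepsilon^{-2}(\psi_i-|x-y_i|^2)\big)\,d\rho(x),$$ so that $\nabla\mathcal{K}^\varepsilon=\alpha-G^\varepsilon$.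 $D_\psi G^\varepsilon$ is the Jacobian matrix in $\psi$, and $\partial_\varepsilon G^\varepsilon$ is the partial derivative in $\varepsilon$ at fixed $\psi$. $\|\cdot\|$ is the Euclidean norm. *)

(* Defs.v *)
From HB Require Import structures.
From mathcomp Require Import all_boot all_order all_algebra.
From mathcomp Require Import all_classical all_reals all_analysis.
Import Order.TTheory GRing.Theory Num.Theory.
Import numFieldNormedType.Exports.

Set Implicit Arguments.
Unset Strict Implicit.
Unset Printing Implicit Defensive.

Local Open Scope ring_scope.
Local Open Scope classical_set_scope.

Section Measures.
Context {R : realType}.

Definition spt (rho : set (measurableTypeR R) -> \bar R) : set R :=
  [set x | forall U : set R, open U -> U x -> (0 < rho U)%E].

Definition is_density (rho : set (measurableTypeR R) -> \bar R)
    (dens : R -> R) : Prop :=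
  [/\ measurable_fun setT (dens : measurableTypeR R -> measurableTypeR R),
      forall x, 0 <= dens x &
      forall A : set (measurableTypeR R), measurable A ->
        rho A = (\int[lebesgue_measure]_(x in A) (dens x)%:E)%E].

End Measures.

Section FiniteExtrema.
Context {R : realType} {n : nat}.
Implicit Types F : 'I_n.+1 -> R.

(* The index set is nonempty: [F ord0], itself one of the values, serves as
   the initial value of the iteration. *)
Definition vmin F : R := \big[Num.min/F ord0]_(i < n.+1) F i.
Definition vmax F : R := \big[Num.max/F ord0]_(i < n.+1) F i.

End FiniteExtrema.

Section Calculus.
Context {R : realType}.

(* The library norm of ['rV[R]_n] is the sup norm. *)
Definition norm2 n (v : 'rV[R]_n) : R := Num.sqrt (\sum_(i < n) v 0 i ^+ 2).

Definition gradient n (F : 'rV[R]_n -> R) (p : 'rV[R]_n) : 'rV[R]_n :=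
  \row_(i < n) 'D_(delta_mx 0 i) F p.

(* ['J f p] acts on row vectors from the right: its (i, j) entry is the i-th
   partial derivative of the j-th component of f. *)
Definition hessian n (F : 'rV[R]_n -> R) (p : 'rV[R]_n) : 'M[R]_n :=
  'J (gradient F) p.

Definition is_maximizer T (D : set T) (F : T -> R) (x : T) : Prop :=
  D x /\ forall z, D z -> F z <= F x.

End Calculus.

(* N = n.+1 sites; potentials psi are row vectors. *)
Section PartialTransport.
Context {R : realType} {n : nat}.
Variables (rho : {measure set (measurableTypeR R) -> \bar R}).
Variables (y alpha : 'I_n.+1 -> R).
Implicit Types psi : 'rV[R]_n.+1.

Definition Lag psi (i : 'I_n.+1) : set R :=
  [set x | forall j : 'I_n.+1,
     `|x - y i| ^+ 2 - psi 0 i <= `|x - y j| ^+ 2 - psi 0 j].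

Definition Kfun psi : R :=
  \int[rho]_x Num.min 0 (vmin (fun i => `|x - y i| ^+ 2 - psi 0 i))
  + \sum_(i < n.+1) alpha i * psi 0 i.

Definition fstar (t : R) : R :=
  if t < 0 then 0
  else if t <= 1 then 2 / 3 * t `^ (3 / 2)
  else t - 1 / 3.

Definition Keps (eps : R) psi : R :=
  - (eps ^+ 2 * \int[rho]_x
       fstar (eps ^- 2 * vmax (fun i => psi 0 i - `|x - y i| ^+ 2)))
  + \sum_(i < n.+1) alpha i * psi 0 i.

Definition Geps (eps : R) psi : 'rV[R]_n.+1 :=
  \row_(i < n.+1) \int[rho]_(x in Lag psi i)
    derive1 fstar (eps ^- 2 * (psi 0 i - `|x - y i| ^+ 2)).

End PartialTransport.

(* Main.v *)
(* The masses form a monotone map psi |-> G(psi), for G^eps as for the unregularized G^0, which is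
   strongly monotone at a potential with masses alpha.  When psi moves by delta, the best score
   max_i (psi_i - |x - y_i|^2) varies by w(x) with |w| = |delta| on the cell of the largest increment.
   By pigeonhole some level mu in (|delta| / 2, |delta|) is far from every |delta_i|.  If |w| takes the
   value mu at positive score, then on an interval of length proportional to |delta| the function w
   differs from all increments, which makes the monotonicity quantitative.  Otherwise |w| > mu
   on an interval of fixed length where the score lies in (0, eps^2), and fstar' is strictly increasing
   there; for G^0 the first case always occurs, since the positive part of the score does not vary
   where no cell reaches.
   Uniqueness, the continuity of eps |-> psi^eps and the invertibility of the Jacobian follow.  So does
   the rate, from strong monotonicity of G^0 at psi^* and |G^0(psi^eps) - G^eps(psi^eps)| <= C eps^2.
   Cells are intervals with ends affine in psi, so each mass is a difference of two integrals over half
   lines.  These are C^1 in (eps, psi_i, end): the derivative of the square root of the height is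
   dominated by an integrable inverse square root.  The curve eps |-> psi^eps is then differentiated as
   in the implicit function theorem. *)
Require Import Defs.
From HB Require Import structures.
From mathcomp Require Import all_boot all_order all_algebra.
From mathcomp Require Import all_classical all_reals all_analysis.
From mathcomp Require Import measurable_realfun.
From mathcomp Require Import ring lra.
Import Order.TTheory GRing.Theory Num.Theory.
Import numFieldNormedType.Exports.

Set Implicit Arguments.
Unset Strict Implicit.
Unset Printing Implicit Defensive.

Local Open Scope ring_scope.
Local Open Scope classical_set_scope.

(** * Expectations and the law *)

(** Strong monotonicity is proved without differentiating the masses: it is needed at finite
    distance and for G^0 as well, and it is what later makes the Jacobian of G^eps invertible. Its
    two cases are both quadratic in |delta|, for opposite reasons: in the first, the gap and the
    length of the interval are each of order |delta|; in the second, the length is fixed and the gap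
    is of order w^2 / eps^2. The largest increment is seen as |w| = |delta| at a fixed point of its
    cell, and the Lipschitz constant of w in x does not depend on the potentials, so the lengths are
    under control. The constants found for G^eps may degenerate as eps tends to 0, which is harmless
    for a statement at one eps, but the rate has to be read off G^0 at the fixed potential psi^*
    instead. Comparing G^0 and G^eps at psi^eps to order eps^2 requires a lower bound on the
    coordinates of psi^eps, which itself comes from a cruder bound of order eps. *)

Section Expectation.
Context {R : realType}.
Variable rho : probability (measurableTypeR R) R.
Implicit Types f g : R -> R.

Definition intg f := rho.-integrable setT (EFin \o f).

Definition aes (P : R -> Prop) : Prop :=
  almost_everywhere rho (P : set (measurableTypeR R)).

Let aeF : Filter (almost_everywhere rho) := ae_filter_ringOfSetsType rho.

Lemma aes_mp (P Q : R -> Prop) : (forall x, P x -> Q x) -> aes P -> aes Q.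
Proof. by move=> PQ; apply: (@filterS _ _ aeF). Qed.

Lemma aes_and (P Q : R -> Prop) : aes P -> aes Q -> aes (fun x => P x /\ Q x).
Proof. exact: (@filterI _ _ aeF). Qed.

Lemma aesT (P : R -> Prop) : (forall x, P x) -> aes P.
Proof. by move=> p; apply: (@aes_mp (fun=> True)) => //; exact: (@filterT _ _ aeF). Qed.

Lemma aes_all (T : finType) (P : T -> R -> Prop) :
  (forall t, aes (P t)) -> aes (fun x => forall t, P t x).
Proof.
move=> aP; have : forall s : seq T, aes (fun x => forall t, t \in s -> P t x).
  elim=> [|u s IH]; first exact: aesT.
  apply: aes_mp (aes_and (aP u) IH) => x [Pu Ps] t.
  by rewrite inE => /predU1P[->//|]; exact: Ps.
by move=> /(_ (enum T)); apply: aes_mp => x h t; apply: h; rewrite mem_enum.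
Qed.

Lemma aes_nat (P : nat -> R -> Prop) :
  (forall n, aes (P n)) -> aes (fun x => forall n, P n x).
Proof. by move=> aP; apply: ae_foralln. Qed.

Lemma aes_ex (P : R -> Prop) : aes P -> exists x, P x.
Proof.
move=> aP; apply: contrapT => nP.
case: aP => A [mA A0 sA].
have AT : A = setT.
  by apply/seteqP; split => // x _; apply: sA => /= Px; apply: nP; exists x.
have := @probability_setT _ _ _ rho.
rewrite AT in A0.
rewrite [X in X = _]A0 => /eqP.
by rewrite eq_sym onee_eq0.
Qed.

Lemma intg_meas f : intg f -> measurable_fun setT f.
Proof. by case/integrableP => /measurable_EFinP. Qed.

Lemma intg_le f g : measurable_fun setT f -> intg g -> (forall x, `|f x| <= g x) -> intg f.
Proof.
move=> mf ig fg; apply: le_integrable ig => //; first exact/measurable_EFinP.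
by move=> x _; rewrite /= lee_fin (le_trans (fg x))// ler_norm.
Qed.

Lemma intg_le_ae f g : measurable_fun setT f -> intg g ->
  aes (fun x => `|f x| <= g x) -> intg f.
Proof.
move=> mf ig fg; apply/integrableP; split; first exact/measurable_EFinP.
have /integrableP[_] := ig; apply: le_lt_trans.
apply: ae_ge0_le_integral => //.
- by apply: measurableT_comp => //; exact/measurable_EFinP.
- by apply: measurableT_comp => //; apply/measurable_EFinP; exact: intg_meas.
- by apply: aes_mp fg => x h _ /=; rewrite lee_fin (le_trans h)// ler_norm.
Qed.

Lemma intg_bnd f (M : R) : measurable_fun setT f -> (forall x, `|f x| <= M) -> intg f.
Proof.
move=> mf fM; apply: (@intg_le _ (cst M)) => //.
exact: finite_measure_integrable_cst.
Qed.

Lemma intgD f g : intg f -> intg g -> intg (fun x => f x + g x).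
Proof.
move=> f1 g1; have := integrableD measurableT f1 g1.
by apply: eq_integrable => // x _ /=; rewrite EFinD.
Qed.

Lemma intgB f g : intg f -> intg g -> intg (fun x => f x - g x).
Proof.
move=> f1 g1; have := integrableB measurableT f1 g1.
by apply: eq_integrable => // x _ /=; rewrite EFinB.
Qed.

Lemma intgZ k f : intg f -> intg (fun x => k * f x).
Proof.
move=> f1; have := integrableZl measurableT k f1.
by apply: eq_integrable => // x _ /=; rewrite EFinM.
Qed.

Lemma intg_norm f : intg f -> intg (fun x => `|f x|).
Proof. by move=> /(integrable_norm). Qed.

Lemma intg_cst c : intg (fun=> c).
Proof. exact: finite_measure_integrable_cst. Qed.

Lemma intg_sum n (F : 'I_n -> R -> R) : (forall i, intg (F i)) ->
  intg (fun x => \sum_(i < n) F i x).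
Proof.
elim: n F => [|n IH] F iF.
  have -> : (fun x => \sum_(i < 0) F i x) = fun=> 0.
    by apply/funext => x; rewrite big_ord0.
  exact: intg_cst.
have -> : (fun x => \sum_(i < n.+1) F i x) =
    (fun x => F ord0 x + \sum_(i < n) F (lift ord0 i) x).
  by apply/funext => x; rewrite big_ord_recl.
by apply: intgD => //; exact: IH.
Qed.

Lemma E_cst c : \int[rho]_x c = c.
Proof.
rewrite Rintegral_cst//.
rewrite -[RHS]mulr1; congr (_ * _).
by have /(congr1 fine) := @probability_setT _ _ _ rho.
Qed.

Lemma E_D f g : intg f -> intg g ->
  \int[rho]_x (f x + g x) = \int[rho]_x f x + \int[rho]_x g x.
Proof. exact: RintegralD. Qed.

Lemma E_B f g : intg f -> intg g ->
  \int[rho]_x (f x - g x) = \int[rho]_x f x - \int[rho]_x g x.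
Proof. exact: RintegralB. Qed.

Lemma E_Z k f : intg f -> \int[rho]_x (k * f x) = k * \int[rho]_x f x.
Proof. exact: RintegralZl. Qed.

Lemma E_sum n (F : 'I_n -> R -> R) : (forall i, intg (F i)) ->
  \int[rho]_x (\sum_(i < n) F i x) = \sum_(i < n) \int[rho]_x F i x.
Proof.
elim: n F => [|n IH] F iF.
  rewrite big_ord0 -[RHS](E_cst 0); congr fine; apply: eq_integral => x _.
  by rewrite big_ord0.
rewrite big_ord_recl -IH// -E_D//; last exact: intg_sum.
by congr fine; apply: eq_integral => x _; rewrite big_ord_recl.
Qed.

Lemma eq_E f g : f =1 g -> \int[rho]_x f x = \int[rho]_x g x.
Proof. by move=> fg; congr fine; apply: eq_integral => x _; rewrite fg. Qed.

Lemma E_eq_ae f g : measurable_fun setT f -> measurable_fun setT g ->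
  aes (fun x => f x = g x) -> \int[rho]_x f x = \int[rho]_x g x.
Proof.
move=> mf mg fg; congr fine; apply: ae_eq_integral => //.
- exact/measurable_EFinP.
- exact/measurable_EFinP.
- by apply: aes_mp fg => x /= ->.
Qed.

Lemma E_le f g : intg f -> intg g -> (forall x, f x <= g x) ->
  \int[rho]_x f x <= \int[rho]_x g x.
Proof. by move=> *; apply: le_Rintegral. Qed.

Lemma E_le_ae f g : intg f -> intg g -> aes (fun x => f x <= g x) ->
  \int[rho]_x f x <= \int[rho]_x g x.
Proof.
move=> f1 g1 fg.
(* Passing to the minimum of f and g, equal to f almost everywhere, reduces the claim to a pointwise
   comparison. *)
have mfg : measurable_fun setT (fun x => Num.min (f x) (g x)).
  by apply: measurable_minr; exact: intg_meas.
have ifg : intg (fun x => Num.min (f x) (g x)).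
  apply: (@intg_le _ (fun x => `|f x| + `|g x|)) => //.
    by apply: intgD; exact: intg_norm.
  move=> x; rewrite /Num.min; case: ifP => _.
    by rewrite lerDl.
  by rewrite lerDr.
rewrite (@E_eq_ae f (fun x => Num.min (f x) (g x))) //; last 2 first.
- exact: intg_meas.
- by apply: aes_mp fg => x /min_idPl ->.
by apply: E_le => // x; rewrite ge_min lexx orbT.
Qed.

Lemma E_ge0_ae f : intg f -> aes (fun x => 0 <= f x) -> 0 <= \int[rho]_x f x.
Proof. by move=> f1 f0; rewrite -(E_cst 0); apply: E_le_ae => //; exact: intg_cst. Qed.

Lemma E_norm f : intg f -> `|\int[rho]_x f x| <= \int[rho]_x `|f x|.
Proof. by move=> f1; apply: le_normr_Rintegral. Qed.

Lemma E_norm_le f M : intg f -> aes (fun x => `|f x| <= M) ->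
  `|\int[rho]_x f x| <= M.
Proof.
move=> f1 fM; rewrite (le_trans (E_norm f1))// -(E_cst M).
by apply: E_le_ae => //; [exact: intg_norm|exact: intg_cst].
Qed.

Lemma E_dct (F : nat -> R -> R) f g :
  (forall n, measurable_fun setT (F n)) -> measurable_fun setT f ->
  aes (fun x => F ^~ x @ \oo --> f x) ->
  intg g -> aes (fun x => forall n, `|F n x| <= g x) ->
  (fun n => \int[rho]_x F n x) @ \oo --> \int[rho]_x f x.
Proof.
move=> mF mf Ff ig Fg.
have [] := @dominated_convergence _ _ _ rho setT measurableT
  (fun n => EFin \o F n) (EFin \o f) (EFin \o g).
- by move=> n; apply/measurable_EFinP; exact: mF.
- exact/measurable_EFinP.
- by apply: aes_mp Ff => x Fx _; apply: cvg_EFin => //; apply: nearW.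
- exact: ig.
- by apply: aes_mp Fg => x Fx n _ /=; rewrite lee_fin.
move=> i1 _ cv.
have fin : (\int[rho]_x (EFin \o f) x)%E \is a fin_num by exact: integrable_fin_num.
rewrite -(fineK fin) in cv.
exact: fine_cvg cv.
Qed.

End Expectation.

(** * Support and interval masses of the law *)

Section Support.
Context {R : realType}.
Variable rho : probability (measurableTypeR R) R.

(** The complement of the support is the union of the null intervals with rational ends, a countable
    family, enumerated here by [unpickle]. *)
Lemma aes_spt : aes rho (spt rho).
Proof.
pose P n (x : R) := forall pq : rat * rat, unpickle n = Some pq ->
  rho `]ratr pq.1, ratr pq.2[%classic = 0%E -> ~ (ratr pq.1 < x < ratr pq.2).
have aP n : aes rho (P n).
  rewrite /P; case E : (unpickle n) => [[p q]|]; last exact: aesT.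
  have [r0|r0] := pselect (rho `]ratr p, ratr q[%classic = 0%E); last first.
    by apply: aesT => x [p1 q1] [<- <-].
  exists `]ratr p, ratr q[%classic; split => // x /= h.
  apply: contrapT => xn; apply: h => -[p1 q1] [<- <-] _ /=.
  by move=> hh; apply: xn; rewrite in_itv.
apply: aes_mp (aes_nat aP) => x h U oU Ux.
rewrite lt_neqAle measure_ge0 andbT; apply/eqP => U0.
have /nbhs_ballP[e /= e0 eU] : nbhs x U by exact: open_nbhs_nbhs.
have [p pI] := @rat_in_itvoo R (x - e) x ltac:(lra).
have [q qI] := @rat_in_itvoo R x (x + e) ltac:(lra).
move: pI qI; rewrite !in_itv /= => /andP[p1 p2] /andP[q1 q2].
apply: (h (pickle (p, q)) (p, q)); rewrite ?pickleK//=; last by rewrite p2.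
apply/eqP; rewrite eq_le measure_ge0 andbT U0.
apply: le_measure; rewrite ?inE//; first exact: open_measurable.
move=> z /=; rewrite in_itv /= => /andP[z1 z2]; apply: eU.
rewrite /ball /= ltr_norml; lra.
Qed.


Lemma meas_itvoo (c d : R) : measurable_fun setT (fun x : R => (c < x < d)%R%:R : R).
Proof.
have -> : (fun x : R => (c < x < d)%R%:R) = \1_`]c, d[%classic :> (R -> R).
  by apply/funext => x; rewrite indicE mem_setE in_itv.
exact: measurable_indic.
Qed.

Lemma intg_itvoo (c d : R) : intg rho (fun x : R => (c < x < d)%R%:R).
Proof.
apply: (@intg_bnd _ _ _ 1); first exact: meas_itvoo.
by move=> x; case: (_ < _ < _); rewrite ?normr1 ?normr0.
Qed.

Lemma E_itvoo (c d : R) : (\int[rho]_x (c < x < d)%R%:R)%:E = rho `]c, d[%classic.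
Proof.
rewrite fineK; last first.
  by apply: integrable_fin_num => //; exact: intg_itvoo.
have := @integral_indic _ _ _ rho setT measurableT `]c, d[%classic.
rewrite setIT => <-//.
by apply: eq_integral => x _ /=; rewrite indicE mem_setE in_itv.
Qed.

(** All later estimates see the law through masses of intervals: no atoms, bounds proportional to
    length, and [rl_loc], which makes [dens] the derivative of the mass at interior points. The
    reals a and b are the ends of the support. *)
Record regular_law (a b m M : R) (dens : R -> R) : Prop := RegularLaw {
  rl_ab : a < b ;
  rl_m : 0 < m ;
  rl_M : 0 < M ;
  rl_supp : aes rho (fun x => a < x < b) ;
  rl_pt : forall c, aes rho (fun x => x != c) ;
  rl_up : forall c d : R, c <= d -> \int[rho]_x (c < x < d)%R%:R <= M * (d - c) ;
  rl_lo : forall c d : R, a <= c -> c <= d -> d <= b ->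
    m * (d - c) <= \int[rho]_x (c < x < d)%R%:R ;
  rl_cont : forall u, a < u < b -> {for u, continuous dens} ;
  rl_loc : forall u, a < u < b -> forall eta : R, 0 < eta ->
    exists2 r : R, 0 < r & forall c d : R, c <= d -> `|c - u| < r -> `|d - u| < r ->
      `|\int[rho]_x (c < x < d)%R%:R - dens u * (d - c)| <= eta * (d - c) }.

Lemma regular_law_ex (dens : R -> R) :
  rho `<< (@lebesgue_measure R) -> is_density rho dens ->
  is_interval (spt rho) -> bounded_set (spt rho) ->
  {within spt rho, continuous dens} ->
  forall m M : R, 0 < m -> 0 < M ->
  (forall x, spt rho x -> m <= dens x <= M) ->
  exists a b, regular_law a b m M dens.
Proof.
move=> ac [mdens dens0 rdens] itv bnd cont m M m0 M0 dB.
have pt c : aes rho (fun x => x != c).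
  exists [set c]; split => //.
    by rewrite rdens//; exact: integral_set1.
  by move=> x /= /negP; rewrite negbK => /eqP.
have S0 : spt rho !=set0 by have [x] := aes_ex aes_spt; exists x.
have [B [_ hB]] := bnd.
have {hB} Bx x : spt rho x -> `|x| <= B + 1 by apply: hB; rewrite ltrDl.
have hI : has_inf (spt rho).
  split => //; exists (- (B + 1)) => x /Bx; rewrite ler_norml; lra.
have hS : has_sup (spt rho).
  split => //; exists (B + 1) => x /Bx; rewrite ler_norml; lra.
set a := inf (spt rho); set b := sup (spt rho).
have sab (x : R) : spt rho x -> a <= x <= b.
  by move=> sx; rewrite ge_inf ?ub_le_sup//; [exact: hS.2|exact: hI.2].
have abs (x : R) : a < x < b -> spt rho x.
  move=> /andP[ax xb].
  have [u su ux] := inf_lt hI.1 ax.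
  have [v sv xv] := sup_gt hS.1 xb.
  by apply: (itv u v) => //; rewrite (ltW ux) (ltW xv).
have supp : aes rho (fun x => a < x < b).
  apply: aes_mp (aes_and aes_spt (aes_and (pt a) (pt b))) => x [/sab/andP[ax xb] [xa xb']].
  by rewrite !lt_neqAle ax xb eq_sym xa xb'.
have ab : a < b by have [x /andP[ax xb]] := aes_ex supp; exact: lt_trans ax xb.
have key (c d k K : R) : a <= c -> c <= d -> d <= b ->
    (forall x, c < x < d -> k <= dens x <= K) -> 0 <= k ->
    k * (d - c) <= \int[rho]_x (c < x < d)%R%:R <= K * (d - c).
  move=> ac' cd db kK k0; rewrite -!lee_fin E_itvoo rdens//.
  have L K' : (\int[lebesgue_measure]_(x in `]c, d[) K'%:E = (K' * (d - c))%:E)%E.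
    by rewrite integral_cst//= lebesgue_measure_itv/= lte_fin EFinM EFinB; case: ltgtP cd => //= -> _; rewrite subee.
  rewrite -!L; apply/andP; split; apply: ge0_le_integral => //.
  - apply/measurable_EFinP; exact: measurable_funS mdens.
  - by move=> x /=; rewrite in_itv /= => /kK; rewrite lee_fin => /andP[].
  - by move=> x _; rewrite lee_fin dens0.
  - apply/measurable_EFinP; exact: measurable_funS mdens.
  - by move=> x /=; rewrite in_itv /= => /kK; rewrite lee_fin => /andP[].
(* Outside the support nothing bounds [dens] from above, so an interval is first cut down to the
   support, at no cost in mass. *)
have clip (c d : R) : \int[rho]_x (c < x < d)%R%:R =
    \int[rho]_x (Num.max a c < x < Num.min b d)%R%:R.
  apply: E_eq_ae; [exact: meas_itvoo|exact: meas_itvoo|].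
  apply: aes_mp supp => x /andP[ax xb].
  by rewrite gt_max lt_min ax xb.
(* An interior point of the support has a full neighbourhood in it, so relative continuity becomes
   continuity. *)
have contin u : a < u < b -> {for u, continuous dens}.
  move=> hu.
  have ou : interior (spt rho) u.
    apply/nbhs_ballP; exists (Num.min (u - a) (b - u)) => /=.
      by rewrite lt_min !subr_gt0.
    move=> x; rewrite /ball /= lt_min !ltr_norml => /andP[h1 h2].
    by apply: abs; lra.
  have cu := cont u; rewrite /continuous_at -(nbhs_subspace_interior ou) in cu.
  exact: cu.
exists a, b; split => //.
- move=> c d cd; rewrite clip.
  have [ml|ml] := leP (Num.max a c) (Num.min b d); last first.
    rewrite (@eq_E _ _ _ (fun=> 0)) ?E_cst; last first.
      move=> x; case: andP => // -[h1 h2]; exfalso.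
      by have := lt_trans h1 h2; rewrite ltNge (ltW ml).
    by rewrite mulr_ge0 ?(ltW M0)//; lra.
  have /andP[_ h] : 0 * (Num.min b d - Num.max a c) <=
      \int[rho]_x (Num.max a c < x < Num.min b d)%R%:R <= M * (Num.min b d - Num.max a c).
    apply: key; rewrite ?le_max ?ge_min ?lexx// => x.
    rewrite gt_max lt_min => /andP[/andP[ax _] /andP[xb _]].
    have /dB /andP[mx ->] : spt rho x by apply: abs; rewrite ax.
    by rewrite andbT (le_trans (ltW m0)).
  apply: (le_trans h); rewrite ler_pM2l//.
  have : c <= Num.max a c by rewrite le_max lexx orbT.
  have : Num.min b d <= d by rewrite ge_min lexx orbT.
  lra.
- move=> c d ac' cd db.
  have /andP[] // : m * (d - c) <= \int[rho]_x (c < x < d)%R%:R <= M * (d - c).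
  apply: key => // [x /andP[cx xd]|]; last exact: ltW.
  by apply: dB; apply: abs; rewrite (le_lt_trans ac')// (lt_le_trans xd).
- move=> u hu eta eta0.
  (* Capping the tolerance by [dens u] keeps the lower constant nonnegative, as [key] requires. *)
  have /cvgrPdist_le /(_ (Num.min eta (dens u)) ) := contin _ hu.
  have du : m <= dens u by have /dB /andP[] := abs _ hu.
  have me0 : 0 < Num.min eta (dens u) by rewrite lt_min eta0 (lt_le_trans m0).
  move=> /(_ me0) /nbhs_ballP [r1 /= r10 h1].
  pose r := Num.min r1 (Num.min (u - a) (b - u)).
  have r0 : 0 < r by rewrite !lt_min r10 !subr_gt0.
  exists r => // c d cd; rewrite !lt_min !ltr_norml => /and3P[c1 c2 c3] /and3P[d1 d2 d3].
  have /andP[h2 h3] : (dens u - Num.min eta (dens u)) * (d - c) <=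
      \int[rho]_x (c < x < d)%R%:R <= (dens u + Num.min eta (dens u)) * (d - c).
    apply: key => //; [lra|lra| |by rewrite subr_ge0 ge_min lexx orbT].
    move=> x /andP[cx xd].
    have /h1 /= : ball u r1 x by rewrite /ball /= ltr_norml; lra.
    rewrite ler_norml; lra.
  have h4 : Num.min eta (dens u) <= eta by rewrite ge_min lexx.
  have h5 : Num.min eta (dens u) * (d - c) <= eta * (d - c).
    by rewrite ler_wpM2r// subr_ge0.
  rewrite ler_norml; lra.
Qed.


End Support.

(** * Scores, winners and masses *)

Section Extrema.
Context {R : realType} {n : nat}.
Implicit Types F G : 'I_n.+1 -> R.

Lemma vmax_ge F i : F i <= vmax F.
Proof. exact: le_bigmax. Qed.


Lemma vmax_le F c : (forall i, F i <= c) -> vmax F <= c.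
Proof. by move=> Fc; apply/bigmax_leP; split. Qed.

Lemma vmax_attained F : exists i, vmax F = F i.
Proof.
rewrite /vmax; elim/big_ind: _ => [|x1 x2 [i ->] [j ->]|i _].
- by exists ord0.
- by rewrite /Num.max; case: ifP => _; [exists j|exists i].
- by exists i.
Qed.


Lemma vmin_vmax F : vmin F = - vmax (fun i => - F i).
Proof.
rewrite /vmin /vmax.
elim/big_ind2: _ => [|x1 x2 y1 y2 -> ->|i _]; rewrite ?opprK//.
by rewrite oppr_max.
Qed.

Lemma vmax_dist F G c : (forall i, `|F i - G i| <= c) -> `|vmax F - vmax G| <= c.
Proof.
move=> FG; have [i Fi] := vmax_attained F; have [j Gj] := vmax_attained G.
have := vmax_ge F j; have := vmax_ge G i.
move: (FG i) (FG j); rewrite Fi Gj !ler_norml; lra.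
Qed.

Lemma coord_le_norm m (v : 'rV[R]_m) i : `|v 0 i| <= `|v|.
Proof.
rewrite [leRHS]mx_normrE.
exact: (@le_bigmax _ _ ('I_1 * 'I_m)%type 0 (fun k => `|v k.1 k.2|) (0, i)).
Qed.

Lemma norm_le_coord m (v : 'rV[R]_m) c : 0 <= c -> (forall i, `|v 0 i| <= c) -> `|v| <= c.
Proof.
move=> c0 vc; rewrite [leLHS]mx_normrE; apply/bigmax_leP; split => // -[k i] _ /=.
by rewrite (ord1 k).
Qed.

Lemma norm_attained (v : 'rV[R]_n.+1) : exists i, `|v 0 i| = `|v|.
Proof.
have [i hi] := vmax_attained (fun i => `|v 0 i|).
exists i; apply/eqP; rewrite eq_le coord_le_norm norm_le_coord// => j.
by rewrite -hi; exact: (vmax_ge (fun i => `|v 0 i|)).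
Qed.

(* Pigeonhole: n + 2 disjoint windows in (d / 2, d), n + 1 values. *)
Lemma avoiding_level (F : 'I_n.+1 -> R) (d : R) : 0 < d ->
  exists2 mu, d / 2 < mu < d &
    forall i, d / (4 * n.+2%:R) <= `| F i - mu|.
Proof.
move=> d0; pose g := d / (4 * n.+2%:R).
have N0 : 0 < n.+2%:R :> R by rewrite ltr0n.
have g0 : 0 < g by rewrite divr_gt0// mulr_gt0.
have gd : g * (4 * n.+2%:R) = d by rewrite /g; field; lra.
(* The windows of radius g around these centres tile (d / 2, d): there are n + 2 of them, of width 2
   g = d / (2 (n + 2)). *)
pose ctr (k : 'I_n.+2) := d / 2 + (2 * k%:R + 1) * g.
have [//|no] := pselect (exists2 mu, d / 2 < mu < d & forall i, g <= `| F i - mu|).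
exfalso.
have bad (k : 'I_n.+2) : exists i, `|F i - ctr k| < g.
  apply: contrapT => nb; apply: no; exists (ctr k).
    have k0 : 0 <= k%:R :> R by rewrite ler0n.
    have kn : k%:R + 1 <= n.+2%:R :> R by rewrite natr1 ler_nat ltn_ord.
    have : k%:R * g + g <= n.+2%:R * g by have := ler_wpM2r (ltW g0) kn; rewrite mulrDl mul1r.
    have : 0 <= k%:R * g by rewrite mulr_ge0// ltW.
    rewrite /ctr; lra.
  by move=> i; rewrite leNgt; apply/negP => h; apply: nb; exists i.
pose f k := projT1 (cid (bad k)).
have fP k : `|F (f k) - ctr k| < g by rewrite /f; case: cid.
have inj : injective f.
  move=> k l fkl; have := fP k; have := fP l; rewrite -fkl !ltr_norml /ctr.
  move=> h1 h2; apply: val_inj => /=; apply/eqP; rewrite eqn_leq.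
  rewrite -!(ler_nat R) !leNgt; apply/andP; split; apply/negP; rewrite ltr_nat => kl.
    have : (l%:R + 1 <= k%:R :> R) by rewrite natr1 ler_nat.
    move=> /(ler_wpM2r (ltW g0)); lra.
  have : (k%:R + 1 <= l%:R :> R) by rewrite natr1 ler_nat.
  move=> /(ler_wpM2r (ltW g0)); lra.
by have := leq_card f inj; rewrite !card_ord ltnn.
Qed.

End Extrema.

Section Scores.
Context {R : realType} {n : nat}.
Variable y : 'I_n.+1 -> R.
Implicit Types (psi phi : 'rV[R]_n.+1) (x : R).

Definition score psi i x := psi 0 i - (x - y i) ^+ 2.
Definition best psi x := vmax (fun i => score psi i x).
Definition winner psi x : 'I_n.+1 :=
  projT1 (cid (vmax_attained (fun i => score psi i x))).

Lemma bestE psi x : best psi x = score psi (winner psi x) x.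
Proof. by rewrite /best /winner; case: cid. Qed.

Lemma score_le_best psi i x : score psi i x <= best psi x.
Proof. exact: (vmax_ge (fun i => score psi i x)). Qed.

Lemma scoreB psi phi i x : score phi i x - score psi i x = (phi - psi) 0 i.
Proof. by rewrite /score !mxE; ring. Qed.

Lemma bestB_bounds psi phi x :
  (phi - psi) 0 (winner psi x) <= best phi x - best psi x <= (phi - psi) 0 (winner phi x).
Proof.
have h1 := score_le_best phi (winner psi x) x.
have h2 := score_le_best psi (winner phi x) x.
rewrite -(scoreB _ _ _ x) -(scoreB _ _ (winner phi x) x) (bestE psi) (bestE phi).
by rewrite (bestE psi) in h2; rewrite (bestE phi) in h1; apply/andP; split; lra.
Qed.

Lemma best_dist psi phi x : `|best phi x - best psi x| <= `|phi - psi|.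
Proof. by apply: vmax_dist => i; rewrite scoreB coord_le_norm. Qed.

Lemma continuous_score psi i : continuous (score psi i).
Proof.
move=> x; rewrite /score; apply: cvgB; first exact: cvg_cst.
by rewrite expr2; apply: cvgM; apply: cvgB; (exact: cvg_id || exact: cvg_cst).
Qed.

Lemma continuous_best psi : continuous (best psi).
Proof.
move=> x; apply/cvgrPdist_le => e e0.
have : \forall z \near x, forall i, `|score psi i x - score psi i z| <= e.
  have h i : \forall z \near x, `|score psi i x - score psi i z| <= e.
    have /cvgrPdist_le cv := @continuous_score psi i x.
    exact: cv.
  exact: filter_forall h.
by apply: filterS => z hz; apply: vmax_dist.
Qed.

Lemma meas_score psi i : measurable_fun setT (score psi i).
Proof. by apply: continuous_measurable_fun; exact: continuous_score. Qed.

Lemma meas_best psi : measurable_fun setT (best psi).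
Proof. by apply: continuous_measurable_fun; exact: continuous_best. Qed.

(** Integrand of the i-th mass over the closed cell: a tie is counted in every tied cell. Ties are
    null by [aes_untied]. *)
Definition cellf (sg : R -> R) psi i x : R :=
  if best psi x <= score psi i x then sg (score psi i x) else 0.

Lemma meas_cellf sg psi i : measurable_fun setT sg ->
  measurable_fun setT (cellf sg psi i).
Proof.
move=> msg; apply: measurable_fun_ifT => //.
- by apply: measurable_fun_ler; [exact: meas_best|exact: meas_score].
- by apply: measurableT_comp => //; exact: meas_score.
Qed.

Definition untied psi x := forall i, i != winner psi x -> score psi i x < best psi x.

Lemma cellf_sum sg psi x (d : 'I_n.+1 -> R) : untied psi x ->
  \sum_(i < n.+1) cellf sg psi i x * d i = sg (best psi x) * d (winner psi x).
Proof.
move=> ut; rewrite (bigD1 (winner psi x))//= big1 ?addr0.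
  by rewrite /cellf -bestE lexx.
by move=> i /ut h; rewrite /cellf leNgt h mul0r.
Qed.

(** The potential cancels between two values of one score, so a single constant serves every [psi];
    interval lengths can be fixed before the perturbation is known. *)
Lemma score_lip (a b : R) : exists2 L, 0 < L & forall psi i x z,
  a <= x <= b -> a <= z <= b -> `|score psi i x - score psi i z| <= L * `|x - z|.
Proof.
pose L := vmax (fun i => `|a - y i| + `|b - y i|).
have L0 : 0 <= L.
  by apply: (le_trans _ (vmax_ge (fun i => `|a - y i| + `|b - y i|) ord0)); rewrite addr_ge0.
exists (2 * L + 1); first lra.
move=> psi i x z hx hz.
have -> : score psi i x - score psi i z = (- (x - y i) - (z - y i)) * (x - z).
  by rewrite /score; ring.
rewrite normrM ler_wpM2r//.
have : `|a - y i| + `|b - y i| <= L by exact: (vmax_ge (fun i => `|a - y i| + `|b - y i|)).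
have b1 u : a <= u <= b -> `|u - y i| <= `|a - y i| + `|b - y i|.
  move=> hu; rewrite ler_norml; apply/andP; split.
    have := ler_norm (- (a - y i)); rewrite normrN; have := normr_ge0 (b - y i); lra.
  have := ler_norm (b - y i); have := normr_ge0 (a - y i); lra.
have := b1 _ hx; have := b1 _ hz.
have := ler_normB (- (x - y i)) (z - y i); rewrite normrN; lra.
Qed.

Lemma best_lip (a b : R) : exists2 L, 0 < L & forall psi x z,
  a <= x <= b -> a <= z <= b -> `|best psi x - best psi z| <= L * `|x - z|.
Proof.
have [L L0 h] := score_lip a b; exists L => // psi x z hx hz.
by apply: vmax_dist => i; exact: h.
Qed.

Variables (rho : probability (measurableTypeR R) R) (a b m M : R) (dens : R -> R).
Hypothesis law : regular_law rho a b m M dens.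
Hypothesis y_inj : injective y.

(** The squares of x cancel between two scores, leaving an affine equation of nonzero slope: two
    distinct sites tie at a single point, and the law has no atoms. *)
Lemma aes_untied psi : aes rho (untied psi).
Proof.
pose c i j := (psi 0 i - psi 0 j + y j ^+ 2 - y i ^+ 2) / (2 * (y j - y i)).
have : aes rho (fun x => forall ij : 'I_n.+1 * 'I_n.+1, x != c ij.1 ij.2).
  by apply: aes_all => -[i j]; apply: (rl_pt law).
apply: aes_mp => x hx i ip; rewrite lt_neqAle score_le_best andbT.
apply/eqP; rewrite bestE => e; have /eqP := hx (i, winner psi x); apply; rewrite /c /=.
move: e; rewrite /score => e.
have d0 : y (winner psi x) - y i != 0 by rewrite subr_eq0; apply: contra_neq ip => /y_inj.
have -> : psi 0 i - psi 0 (winner psi x) + y (winner psi x) ^+ 2 - y i ^+ 2 =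
    - (2 * (y (winner psi x) - y i)) * - x by lra.
by field.
Qed.

End Scores.

(** * The regularized weight and its limit *)

Section RealLine.
Context {R : realType}.
Implicit Types e s t : R.

Lemma ivt_between (f : R -> R) x z v : continuous f -> f x <= v -> v <= f z ->
  exists2 c, Num.min x z <= c <= Num.max x z & f c = v.
Proof.
move=> cf fx fz; have [xz|zx] := leP x z.
  have [|c] := @IVT R f x z v xz (continuous_subspaceT cf).
    by rewrite ge_min le_max fx fz orbT.
  by rewrite in_itv /=; exists c.
have [|c] := @IVT R f z x v (ltW zx) (continuous_subspaceT cf).
  by rewrite ge_min le_max fx fz orbT.
by rewrite in_itv /=; exists c.
Qed.

Lemma pos_lower n (F : 'I_n -> R) : (forall i, 0 < F i) ->
  exists2 e, 0 < e & forall i, e <= F i.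
Proof.
elim: n F => [|n IH] F F0; first by exists 1 => // -[].
have [e e0 he] := IH (fun i => F (lift ord0 i)) (fun i => F0 _).
exists (Num.min e (F ord0)); first by rewrite lt_min e0 F0.
move=> i; have [->|ij] := eqVneq i ord0; first by rewrite ge_min lexx orbT.
case: (unliftP ord0 i) ij => [j -> _|->]; last by rewrite eqxx.
by rewrite ge_min he.
Qed.

(* [sig e t] is fstar' (t / e^2); [step] is its limit as e tends to 0. *)
Definition sig (e t : R) : R := Num.min (Num.sqrt t / e) 1.
Definition step (t : R) : R := (0 < t)%R%:R.

Lemma continuous_sig e : continuous (sig e).
Proof.
move=> t; apply: (@continuous_min R R (fun t => Num.sqrt t / e) (fun=> 1)).
  by apply: cvgM; [exact: sqrt_continuous|exact: cvg_cst].
exact: cvg_cst.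
Qed.

Lemma sig_bounds e t : 0 < e -> 0 <= sig e t <= 1.
Proof.
by move=> e0; rewrite le_min ge_min lexx orbT ler01 divr_ge0 ?sqrtr_ge0// ltW.
Qed.

Lemma sig_homo e : 0 < e -> {homo sig e : s t / s <= t}.
Proof.
move=> e0 s t st; rewrite /sig le_min ge_min; apply/andP; split; last first.
  by rewrite ge_min lexx orbT.
by rewrite ler_pM2r ?invr_gt0// ler_wsqrtr.
Qed.

Lemma sig_gt0 e t : 0 < e -> 0 < t -> 0 < sig e t.
Proof. by move=> e0 t0; rewrite lt_min ltr01 andbT divr_gt0// sqrtr_gt0. Qed.

Lemma sig_le0 e t : t <= 0 -> sig e t = 0.
Proof. by move=> t0; rewrite /sig ler0_sqrtr// mul0r; apply/min_idPl; exact: ler01. Qed.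

Lemma sig_sqrt e t : 0 < e -> t <= e ^+ 2 -> sig e t = Num.sqrt t / e.
Proof.
move=> e0 te; apply/min_idPl; rewrite ler_pdivrMr// mul1r.
by rewrite -[leRHS]gtr0_norm// -sqrtr_sqr ler_wsqrtr.
Qed.

Lemma sig_one e t : 0 < e -> e ^+ 2 <= t -> sig e t = 1.
Proof.
move=> e0 te; apply/min_idPr; rewrite ler_pdivlMr// mul1r.
by rewrite -[leLHS]gtr0_norm// -sqrtr_sqr ler_wsqrtr.
Qed.

(** With p and q the roots of s and t, the claim reduces to (p - q)^2 (p + q)^2 <= 2 e (p - q)^2 (p
    + q), and p + q <= 2 e because both values lie below the cap. *)
Lemma sig_strong e s t : 0 < e -> 0 <= s <= e ^+ 2 -> 0 <= t <= e ^+ 2 ->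
  (s - t) ^+ 2 / (2 * e ^+ 2) <= (sig e s - sig e t) * (s - t).
Proof.
move=> e0 /andP[s0 se] /andP[t0 te]; rewrite !sig_sqrt//.
have es u : 0 <= u -> u <= e ^+ 2 -> Num.sqrt u <= e.
  by move=> u0 ue; rewrite -[leRHS]gtr0_norm// -sqrtr_sqr ler_wsqrtr.
have se' := es _ s0 se; have te' := es _ t0 te.
have ps := sqrtr_ge0 s; have pt := sqrtr_ge0 t.
move: (sqr_sqrtr s0) (sqr_sqrtr t0) se' te' ps pt.
move: (Num.sqrt s) (Num.sqrt t) => p q <- <- pe qe p0 q0.
have -> : (p / e - q / e) * (p ^+ 2 - q ^+ 2) =
   (2 * e * ((p - q) ^+ 2 * (p + q))) / (2 * e ^+ 2) by field; lra.
rewrite ler_pM2r ?invr_gt0 ?mulr_gt0 ?exprn_gt0//.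
rewrite (_ : (p ^+ 2 - q ^+ 2) ^+ 2 = (p + q) * ((p - q) ^+ 2 * (p + q))); last by ring.
by apply: ler_wpM2r; [rewrite mulr_ge0 ?sqr_ge0// addr_ge0|lra].
Qed.

Lemma meas_sig e : measurable_fun setT (sig e).
Proof. by apply: continuous_measurable_fun; exact: continuous_sig. Qed.

Lemma meas_step : measurable_fun setT step.
Proof.
have -> : step = (fun t => if 0 < t then 1 else 0).
  by apply/funext => t; rewrite /step; case: (0 < t).
by apply: measurable_fun_ifT => //; apply: measurable_fun_ltr.
Qed.

Lemma step_bounds t : 0 <= step t <= 1.
Proof. by rewrite /step; case: (0 < t); rewrite ?lexx ?ler01. Qed.

Lemma step_homo : {homo step : s t / s <= t}.
Proof. by move=> s t st; rewrite /step; have [s0|s0] := ltP 0 s; rewrite ?(lt_le_trans s0 st) ?lexx ?ler0n. Qed.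

End RealLine.


(** * Monotonicity of the mass map *)

Section Monotonicity.
Context {R : realType} {n : nat}.
Variable y : 'I_n.+1 -> R.
Variables (rho : probability (measurableTypeR R) R) (a b m M : R) (dens : R -> R).
Hypothesis law : regular_law rho a b m M dens.
Hypothesis y_inj : injective y.
Implicit Types (psi phi : 'rV[R]_n.+1) (x : R) (sg : R -> R).

Definition mass sg psi i := \int[rho]_x cellf y sg psi i x.

(** Integrand of the pairing of G(phi) - G(psi) with phi - psi, see [E_gain]: pointwise lower bounds
    on it become monotonicity of the masses. *)
Definition gain sg psi phi x :=
  \sum_(i < n.+1) (cellf y sg phi i x - cellf y sg psi i x) * (phi - psi) 0 i.

(** As z may be an end of [a, b], the interval is taken on whichever side of z has room; l <= (b -
    a) / 2 guarantees one. *)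
Lemma interval_near z l : a <= z <= b -> 0 <= l <= (b - a) / 2 ->
  exists c d, [/\ a <= c, c <= d, d <= b, d - c = l & forall x, c < x < d -> `|x - z| <= l].
Proof.
move=> /andP[az zb] /andP[l0 lab].
have [zm|mz] := leP z ((a + b) / 2).
  exists z, (z + l); split; [lra|lra|lra|lra|].
  by move=> x /andP[zx xl]; rewrite ler_norml; lra.
exists (z - l), z; split; [lra|lra|lra|lra|].
by move=> x /andP[zx xl]; rewrite ler_norml; lra.
Qed.

Lemma E_lower (D : R -> R) z l k : intg rho D -> aes rho (fun x => 0 <= D x) ->
  a <= z <= b -> 0 <= l <= (b - a) / 2 -> 0 <= k ->
  aes rho (fun x => a <= x <= b -> `|x - z| <= l -> k <= D x) ->
  k * m * l <= \int[rho]_x D x.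
Proof.
move=> iD D0 hz hl k0 hD; have [c [d [ac cd db dcl near_z]]] := interval_near hz hl.
apply: (@le_trans _ _ (\int[rho]_x (k * (c < x < d)%R%:R))).
  rewrite E_Z; last exact: intg_itvoo.
  by rewrite -mulrA ler_wpM2l// -dcl; apply: (rl_lo law).
apply: E_le_ae => //; first by apply: intgZ; exact: intg_itvoo.
apply: aes_mp (aes_and D0 hD) => x [Dx0 hx].
have [hcd|_] := boolP (c < x < d); last by rewrite mulr0.
by rewrite mulr1; apply: hx; [move/andP: hcd => [? ?]; apply/andP; split; lra|exact: near_z].
Qed.

Section Weight.
Variable sg : R -> R.
Hypothesis sg_meas : measurable_fun setT sg.
Hypothesis sg_bounds : forall t, 0 <= sg t <= 1.
Hypothesis sg_homo : {homo sg : s t / s <= t}.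

Lemma cellf_bounds psi i x : 0 <= cellf y sg psi i x <= 1.
Proof. by rewrite /cellf; case: ifP => _ //; rewrite lexx ler01. Qed.

Lemma intg_cellf psi i : intg rho (cellf y sg psi i).
Proof.
apply: (@intg_bnd _ _ _ 1); first exact: meas_cellf.
by move=> x; have /andP[h0 h1] := cellf_bounds psi i x; rewrite ger0_norm.
Qed.

Lemma intg_gain psi phi : intg rho (gain sg psi phi).
Proof.
apply: intg_sum => i.
have -> : (fun x => (cellf y sg phi i x - cellf y sg psi i x) * (phi - psi) 0 i) =
  (fun x => (phi - psi) 0 i * (cellf y sg phi i x - cellf y sg psi i x)).
  by apply/funext => x; rewrite mulrC.
by apply: intgZ; apply: intgB; exact: intg_cellf.
Qed.

Lemma E_gain psi phi : \int[rho]_x gain sg psi phi x =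
  \sum_(i < n.+1) (mass sg phi i - mass sg psi i) * (phi - psi) 0 i.
Proof.
rewrite /gain E_sum.
  apply: eq_bigr => i _.
  under [LHS]eq_E do rewrite mulrC.
  rewrite E_Z; last by apply: intgB; exact: intg_cellf.
  by rewrite E_B 1?mulrC//; exact: intg_cellf.
move=> i.
have -> : (fun x => (cellf y sg phi i x - cellf y sg psi i x) * (phi - psi) 0 i) =
  (fun x => (phi - psi) 0 i * (cellf y sg phi i x - cellf y sg psi i x)).
  by apply/funext => x; rewrite mulrC.
by apply: intgZ; apply: intgB; exact: intg_cellf.
Qed.

Lemma gainE psi phi x : untied y psi x -> untied y phi x ->
  gain sg psi phi x = sg (best y phi x) * (phi - psi) 0 (winner y phi x)
    - sg (best y psi x) * (phi - psi) 0 (winner y psi x).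
Proof.
move=> u1 u2; rewrite /gain.
under eq_bigr do rewrite mulrBl.
by rewrite sumrB !cellf_sum.
Qed.

(* With w the variation of the best score, delta_I <= w <= delta_J for the old and new winners I, J:
   the gain splits into the three nonnegative terms
   sg(new) (delta_J - w) + (sg(new) - sg(old)) w + sg(old) (w - delta_I). *)
Lemma gain_lower psi phi x : untied y psi x -> untied y phi x ->
  let w := best y phi x - best y psi x in
  [/\ 0 <= gain sg psi phi x,
     sg (best y psi x) * (w - (phi - psi) 0 (winner y psi x)) <= gain sg psi phi x &
     (sg (best y phi x) - sg (best y psi x)) * w <= gain sg psi phi x].
Proof.
move=> u1 u2 w; rewrite gainE//.
have /andP[dI dJ] := bestB_bounds y psi phi x; rewrite -/w in dI dJ.
move: dI dJ; move: ((phi - psi) 0 (winner y psi x)) => dI.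
move: ((phi - psi) 0 (winner y phi x)) => dJ hI hJ.
have /andP[s0 _] := sg_bounds (best y psi x).
have /andP[t0 _] := sg_bounds (best y phi x).
have h1 : 0 <= sg (best y phi x) * (dJ - w) by rewrite mulr_ge0// subr_ge0.
have h2 : 0 <= sg (best y psi x) * (w - dI) by rewrite mulr_ge0// subr_ge0.
have h3 : 0 <= (sg (best y phi x) - sg (best y psi x)) * w.
  have [w0|w0] := leP 0 w.
    by rewrite mulr_ge0// subr_ge0 sg_homo// -subr_ge0.
  rewrite mulr_le0 ?(ltW w0)// subr_le0 sg_homo//.
  by rewrite -subr_le0 ltW.
split; lra.
Qed.

Lemma gain_ge0 psi phi : aes rho (fun x => 0 <= gain sg psi phi x).
Proof.
apply: aes_mp (aes_and (aes_untied law y_inj psi) (aes_untied law y_inj phi)) => x [u1 u2].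
by have [] := gain_lower u1 u2.
Qed.

Lemma E_gain_ge0 psi phi : 0 <= \int[rho]_x gain sg psi phi x.
Proof. by apply: E_ge0_ae; [exact: intg_gain|exact: gain_ge0]. Qed.

End Weight.

End Monotonicity.

(** * Strong monotonicity *)

Section StrongMonotonicity.
Context {R : realType} {n : nat}.
Variable y : 'I_n.+1 -> R.
Variables (rho : probability (measurableTypeR R) R) (a b m M : R) (dens : R -> R).
Hypothesis law : regular_law rho a b m M dens.
Hypothesis y_inj : injective y.
Implicit Types (psi phi : 'rV[R]_n.+1) (x : R) (sg : R -> R).

Definition strictly_best psi k x := forall j, j != k -> score y psi j x < score y psi k x.

Lemma strictly_best_winner psi k x : strictly_best psi k x -> winner y psi x = k.
Proof.
move=> h; apply/eqP/negPn/negP => /h.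
by rewrite -bestE ltNge score_le_best.
Qed.

(** A score moves by at most |phi - psi|, so a third of the smallest gap suffices. Old and new
    potentials then share a point in each cell, where the best score varies by exactly the increment
    of that cell. *)
Lemma strictly_best_stable psi (X : 'I_n.+1 -> R) :
  (forall k, strictly_best psi k (X k)) ->
  exists2 r, 0 < r & forall phi, `|phi - psi| <= r -> forall k, strictly_best phi k (X k).
Proof.
move=> hX.
have hk k : exists2 r, 0 < r & forall j, j != k -> r <= score y psi k (X k) - score y psi j (X k).
  pose F j := if j == k then 1 else score y psi k (X k) - score y psi j (X k).
  have [|r r0 hr] := @pos_lower R n.+1 F.
    by move=> j; rewrite /F; case: eqVneq => // jk; rewrite subr_gt0 hX.
  by exists r => // j jk; have := hr j; rewrite /F (negbTE jk).
pose rk k := projT1 (cid2 (hk k)).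
have rk0 k : 0 < rk k by rewrite /rk; case: cid2.
have rkP k : forall j, j != k -> rk k <= score y psi k (X k) - score y psi j (X k).
  by rewrite /rk; case: cid2.
have [r r0 hr] := pos_lower rk0.
exists (r / 3); first by rewrite divr_gt0.
move=> phi hphi k j jk.
have h1 := rkP k j jk; have h2 := hr k.
have h3 := scoreB y psi phi k (X k); have h4 := scoreB y psi phi j (X k).
have h5 := coord_le_norm (phi - psi) k; have h6 := coord_le_norm (phi - psi) j.
move: h3 h4 h5 h6; move: ((phi - psi) 0 k) ((phi - psi) 0 j) => dk dj h3 h4.
move=> h5 h6; have := le_trans h5 hphi; have := le_trans h6 hphi.
rewrite !ler_norml; lra.
Qed.

(* A point z where |w| sits at distance g from every |delta_i|: near z the winning
   increment cannot agree with w. *)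
Lemma off_level (F : 'I_n.+1 -> R) g mu w i : (forall i, g <= `| `|F i| - mu|) ->
  `| `|w| - mu| <= g / 2 -> F i <= w -> g / 2 <= w - F i.
Proof.
move=> hF hw Fw; have := hF i.
have := ler_dist_dist w (F i); rewrite (ger0_norm (_ : 0 <= w - F i)) ?subr_ge0//.
have := ler_distD (`|w|) `|F i| mu; rewrite (distrC `|F i| `|w|); lra.
Qed.

(** The points in the cells provide a place of positive score with |w| = |delta|. The point of best
    score below e^2 is the other end of a path along which either |w| crosses [mu] or the score
    comes below the cap. *)
Lemma strong_mono_sig e psi : 0 < e ->
  (forall k, exists x, [/\ a <= x <= b, strictly_best psi k x & 0 < score y psi k x]) ->
  (exists2 x, a <= x <= b & best y psi x < e ^+ 2) ->
  exists2 c, 0 < c & exists2 r, 0 < r & forall phi, `|phi - psi| <= r ->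
    c * `|phi - psi| ^+ 2 <= \int[rho]_x gain y (sig e) psi phi x.
Proof.
move=> e0 hcell [x0 hx0 hb0].
pose X k := projT1 (cid (hcell k)).
have XP k : [/\ a <= X k <= b, strictly_best psi k (X k) & 0 < score y psi k (X k)].
  by rewrite /X; case: cid.
have Xs k : strictly_best psi k (X k) by have [] := XP k.
have Xp k : 0 < score y psi k (X k) by have [] := XP k.
have [r1 r10 hr1] := strictly_best_stable Xs.
have [eta1 eta10 heta1] := pos_lower Xp.
have ab := rl_ab law; have m0 := rl_m law.
have [L L0 hL] := best_lip y a b.
(* The factor 8 leaves room for thresholds at multiples of eta, each of which may shift by eta
   through a move of x and by another eta through the passage from [psi] to [phi]. *)
pose eta := Num.min eta1 (Num.min (e ^+ 2) (e ^+ 2 - best y psi x0)) / 8.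
have eta0 : 0 < eta by rewrite divr_gt0// !lt_min eta10 exprn_gt0// subr_gt0.
have [he1 he2 he3] : [/\ 8 * eta <= eta1, 8 * eta <= e ^+ 2 & 8 * eta <= e ^+ 2 - best y psi x0].
  have -> : 8 * eta = Num.min eta1 (Num.min (e ^+ 2) (e ^+ 2 - best y psi x0)).
    by rewrite /eta; field.
  by rewrite !ge_min !lexx !orbT.
pose N : R := n.+2%:R.
have N0 : 0 < N by rewrite ltr0n.
have N1 : 1 <= N by rewrite ler1n.
pose l2 := Num.min (eta / L) ((b - a) / 2).
have l20 : 0 < l2 by rewrite lt_min (divr_gt0 eta0 L0) divr_gt0 ?subr_gt0//.
(* Weight, gap, density and length of the first case, with |delta|^2 factored out: the gap is g / 2
   and the length g / (4 L), where g = |delta| / (4 N). *)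
pose c1 := sig e eta * (1 / (4 * N) / 2) * m * (1 / (4 * N) / (4 * L)).
(* Second case: |w| > |delta| / 2 turns the w^2 / (2 e^2) of [sig_strong] into |delta|^2 / (8 e^2),
   on an interval whose length l2 does not depend on [phi]. *)
pose c2 := 1 / (8 * e ^+ 2) * m * l2.
have c10 : 0 < c1.
  by rewrite /c1 !mulr_gt0// ?sig_gt0// ?divr_gt0 ?mulr_gt0// ?invr_gt0 ?mulr_gt0.
have c20 : 0 < c2 by rewrite /c2 !mulr_gt0 ?invr_gt0 ?mulr_gt0 ?exprn_gt0.
exists (Num.min c1 c2); first by rewrite lt_min c10.
(* Below r1 the points X k stay in their cells, below eta the new best score stays between 0 and e^2
   where this matters, and below L (b - a) the short interval fits into [a, b]. *)
exists (Num.min r1 (Num.min eta (L * (b - a)))).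
  by rewrite !lt_min r10 eta0 mulr_gt0// subr_gt0.
move=> phi; rewrite !le_min => /and3P[hr hre hrL].
have G0 := E_gain_ge0 law y_inj (meas_sig e) (fun t => sig_bounds t e0) (sig_homo e0) psi phi.
set d := `|phi - psi| in hr hre hrL *.
have [d0|d0] := eqVneq d 0; first by rewrite d0 expr0n /= mulr0.
have {}d0 : 0 < d by rewrite lt_neqAle eq_sym d0 normr_ge0.
have [k hk] := norm_attained (phi - psi).
have [mu /andP[mu1 mu2] hmu] := avoiding_level (fun i => `|(phi - psi) 0 i|) d0.
set g := d / (4 * N) in hmu.
have g0 : 0 < g by rewrite divr_gt0// mulr_gt0.
have gE : g = d * (1 / (4 * N)) by rewrite /g; field; rewrite gt_eqF.
have gd : 4 * g <= d.
  have -> : 4 * g = d / N by rewrite /g; field; rewrite gt_eqF.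
  by rewrite ler_pdivrMr// ler_peMr// ltW.
pose w x := best y phi x - best y psi x.
have cw : continuous w by move=> x; apply: cvgB; exact: continuous_best.
have caw : continuous (fun x => `|w x|) by move=> x; apply: cvg_norm; exact: cw.
have wd x : `|w x| <= d by exact: best_dist.
have wX : `|w (X k)| = d.
  have [_ hs _] := XP k.
  have := bestB_bounds y psi phi (X k).
  rewrite (strictly_best_winner hs) (strictly_best_winner (hr1 _ hr k)).
  by rewrite -eq_le eq_sym => /eqP wk; rewrite /w wk hk.
have wL x z : a <= x <= b -> a <= z <= b -> `|w x - w z| <= 2 * L * `|x - z|.
  move=> hx hz; have := hL phi _ _ hx hz; have := hL psi _ _ hx hz.
  by rewrite /w !ler_norml; clear -law y_inj; lra.
have [[z [hz wz bz]]|noev] :=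
    pselect (exists z, [/\ a <= z <= b, `|w z| = mu & 2 * eta <= best y psi z]).
  apply: (@le_trans _ _ (c1 * d ^+ 2)).
    by rewrite ler_wpM2r ?sqr_ge0// ge_min lexx.
  have -> : c1 * d ^+ 2 = (sig e eta * (g / 2)) * m * (g / (4 * L)).
    by rewrite /c1 gE; ring.
  apply: (E_lower law (z := z)) => //.
  - exact: intg_gain (meas_sig e) (fun t => sig_bounds t e0) _ _.
  - by apply: (gain_ge0 law y_inj) => [t|]; [exact: sig_bounds|exact: sig_homo].
  - apply/andP; split; first by rewrite ltW// divr_gt0// mulr_gt0.
    by rewrite ler_pdivrMr ?mulr_gt0//; move: gd g0 hrL; clear -law y_inj; lra.
  - by rewrite ltW// mulr_gt0 ?sig_gt0// divr_gt0.
  apply: aes_mp (aes_and (aes_untied law y_inj psi) (aes_untied law y_inj phi)).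
  move=> x [u1 u2] hx xz.
  have [_ h1 _] := gain_lower (fun t => sig_bounds t e0) (sig_homo e0) u1 u2.
  apply: (le_trans _ h1).
  have Lxz : L * `|x - z| <= g / 4.
    by rewrite mulrC -ler_pdivlMr//; apply: (le_trans xz); rewrite le_eqVlt; apply/orP; left; apply/eqP; field; rewrite gt_eqF.
  have bx : eta <= best y psi x.
    have := hL psi _ _ hx hz; move: bz g0 gd hre Lxz; rewrite ler_norml; clear -law y_inj; lra.
  apply: ler_pM; [by have /andP[] := sig_bounds eta e0|by rewrite divr_ge0// ltW|exact: sig_homo|].
  apply: (@off_level (fun i => (phi - psi) 0 i) g mu) => //.
    rewrite -wz; apply: (le_trans (ler_dist_dist _ _)).
    by have := wL _ _ hx hz; move: Lxz; clear -law y_inj; lra.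
  by have /andP[] := bestB_bounds y psi phi x.
have [z [hz wz bz]] : exists z, [/\ a <= z <= b, mu < `|w z| &
    4 * eta <= best y psi z <= e ^+ 2 - 3 * eta].
  have [hXk hs _] := XP k.
  have bX : best y psi (X k) = score y psi k (X k) by rewrite bestE (strictly_best_winner hs).
  have bX8 : 8 * eta <= best y psi (X k) by rewrite bX (le_trans he1)// heta1.
  have [low|high] := leP (best y psi (X k)) (e ^+ 2 - 3 * eta).
    by exists (X k); split => //; [rewrite wX|move: low bX8 eta0; clear -law y_inj; lra].
  (* A zero of q has |w| >= mu and score at least e^2 - 3 eta, with equality in one of them.
     Equality in the first contradicts [noev], so the score equals e^2 - 3 eta there. *)
  pose q x := Num.min (`|w x| - mu) (best y psi x - (e ^+ 2 - 3 * eta)).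
  have cq : continuous q.
    move=> x; apply: (@continuous_min R R (fun x => `|w x| - mu)
        (fun x => best y psi x - (e ^+ 2 - 3 * eta))).
      by apply: cvgB; [exact: caw|exact: cvg_cst].
    by apply: cvgB; [exact: continuous_best|exact: cvg_cst].
  have q0 : q x0 <= 0 by rewrite ge_min; apply/orP; right; move: he3 eta0; clear -law y_inj; lra.
  have qX : 0 <= q (X k) by by rewrite le_min wX !subr_ge0 (ltW mu2) (ltW high).
  have [z hz qz] := ivt_between cq q0 qX.
  have hz' : a <= z <= b.
    move: hz; rewrite ge_min le_max => /andP[h1 h2].
    move: hx0 hXk => /andP[? ?] /andP[? ?]; apply/andP; split.
      by case/orP: h1; apply: le_trans.
    by case/orP: h2 => /le_trans; apply.
  have : 0 <= `|w z| - mu by rewrite -qz ge_min lexx.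
  have : 0 <= best y psi z - (e ^+ 2 - 3 * eta) by rewrite -qz ge_min lexx orbT.
  move=> h1 h2.
  have wne : `|w z| != mu.
    by apply/eqP => wz; apply: noev; exists z; split => //; move: h1 he2 eta0; clear -law y_inj; lra.
  have {}h2 : mu < `|w z| by rewrite lt_neqAle eq_sym wne -subr_ge0.
  exists z; split => //.
  move: qz h1 h2 he2 eta0; rewrite /q /Num.min; case: ifP => _; clear -law y_inj; lra.
apply: (@le_trans _ _ (c2 * d ^+ 2)).
  by rewrite ler_wpM2r ?sqr_ge0// ge_min lexx orbT.
have -> : c2 * d ^+ 2 = (d ^+ 2 / (8 * e ^+ 2)) * m * l2.
  by rewrite /c2; field; rewrite gt_eqF.
apply: (E_lower law (z := z)) => //.
- exact: intg_gain (meas_sig e) (fun t => sig_bounds t e0) _ _.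
- by apply: (gain_ge0 law y_inj) => [t|]; [exact: sig_bounds|exact: sig_homo].
- by rewrite ltW//= ge_min lexx orbT.
- by rewrite divr_ge0 ?sqr_ge0// mulr_ge0// sqr_ge0.
apply: aes_mp (aes_and (aes_untied law y_inj psi) (aes_untied law y_inj phi)).
move=> x [u1 u2] hx xz.
have [_ _ h1] := gain_lower (fun t => sig_bounds t e0) (sig_homo e0) u1 u2.
apply: (le_trans _ h1).
have Lle u : `|u - z| <= `|x - z| -> L * `|u - z| <= eta.
  move=> uz; rewrite mulrC -ler_pdivlMr// (le_trans uz)// (le_trans xz)//.
  by rewrite ge_min lexx.
(* If |w| were at most mu at x, it would equal mu somewhere between x and z, at a point whose score
   is still at least 2 eta, against [noev]. *)
have wx : mu < `|w x|.
  rewrite ltNge; apply/negP => wx; apply: noev.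
  have [u hu wu] := ivt_between caw wx (ltW wz).
  have hu' : a <= u <= b /\ `|u - z| <= `|x - z|.
    move: hu hx hz => /andP[]; rewrite ge_min le_max => h2 h3 /andP[? ?] /andP[? ?].
    split.
      apply/andP; split; first by case/orP: h2; apply: le_trans.
      by case/orP: h3 => /le_trans; apply.
    have [xz'|xz'] := leP x z.
      have xu : x <= u by case/orP: h2 => // zu; exact: le_trans zu.
      have uz : u <= z by case/orP: h3 => // ux; exact: le_trans xz'.
      by rewrite !ler0_norm ?subr_le0// lerN2 lerD2r.
    have zu : z <= u by case/orP: h2 => // xu; exact: le_trans (ltW xz') xu.
    have ux : u <= x by case/orP: h3 => // uz; exact: le_trans uz (ltW xz').
    by rewrite !ger0_norm ?subr_ge0 ?(ltW xz')// lerD2r.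
  exists u; split => //; first exact: hu'.1.
  have := hL psi _ _ hu'.1 hz; have := Lle _ hu'.2; move: bz eta0; rewrite ler_norml; clear -law y_inj; lra.
have bx := hL psi _ _ hx hz; have lx := Lle x (lexx _).
have wdx := wd x.
have bx1 : 3 * eta <= best y psi x <= e ^+ 2 - 2 * eta by move: bx lx bz eta0; rewrite ler_norml; clear -law y_inj; lra.
have := @sig_strong R e (best y phi x) (best y psi x) e0.
have bp : best y phi x = best y psi x + w x by rewrite /w; ring.
move=> /(_ ltac:(rewrite bp; move: wdx bx1 hre eta0; rewrite ler_norml; clear -law y_inj; lra) ltac:(move: bx1 eta0; clear -law y_inj; lra)).
apply: le_trans.
have d4 : d ^+ 2 <= 4 * `|w x| ^+ 2.
  rewrite (_ : 4 * `|w x| ^+ 2 = (2 * `|w x|) ^+ 2); last by ring.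
  by rewrite ler_sqr ?nnegrE; move: mu1 wx d0; clear -law y_inj; lra.
rewrite -/(w x) real_normK ?num_real// in d4 *.
rewrite ler_pdivrMr ?mulr_gt0 ?exprn_gt0//.
by rewrite (_ : _ / _ * _ = 4 * w x ^+ 2)//; field; rewrite gt_eqF.
Qed.

(** Here w is the variation of the positive part of the best score. It vanishes at [x0], where the
    score is nonpositive for both potentials, and has modulus |delta| in the cell of the largest
    increment, so the level [mu] is always crossed. *)
Lemma strong_mono_step psi :
  (forall k, exists x, [/\ a <= x <= b, strictly_best psi k x & 0 < score y psi k x]) ->
  (exists2 x, a <= x <= b & best y psi x < 0) ->
  exists2 c, 0 < c & exists2 r, 0 < r & forall phi, `|phi - psi| <= r ->
    c * `|phi - psi| ^+ 2 <= \int[rho]_x gain y step psi phi x.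
Proof.
move=> hcell [x0 hx0 hb0].
pose X k := projT1 (cid (hcell k)).
have XP k : [/\ a <= X k <= b, strictly_best psi k (X k) & 0 < score y psi k (X k)].
  by rewrite /X; case: cid.
have Xs k : strictly_best psi k (X k) by have [] := XP k.
have Xp k : 0 < score y psi k (X k) by have [] := XP k.
have [r1 r10 hr1] := strictly_best_stable Xs.
have [eta1 eta10 heta1] := pos_lower Xp.
have ab := rl_ab law; have m0 := rl_m law.
have [L L0 hL] := best_lip y a b.
pose eta := Num.min eta1 (- best y psi x0).
have eta0 : 0 < eta by rewrite lt_min eta10 oppr_gt0.
pose N : R := n.+2%:R.
have N0 : 0 < N by rewrite ltr0n.
have N1 : 1 <= N by rewrite ler1n.
pose c1 := (1 / (4 * N) / 2) * m * (1 / (4 * N) / (4 * L)).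
have c10 : 0 < c1.
  by rewrite /c1 !mulr_gt0// ?divr_gt0 ?mulr_gt0// ?invr_gt0 ?mulr_gt0.
exists c1 => //.
exists (Num.min r1 (Num.min (eta / 2) (L * (b - a)))).
  by rewrite !lt_min r10 divr_gt0// mulr_gt0// subr_gt0.
move=> phi; rewrite !le_min => /and3P[hr hre hrL].
have G0 := E_gain_ge0 law y_inj meas_step step_bounds step_homo psi phi.
set d := `|phi - psi| in hr hre hrL *.
have [d0|d0] := eqVneq d 0; first by rewrite d0 expr0n /= mulr0.
have {}d0 : 0 < d by rewrite lt_neqAle eq_sym d0 normr_ge0.
have [k hk] := norm_attained (phi - psi).
have [mu /andP[mu1 mu2] hmu] := avoiding_level (fun i => `|(phi - psi) 0 i|) d0.
set g := d / (4 * N) in hmu.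
have g0 : 0 < g by rewrite divr_gt0// mulr_gt0.
have gE : g = d * (1 / (4 * N)) by rewrite /g; field; rewrite gt_eqF.
have gd : 4 * g <= d.
  have -> : 4 * g = d / N by rewrite /g; field; rewrite gt_eqF.
  by rewrite ler_pdivrMr// ler_peMr// ltW.
pose w x := Num.max 0 (best y phi x) - Num.max 0 (best y psi x).
have cw : continuous w.
  move=> x; apply: cvgB.
    by apply: (@continuous_max R R (fun=> 0) (best y phi)); [exact: cvg_cst|exact: continuous_best].
  by apply: (@continuous_max R R (fun=> 0) (best y psi)); [exact: cvg_cst|exact: continuous_best].
have caw : continuous (fun x => `|w x|) by move=> x; apply: cvg_norm; exact: cw.
have bd x : `|best y phi x - best y psi x| <= d by exact: best_dist.
have maxdist (s t : R) : `|Num.max 0 s - Num.max 0 t| <= `|s - t|.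
  rewrite ler_norml; have := ler_norm (s - t); have := ler_norm (- (s - t)).
  rewrite normrN /Num.max; case: ifP; case: ifP; clear -law y_inj; lra.
have [hXk _ _] := XP k.
have wX : `|w (X k)| = d.
  have := bestB_bounds y psi phi (X k).
  rewrite (strictly_best_winner (Xs k)) (strictly_best_winner (hr1 _ hr k)).
  rewrite -eq_le eq_sym => /eqP wk.
  have b1 : eta <= best y psi (X k).
    rewrite bestE (strictly_best_winner (Xs k)) (le_trans _ (heta1 k))//.
    by rewrite ge_min lexx.
  have b2 := bd (X k).
  have b3 : 0 <= best y phi (X k) by move: b1 b2 hre; rewrite ler_norml; clear -law y_inj; lra.
  by rewrite /w !max_r ?wk ?hk//; move: b1 eta0; clear -law y_inj; lra.
have w0 : w x0 = 0.
  have b1 : eta <= - best y psi x0 by rewrite ge_min lexx orbT.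
  have b2 := bd x0.
  have b3 : best y phi x0 <= 0 by move: b1 b2 hre; rewrite ler_norml; clear -law y_inj; lra.
  by rewrite /w !max_l ?subrr//; move: b1 eta0; clear -law y_inj; lra.
have wL x z : a <= x <= b -> a <= z <= b -> `|w x - w z| <= 2 * L * `|x - z|.
  move=> hx hz.
  have h1 := hL phi _ _ hx hz; have h2 := hL psi _ _ hx hz.
  have h3 := maxdist (best y phi x) (best y phi z).
  have h4 := maxdist (best y psi x) (best y psi z).
  have -> : w x - w z = (Num.max 0 (best y phi x) - Num.max 0 (best y phi z))
    - (Num.max 0 (best y psi x) - Num.max 0 (best y psi z)) by rewrite /w; ring.
  by rewrite (le_trans (ler_normB _ _))//; move: h1 h2 h3 h4; clear -law y_inj; lra.
have [z hz wz] : exists2 z, a <= z <= b & `|w z| = mu.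
  have mu0 : 0 <= mu by move: mu1 d0; clear -law y_inj; lra.
  have wa : `|w x0| <= mu by rewrite w0 normr0.
  have wb : mu <= `|w (X k)| by rewrite wX ltW.
  have [z hz wz] := ivt_between caw wa wb.
  exists z => //.
  move: hz; rewrite ge_min le_max => /andP[h1 h2].
  move: hx0 hXk => /andP[p1 p2] /andP[q1 q2]; apply/andP; split.
    by case/orP: h1; apply: le_trans.
  by case/orP: h2 => /le_trans; apply.
have -> : c1 * d ^+ 2 = (g / 2) * m * (g / (4 * L)).
  by rewrite /c1 gE; ring.
apply: (E_lower law (z := z)) => //.
- exact: intg_gain meas_step step_bounds _ _.
- by apply: (gain_ge0 law y_inj) => [t|]; [exact: step_bounds|exact: step_homo].
- apply/andP; split; first by rewrite ltW// divr_gt0// mulr_gt0.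
  by rewrite ler_pdivrMr ?mulr_gt0//; move: gd g0 hrL; clear -law y_inj; lra.
- by rewrite ltW// divr_gt0.
apply: aes_mp (aes_and (aes_untied law y_inj psi) (aes_untied law y_inj phi)).
move=> x [u1 u2] hx xz; rewrite gainE//.
have /andP[dI dJ] := bestB_bounds y psi phi x.
pose F i := (phi - psi) 0 i.
have J : w x <= step (best y phi x) * F (winner y phi x).
  rewrite /w /step; have [p0|p0] := ltP 0 (best y phi x).
    rewrite mul1r /F; have : best y psi x <= Num.max 0 (best y psi x) by rewrite le_max lexx orbT.
    by move: p0 dI dJ; rewrite -/(F _); clear -law y_inj; lra.
  by rewrite mul0r sub0r oppr_le0 le_max lexx.
apply: (@le_trans _ _ (w x - step (best y psi x) * F (winner y psi x))); last by rewrite lerD2r.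
have Lxz : L * `|x - z| <= g / 4.
  by rewrite mulrC -ler_pdivlMr//; apply: (le_trans xz); rewrite le_eqVlt; apply/orP; left; apply/eqP; field; rewrite gt_eqF.
have wmu : `| `|w x| - mu| <= g / 2.
  by rewrite -wz; apply: (le_trans (ler_dist_dist _ _)); have := wL _ _ hx hz; move: Lxz; clear -law y_inj; lra.
rewrite /step; have [p0|p0] := ltP 0 (best y psi x).
  rewrite mul1r; apply: (@off_level F g mu) => //.
  rewrite /w (max_r (ltW p0)) /F.
  have : best y phi x <= Num.max 0 (best y phi x) by rewrite le_max lexx orbT.
  by move: p0 dI dJ; clear -law y_inj; lra.
(* Where [psi] reaches nothing, w is nonnegative, so w itself is at least mu - g / 2; as mu > d / 2
   >= 2 g, this is more than g / 2. *)
have wx0 : 0 <= w x by rewrite /w (max_l p0) subr0 le_max lexx.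
by rewrite mul0r subr0; move: wmu mu1 gd d0 g0; rewrite (ger0_norm wx0) ler_norml; clear -law y_inj; lra.
Qed.

End StrongMonotonicity.

(** * The dual functional *)

Section UnderTheIntegral.
Context {R : realType}.
Variable rho : probability (measurableTypeR R) R.

Lemma cvg_le_eventually (u : nat -> R) (e : R) : u @ \oo --> (0 : R) -> 0 < e ->
  exists k, `|u k| <= e.
Proof.
move=> /cvgrPdist_le u0 e0; have [N _ hN] := u0 e e0.
by exists N; have := hN N (leqnn N); rewrite /= sub0r normrN.
Qed.

(* Abstract form: T indexes the perturbations and sz measures their size. *)
Lemma E_expansion (T : Type) (sz : T -> R) (F L : T -> R -> R) (F0 g : R -> R) (r : R) :
  0 < r -> (forall v, 0 <= sz v) ->
  (forall v, intg rho (F v)) -> intg rho F0 ->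
  (forall v, measurable_fun setT (L v)) -> intg rho g ->
  aes rho (fun x => forall v, sz v < r -> `|F v x - F0 x| <= g x * sz v) ->
  (forall v, aes rho (fun x => `|L v x| <= g x * sz v)) ->
  aes rho (fun x => forall eta, 0 < eta -> exists2 s, 0 < s &
    forall v, sz v < s -> `|F v x - F0 x - L v x| <= eta * sz v) ->
  forall eta, 0 < eta -> exists2 s, 0 < s & forall v, sz v < s ->
    `|\int[rho]_x F v x - \int[rho]_x F0 x - \int[rho]_x L v x| <= eta * sz v.
Proof.
move=> r0 sz0 iF iF0 mL ig hF hL hd eta eta0; apply: contrapT => no.
have iL v : intg rho (L v).
  have i2 : intg rho (fun x => `|g x| * sz v).
    have -> : (fun x => `|g x| * sz v) = (fun x => sz v * `|g x|) by apply/funext => x; rewrite mulrC.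
    by apply: intgZ; exact: intg_norm.
  apply: (@intg_le_ae _ _ _ (fun x => `|g x| * sz v)) => //.
  by apply: aes_mp (hL v) => x h; rewrite (le_trans h)// ler_wpM2r// ler_norm.
(* Dominated convergence is about sequences, so a failure of the bound is turned into violating
   perturbations of size below 1 / (k + 1). *)
have bad (k : nat) : exists v, sz v < Num.min r k.+1%:R^-1 /\
    eta * sz v < `|\int[rho]_x F v x - \int[rho]_x F0 x - \int[rho]_x L v x|.
  apply: contrapT => nb; apply: no; exists (Num.min r k.+1%:R^-1).
    by rewrite lt_min r0 invr_gt0 ltr0n.
  move=> v hv; rewrite leNgt; apply/negP => hh; apply: nb; by exists v.
pose v k := projT1 (cid (bad k)).
have [vr vk vb] : [/\ forall k, sz (v k) < r, forall k, sz (v k) < k.+1%:R^-1 &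
    forall k, eta * sz (v k) <
     `|\int[rho]_x F (v k) x - \int[rho]_x F0 x - \int[rho]_x L (v k) x|].
  by split => k; rewrite /v; case: cid => /= z []; rewrite lt_min => /andP[].
pose D k x := F (v k) x - F0 x - L (v k) x.
have iD k : intg rho (D k) by apply: intgB => //; apply: intgB.
have Db : aes rho (fun x => forall k, `|D k x| <= 2 * `|g x| * sz (v k)).
  apply: aes_mp (aes_and hF (aes_nat (fun k => hL (v k)))) => x [h1 h2] k.
  rewrite /D (le_trans (ler_normB _ _))//.
  have := h1 _ (vr k); have := h2 k.
  have : g x * sz (v k) <= `|g x| * sz (v k) by rewrite ler_wpM2r// ler_norm.
  lra.
(* At size zero the difference [D] vanishes almost everywhere, against the strict inequality [vb];
   dividing by the size is thus legitimate. *)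
have sp k : 0 < sz (v k).
  rewrite lt_neqAle sz0 andbT; apply/eqP => s0.
  have := vb k; rewrite -s0 mulr0.
  rewrite -E_B// -E_B//; last exact: intgB.
  rewrite ltNge => /negP; apply.
  apply: E_norm_le; first exact: (iD k).
  by apply: aes_mp Db => x /(_ k); rewrite -s0 mulr0.
pose q k x := D k x / sz (v k).
have q0 : (fun k => \int[rho]_x q k x) @ \oo --> \int[rho]_x (0 : R).
  apply: (@E_dct _ _ q (fun=> 0) (fun x => 2 * `|g x|)).
  - move=> k; apply: measurable_funM => //; exact: intg_meas (iD k).
  - exact: measurable_cst.
  - apply: aes_mp hd => x hx; apply/cvgrPdist_le => e e0.
    have [s s0 hs] := hx e e0.
    have [N hN] : exists N, s^-1 <= N%:R.
      by exists (Num.truncn s^-1).+1; apply/ltW/truncnS_gt.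
    exists N => // k /= Nk.
    rewrite sub0r normrN /q normrM normfV (gtr0_norm (sp k)) ler_pdivrMr//.
    apply: hs; apply: (lt_le_trans (vk k)).
    rewrite -[s in leRHS]invrK lef_pV2 ?posrE ?invr_gt0 ?ltr0n//.
    by apply: (le_trans hN); rewrite ler_nat (leq_trans Nk).
  - by apply: intgZ; exact: intg_norm.
  - apply: aes_mp Db => x hx k.
    by rewrite /q normrM normfV (gtr0_norm (sp k)) ler_pdivrMr.
rewrite E_cst in q0.
have [k hk] := cvg_le_eventually q0 eta0.
have := vb k; apply/negP; rewrite -leNgt.
have -> : \int[rho]_x F (v k) x - \int[rho]_x F0 x - \int[rho]_x L (v k) x =
    \int[rho]_x q k x * sz (v k).
  rewrite -E_B// -E_B//; last exact: intgB.
  rewrite mulrC -E_Z; last first.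
    have -> : q k = (fun x => (sz (v k))^-1 * D k x) by apply/funext => x; rewrite /q mulrC.
    exact: intgZ.
  by apply: eq_E => x; rewrite /q mulrC divfK// gt_eqF.
by rewrite normrM (gtr0_norm (sp k)) ler_pM2r.
Qed.

End UnderTheIntegral.

(** * Convexity and first-order expansion of fstar *)

Section FStar.
Context {R : realType}.
Implicit Types s t e : R.


Lemma fstar_le0 t : t <= 0 -> fstar t = 0.
Proof.
rewrite /fstar le_eqVlt => /predU1P[->|->//].
by rewrite ltxx ler01 powR0 ?mulr0// lt0r_neq0.
Qed.

Lemma fstar_mid t : 0 <= t <= 1 -> fstar t = 2 / 3 * Num.sqrt t ^+ 3.
Proof.
move=> /andP[t0 t1]; rewrite /fstar ltNge t0 t1 /=; congr (_ * _).
rewrite (_ : 3 / 2 = 2^-1 * 3%:R :> R); last by field.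
by rewrite powRrM powR_mulrn ?powR_ge0// powR12_sqrt.
Qed.

Lemma fstar_ge1 t : 1 <= t -> fstar t = t - 1 / 3.
Proof.
rewrite le_eqVlt => /predU1P[<-|t1].
  by rewrite fstar_mid ?ler01 ?lexx// sqrtr1 expr1n; field.
by rewrite /fstar ltNge (le_trans ler01 (ltW t1)) /= leNgt t1.
Qed.

Lemma sig1_mid t : 0 <= t <= 1 -> sig 1 t = Num.sqrt t.
Proof. by move=> /andP[_ t1]; rewrite sig_sqrt ?ltr01 ?expr1n// divr1. Qed.

(** Convexity, checked case by case in the roots p and q of s and t, where each gap is a sum of
    visibly nonnegative products. *)
Lemma fstar_subgradient s t : sig 1 t * (s - t) <= fstar s - fstar t.
Proof.
have e0 : 0 < 1 :> R by exact: ltr01.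
have fs0 (u : R) : 0 <= fstar u.
  have [u0|u0] := leP u 0; first by rewrite fstar_le0.
  have [u1|u1] := leP u 1; last by rewrite fstar_ge1; lra.
  by rewrite fstar_mid ?(ltW u0)// mulr_ge0// exprn_ge0// sqrtr_ge0.
have [t0|t0] := leP t 0.
  by rewrite sig_le0// mul0r (fstar_le0 t0) subr0.
have [t1|t1] := leP t 1.
  have ht : 0 <= t <= 1 by rewrite t1 (ltW t0).
  rewrite sig1_mid// (fstar_mid ht).
  have := sqr_sqrtr (ltW t0); have := sqrtr_ge0 t.
  have : Num.sqrt t <= 1 by rewrite -[leRHS]sqrtr1 ler_wsqrtr.
  move: (Num.sqrt t) => q q1 q0 <-.
  have [s0|s0] := leP s 0.
    rewrite fstar_le0//; have : 0 <= q * - s by rewrite mulr_ge0// oppr_ge0.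
    have : 0 <= q ^+ 3 by rewrite exprn_ge0.
    rewrite !exprS expr0; lra.
  have [s1|s1] := leP s 1.
    rewrite fstar_mid ?s1 ?(ltW s0)//.
    have := sqr_sqrtr (ltW s0); have := sqrtr_ge0 s; move: (Num.sqrt s) => p p0 <-.
    rewrite -subr_ge0 (_ : _ - _ = (p - q) ^+ 2 * (2 * p + q) / 3); last by field.
    by rewrite divr_ge0// mulr_ge0 ?sqr_ge0//; lra.
  rewrite (fstar_ge1 (ltW s1)).
  rewrite -subr_ge0 (_ : _ - _ = (s - 1) * (1 - q) + (1 - q) ^+ 2 * (q + 2) / 3); last by field.
  by rewrite addr_ge0 ?mulr_ge0 ?sqr_ge0//; lra.
rewrite (@sig_one _ 1 t) ?expr1n ?(ltW t1)// mul1r (fstar_ge1 (ltW t1)).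
have [s0|s0] := leP s 0; first by rewrite fstar_le0//; lra.
have [s1|s1] := leP s 1; last by rewrite fstar_ge1; lra.
rewrite fstar_mid ?s1 ?(ltW s0)//.
have := sqr_sqrtr (ltW s0); have := sqrtr_ge0 s; move: (Num.sqrt s) => p p0 <-.
rewrite -subr_ge0 (_ : _ - _ = (p - 1) ^+ 2 * (2 * p + 1) / 3); last by field.
by rewrite divr_ge0// mulr_ge0 ?sqr_ge0//; lra.
Qed.

Lemma fstar_ge0 t : 0 <= fstar t.
Proof. by have := fstar_subgradient t 0; rewrite sig_le0// mul0r (fstar_le0 (lexx 0)) subr0. Qed.

Lemma fstar_geB t : t - 1 / 3 <= fstar t.
Proof.
have := fstar_subgradient t 1; rewrite sig_one ?ltr01 ?expr1n// mul1r (fstar_ge1 (lexx 1)); lra.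
Qed.

Lemma sqrt_dist s t : `|Num.sqrt s - Num.sqrt t| <= Num.sqrt `|s - t|.
Proof.
wlog ts : s t / t <= s => [hw|].
  by have [/hw//|/ltW/hw] := leP t s; rewrite distrC (distrC t).
rewrite !ger0_norm ?subr_ge0 ?ler_wsqrtr// lerBlDr.
have [t0|t0] := leP t 0.
  by rewrite (ler0_sqrtr t0) addr0 ler_wsqrtr//; lra.
have s0 : 0 <= s by lra.
rewrite -ler_sqr ?nnegrE ?addr_ge0 ?sqrtr_ge0// sqrrD !sqr_sqrtr ?subr_ge0 ?(ltW t0)//.
have : 0 <= Num.sqrt (s - t) * Num.sqrt t by rewrite mulr_ge0 ?sqrtr_ge0.
rewrite mulr2n; lra.
Qed.

Lemma min1_dist s t : `|Num.min s 1 - Num.min t 1| <= `|s - t|.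
Proof.
rewrite ler_norml; have := ler_norm (s - t); have := ler_norm (- (s - t)).
rewrite normrN /Num.min; case: ifP => h1; case: ifP => h2; lra.
Qed.

Lemma sig1_dist s t : `|sig 1 s - sig 1 t| <= Num.sqrt `|s - t|.
Proof. by rewrite /sig !divr1 (le_trans (min1_dist _ _))// sqrt_dist. Qed.

(** The subgradient inequalities at s and at t squeeze the remainder between 0 and (sig 1 s - sig 1
    t) (s - t), and the root is Hoelder of exponent 1/2. *)
Lemma fstar_expansion s t :
  `|fstar s - fstar t - sig 1 t * (s - t)| <= Num.sqrt `|s - t| * `|s - t|.
Proof.
have h1 := fstar_subgradient s t; have h2 := fstar_subgradient t s.
have h3 : (sig 1 s - sig 1 t) * (s - t) <= Num.sqrt `|s - t| * `|s - t|.
  by rewrite (le_trans (ler_norm _))// normrM ler_wpM2r// sig1_dist.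
rewrite ger0_norm; lra.
Qed.

Lemma derive1_fstar t : derive1 fstar t = sig 1 t.
Proof.
rewrite /derive1; apply/cvg_lim => //; apply/cvgrPdist_le => e e0.
near=> h.
have h0 : h != 0 by near: h; exact: nbhs_dnbhs_neq.
rewrite -(ler_pM2r (_ : 0 < `|h|)) ?normr_gt0// -normrM mulrBl.
rewrite (_ : h^-1 *: _ * h = fstar (h + t) - fstar t); last first.
  by rewrite /GRing.scale /= mulrC mulrA divff// mul1r.
have := fstar_expansion (h + t) t; rewrite addrK distrC => /le_trans; apply.
rewrite ler_wpM2r// -(@ler_sqr _ (Num.sqrt _)) ?nnegrE ?sqrtr_ge0 ?(ltW e0)//.
rewrite sqr_sqrtr//; near: h.
apply: dnbhs0_le; exact: exprn_gt0.
Unshelve. all: by end_near. Qed.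

Lemma sig_scale e t : 0 < e -> sig 1 (e ^- 2 * t) = sig e t.
Proof.
move=> e0; rewrite /sig divr1; congr Num.min.
by rewrite sqrtrM ?invr_ge0 ?sqr_ge0// -exprVn sqrtr_sqr gtr0_norm ?invr_gt0// mulrC.
Qed.

(** The integrand of [Keps] as a function of the best score: a smoothing of the positive part, with
    derivative [sig e]. *)
Definition pen e t := e ^+ 2 * fstar (e ^- 2 * t).

Lemma pen_subgradient e s t : 0 < e -> sig e t * (s - t) <= pen e s - pen e t.
Proof.
move=> e0; have e20 : 0 < e ^+ 2 by rewrite exprn_gt0.
rewrite /pen -mulrBr mulrC -ler_pdivrMl// -sig_scale//.
apply: le_trans (fstar_subgradient _ _).
move: (sig 1 (e ^- 2 * t)) => u; move: (e ^- 2) => v.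
by rewrite (_ : v * ((s - t) * u) = u * (v * s - v * t))//; ring.
Qed.

Lemma pen_expansion e t : 0 < e -> forall eta, 0 < eta ->
  exists2 r, 0 < r & forall s, `|s - t| < r -> `|pen e s - pen e t - sig e t * (s - t)| <= eta * `|s - t|.
Proof.
move=> e0 eta eta0; have e20 : 0 < e ^+ 2 by rewrite exprn_gt0.
exists ((e * eta) ^+ 2); first by rewrite exprn_gt0// mulr_gt0.
move=> s hs.
rewrite (_ : pen e s - pen e t - sig e t * (s - t) = e ^+ 2 *
   (fstar (e ^- 2 * s) - fstar (e ^- 2 * t) - sig 1 (e ^- 2 * t) * (e ^- 2 * s - e ^- 2 * t))); last first.
  by rewrite sig_scale// /pen -mulrBr; field; rewrite gt_eqF.
rewrite normrM (gtr0_norm e20).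
apply: (le_trans (ler_wpM2l (ltW e20) (fstar_expansion _ _))).
rewrite -mulrBr normrM (gtr0_norm (_ : 0 < e ^- 2)) ?invr_gt0//.
rewrite mulrCA mulVKf ?gt_eqF// ler_wpM2r//.
rewrite -(@ler_sqr _ (Num.sqrt _)) ?nnegrE ?sqrtr_ge0 ?(ltW eta0)//.
rewrite sqr_sqrtr ?mulr_ge0 ?invr_ge0 ?(ltW e20)//.
by rewrite ler_pdivrMl// -exprMn ltW.
Qed.

Lemma pen_bounds e t : 0 < e -> 0 <= pen e t /\ t - e ^+ 2 / 3 <= pen e t.
Proof.
move=> e0; have e20 : 0 < e ^+ 2 by rewrite exprn_gt0.
split; first by rewrite mulr_ge0 ?fstar_ge0// ltW.
have := fstar_geB (e ^- 2 * t) => /(ler_wpM2l (ltW e20)); apply: le_trans.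
by rewrite le_eqVlt; apply/orP; left; apply/eqP; field; rewrite gt_eqF.
Qed.

Lemma pos_part_subgradient s t : step t * (s - t) <= Num.max 0 s - Num.max 0 t.
Proof.
rewrite /step; have [t0|t0] := ltP 0 t.
  by rewrite mul1r lerD2r le_max lexx orbT.
by rewrite mul0r subr0 le_max lexx.
Qed.

Lemma pos_part_expansion t : t != 0 -> forall eta, 0 < eta ->
  exists2 r, 0 < r & forall s, `|s - t| < r ->
    `|Num.max 0 s - Num.max 0 t - step t * (s - t)| <= eta * `|s - t|.
Proof.
move=> t0 eta eta0; exists `|t|; first by rewrite normr_gt0.
move=> s; rewrite /step; have [tp|tp] := ltP 0 t.
  rewrite (gtr0_norm tp) ltr_norml => /andP[h1 h2].
  by rewrite max_r ?mul1r ?subrr ?normr0 ?mulr_ge0 ?(ltW eta0)//; lra.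
rewrite (ler0_norm tp) ltr_norml => /andP[h1 h2].
by rewrite max_l ?mul0r ?subrr ?normr0 ?mulr_ge0 ?(ltW eta0)//; lra.
Qed.

End FStar.

Lemma lip_continuous (R : realType) (V : normedModType R) (f : V -> R) (k : R) :
  0 < k -> (forall u v, `|f u - f v| <= k * `|u - v|) -> continuous f.
Proof.
move=> k0 hf u; apply/cvgrPdist_le => e e0; apply/nbhs_ballP; exists (e / k) => /=.
  by rewrite divr_gt0.
move=> v; rewrite -ball_normE /= ltr_pdivlMr// => h.
by rewrite (le_trans (hf _ _))// mulrC ltW.
Qed.

(** * Dual functionals with a general convex integrand *)

Section Dual.
Context {R : realType} {n : nat}.
Variable y : 'I_n.+1 -> R.
Variables (rho : probability (measurableTypeR R) R) (a b m M : R) (dens : R -> R).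
Hypothesis law : regular_law rho a b m M dens.
Hypothesis y_inj : injective y.
Variable alpha : 'I_n.+1 -> R.
Hypothesis alpha_gt0 : forall i, 0 < alpha i.
Hypothesis alpha_sum : \sum_(i < n.+1) alpha i < 1.
Implicit Types (psi phi : 'rV[R]_n.+1) (x : R).

(** The best score can vanish only at the points y_i +- sqrt psi_i. Discarding them avoids the kink
    of the positive part, the integrand of the unregularized functional. *)
Lemma aes_best_neq0 psi : aes rho (fun x => best y psi x != 0).
Proof.
have : aes rho (fun x => forall i : 'I_n.+1 * bool, x != y i.1 + (-1) ^+ i.2 * Num.sqrt (psi 0 i.1)).
  by apply: aes_all => -[i s]; apply: (rl_pt law).
apply: aes_mp => x hx; rewrite bestE; apply/eqP; rewrite /score => /eqP.
set i := winner _ _ _; rewrite subr_eq0 => /eqP e.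
have : Num.sqrt (psi 0 i) = `|x - y i| by rewrite e sqrtr_sqr.
have := hx (i, false); have := hx (i, true); rewrite /= expr0 expr1 mul1r mulN1r => h1 h2.
by case: (ger0P (x - y i)) => _ hs; [move: h2|move: h1]; rewrite hs => /eqP; apply; ring.
Qed.

Lemma E_gt0_ex (f : R -> R) (P : R -> Prop) : intg rho f -> 0 < \int[rho]_x f x ->
  aes rho P -> exists x, P x /\ 0 < f x.
Proof.
move=> jf f0 aP; apply: contrapT => no; move: f0; apply/negP; rewrite -leNgt.
rewrite -(E_cst rho 0); apply: E_le_ae => //; first exact: intg_cst.
apply: aes_mp aP => x Px; rewrite leNgt; apply/negP => fx; apply: no; by exists x.
Qed.

Section Potential.
(** The data common to both functionals: a convex integrand [J] and its derivative [sg]. The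
    expansion exempts t = 0, where the positive part has its kink. *)
Variables (J sg : R -> R).
Hypothesis sg_meas : measurable_fun setT sg.
Hypothesis sg_bounds : forall t, 0 <= sg t <= 1.
Hypothesis sg_homo : {homo sg : s t / s <= t}.
Hypothesis sg_le0 : forall t, t <= 0 -> sg t = 0.
Hypothesis J_ge0 : forall t, 0 <= J t.
Hypothesis J_sub : forall s t, sg t * (s - t) <= J s - J t.
Hypothesis J_exp : forall t, t != 0 -> forall eta : R, 0 < eta ->
  exists2 r : R, 0 < r & forall s : R, `|s - t| < r -> `|J s - J t - sg t * (s - t)| <= eta * `|s - t|.

Lemma J_homo : {homo J : s t / s <= t}.
Proof.
move=> s t st; rewrite -subr_ge0; apply: (le_trans _ (J_sub t s)).
by have /andP[? _] := sg_bounds s; rewrite mulr_ge0// subr_ge0.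
Qed.

Lemma J_lip s t : `|J s - J t| <= `|s - t|.
Proof.
have hb u v : sg u * (v - u) >= - `|v - u|.
  have /andP[h0 h1] := sg_bounds u.
  have : `|sg u * (v - u)| <= `|v - u| by rewrite normrM ger0_norm// ler_piMl.
  by rewrite ler_norml => /andP[].
have h1 := J_sub s t; have h2 := J_sub t s.
have h3 := hb t s; have h4 := hb s t; rewrite (distrC t s) in h4.
rewrite ler_norml; lra.
Qed.

Lemma continuous_J : continuous J.
Proof.
move=> t; apply/cvgrPdist_le => e e0; apply/nbhs_ballP; exists e => //= s hs.
by rewrite (le_trans (J_lip _ _))// ltW.
Qed.

Lemma meas_Jbest psi : measurable_fun setT (fun x => J (best y psi x)).
Proof.
apply: measurableT_comp; last exact: meas_best.
by apply: continuous_measurable_fun; exact: continuous_J.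
Qed.

Lemma best_le psi x : best y psi x <= `|psi|.
Proof.
apply: vmax_le => i; rewrite /score.
have := coord_le_norm psi i; have := ler_norm (psi 0 i); have := sqr_ge0 (x - y i); lra.
Qed.

Lemma intg_Jbest psi : intg rho (fun x => J (best y psi x)).
Proof.
apply: (@intg_bnd _ _ _ (J `|psi|)); first exact: meas_Jbest.
by move=> x; rewrite ger0_norm// J_homo// best_le.
Qed.

(** Away from ties a small perturbation does not change the winner, so the best score moves by the
    increment of the winner alone. *)
Lemma score_expansion psi x : untied y psi x -> best y psi x != 0 ->
  forall eta, 0 < eta -> exists2 s, 0 < s & forall phi, `|phi - psi| < s ->
  `|J (best y phi x) - J (best y psi x)
     - \sum_(i < n.+1) cellf y sg psi i x * (phi - psi) 0 i| <= eta * `|phi - psi|.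
Proof.
move=> ut b0 eta eta0; set k := winner y psi x.
pose F j := if j == k then 1 else best y psi x - score y psi j x.
have F0 j : 0 < F j by rewrite /F; case: eqVneq => // jk; rewrite subr_gt0 ut.
have [r r0 hr] := pos_lower F0.
have [r' r'0 hr'] := J_exp b0 eta0.
exists (Num.min (r / 2) r'); first by rewrite lt_min divr_gt0.
move=> phi; rewrite lt_min => /andP[h1 h2].
have bk : best y phi x = best y psi x + (phi - psi) 0 k.
  rewrite bestE [in RHS]bestE -/k -(scoreB y psi phi k x) [RHS]addrC subrK.
  have [->//|wk] := eqVneq (winner y phi x) k.
  have := hr (winner y phi x); rewrite /F (negbTE wk) [best _ psi _]bestE -/k.
  have := score_le_best y phi k x; rewrite bestE.
  have := scoreB y psi phi k x; have := scoreB y psi phi (winner y phi x) x.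
  have := coord_le_norm (phi - psi) k; have := coord_le_norm (phi - psi) (winner y phi x).
  rewrite !ler_norml; lra.
have dk : best y phi x - best y psi x = (phi - psi) 0 k by rewrite bk addrAC subrr add0r.
rewrite cellf_sum// -/k -dk.
have hd : `|best y phi x - best y psi x| <= `|phi - psi| by exact: best_dist.
apply: (le_trans (hr' _ _)); first exact: le_lt_trans h2.
by rewrite ler_wpM2l// ltW.
Qed.

(** Envelope theorem under the integral: [J] and the best score are 1-Lipschitz, so the constant 1
    dominates. *)
Lemma best_expansion psi eta : 0 < eta -> exists2 s, 0 < s & forall phi, `|phi - psi| < s ->
  `|\int[rho]_x J (best y phi x) - \int[rho]_x J (best y psi x)
     - \sum_(i < n.+1) mass y rho sg psi i * (phi - psi) 0 i| <= eta * `|phi - psi|.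
Proof.
move=> eta0.
pose L phi x := \sum_(i < n.+1) cellf y sg psi i x * (phi - psi) 0 i.
have iL phi i : intg rho (fun x => cellf y sg psi i x * (phi - psi) 0 i).
  have -> : (fun x => cellf y sg psi i x * (phi - psi) 0 i) =
     (fun x => (phi - psi) 0 i * cellf y sg psi i x) by apply/funext => x; rewrite mulrC.
  by apply: intgZ; exact: intg_cellf.
have [||||||||s s0 hs] := @E_expansion R rho _ (fun phi => `|phi - psi|)
   (fun phi x => J (best y phi x)) L (fun x => J (best y psi x)) (fun=> 1) 1 ltr01 _ _ _ _ _ _ _ _ eta eta0.
- by [].
- by move=> phi; exact: intg_Jbest.
- exact: intg_Jbest.
- by move=> phi; apply: intg_meas (intg_sum _).
- exact: intg_cst.
- apply: aesT => x phi _; rewrite mul1r (le_trans (J_lip _ _))//; exact: best_dist.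
- move=> phi; apply: aes_mp (aes_untied law y_inj psi) => x ut.
  rewrite mul1r /L cellf_sum// normrM.
  have /andP[h0 h1] := sg_bounds (best y psi x).
  by rewrite ger0_norm// (le_trans (ler_piMl _ h1))// coord_le_norm.
- apply: aes_mp (aes_and (aes_untied law y_inj psi) (aes_best_neq0 psi)) => x [ut b0].
  exact: score_expansion.
exists s => // phi hphi; have := hs phi hphi; rewrite E_sum//.
congr (`|_ - _| <= _); apply: eq_bigr => i _.
under eq_E do rewrite mulrC.
by rewrite E_Z 1?mulrC//; exact: intg_cellf.
Qed.

(* [J = pen e] gives K^eps and [J = max 0] gives K. *)
Definition dual psi := \sum_(i < n.+1) alpha i * psi 0 i - \int[rho]_x J (best y psi x).

Lemma dual_expansion psi eta : 0 < eta -> exists2 s, 0 < s & forall phi, `|phi - psi| < s ->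
  `|dual phi - dual psi
     - \sum_(i < n.+1) (alpha i - mass y rho sg psi i) * (phi - psi) 0 i| <= eta * `|phi - psi|.
Proof.
move=> eta0; have [s s0 hs] := best_expansion psi eta0; exists s => // phi /hs.
rewrite -[X in X <= _ -> _]normrN; congr (`|_| <= _); rewrite /dual.
have -> : \sum_(i < n.+1) (alpha i - mass y rho sg psi i) * (phi - psi) 0 i =
   \sum_(i < n.+1) alpha i * (phi - psi) 0 i -
   \sum_(i < n.+1) mass y rho sg psi i * (phi - psi) 0 i.
  by rewrite -sumrB; apply: eq_bigr => i _; rewrite mulrBl.
have -> : \sum_(i < n.+1) alpha i * (phi - psi) 0 i =
   \sum_(i < n.+1) alpha i * phi 0 i - \sum_(i < n.+1) alpha i * psi 0 i.
  by rewrite -sumrB; apply: eq_bigr => i _; rewrite !mxE mulrBr.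
ring.
Qed.

(** First-order condition along both signs of each coordinate direction. Maximality in a ball is
    enough, which covers a maximizer over the open orthant too. *)
Lemma maximizer_mass psi r : 0 < r ->
  (forall phi, `|phi - psi| < r -> dual phi <= dual psi) ->
  forall i, mass y rho sg psi i = alpha i.
Proof.
move=> r0 hmax i; apply/eqP; rewrite eq_sym -subr_eq0 -normr_le0.
apply/ler_addgt0Pl => eta eta0; rewrite addr0.
have [s s0 hs] := dual_expansion psi eta0.
pose t := Num.min s r / 2.
have t0 : 0 < t by rewrite divr_gt0// lt_min s0.
have [ts tr] : t < s /\ t < r.
  have : Num.min s r <= s by rewrite ge_min lexx.
  have : Num.min s r <= r by rewrite ge_min lexx orbT.
  rewrite /t; lra.
have key u : `|u| = t -> (alpha i - mass y rho sg psi i) * u <= eta * t.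
  move=> ut; pose phi := psi + u *: delta_mx 0 i.
  have dphi : phi - psi = u *: delta_mx 0 i by rewrite /phi addrAC subrr add0r.
  have nphi : `|phi - psi| = t.
    apply/eqP; rewrite dphi eq_le norm_le_coord ?(ltW t0)//=.
      by have := coord_le_norm (u *: delta_mx 0 i : 'rV[R]_n.+1) i; rewrite !mxE !eqxx mulr1 ut.
    by move=> j; rewrite !mxE eqxx /=; case: eqP => _; rewrite ?mulr1 ?ut// mulr0 normr0 ltW.
  have := hs phi; rewrite nphi => /(_ ts).
  rewrite (bigD1 i)//= big1 => [|j ji]; last by rewrite dphi !mxE (negbTE ji) andbF !mulr0.
  rewrite dphi !mxE !eqxx mulr1 addr0.
  have := hmax phi; rewrite nphi => /(_ tr).
  rewrite ler_norml; lra.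
have h1 := key t (gtr0_norm t0); have h2 := key (- t) (etrans (normrN t) (gtr0_norm t0)).
rewrite -(ler_pM2r t0) -[X in `|_| * X](gtr0_norm t0) -normrM ler_norml; lra.
Qed.

(* By monotonicity along segments, the local quadratic bound propagates to a linear one. *)
Lemma resolvent psi c r : 0 < c -> 0 < r ->
  (forall phi, `|phi - psi| <= r -> c * `|phi - psi| ^+ 2 <= \int[rho]_x gain y sg psi phi x) ->
  forall phi, c * Num.min r `|phi - psi| * `|phi - psi| <=
    \sum_(i < n.+1) (mass y rho sg phi i - mass y rho sg psi i) * (phi - psi) 0 i.
Proof.
move=> c0 r0 hsm phi; rewrite -(E_gain y rho sg_meas sg_bounds).
have [small|big] := leP `|phi - psi| r.
  by rewrite -mulrA -expr2; exact: hsm.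
set d := `|phi - psi| in big *.
have d0 : 0 < d by exact: lt_trans big.
pose t := r / d; pose phi' := psi + t *: (phi - psi).
have t0 : 0 < t by rewrite divr_gt0.
have t1 : t < 1 by rewrite ltr_pdivrMr// mul1r.
have e1 : phi' - psi = t *: (phi - psi) by rewrite /phi' addrAC subrr add0r.
have e2 : phi - phi' = (1 - t) *: (phi - psi) by rewrite /phi' scalerBl scale1r opprD addrA.
have n1 : `|phi' - psi| = r by rewrite e1 normrZ gtr0_norm// -/d /t divfK// gt_eqF.
have h1 := hsm phi'; rewrite n1 lexx in h1; have {}h1 := h1 isT.
have h2 := E_gain_ge0 law y_inj sg_meas sg_bounds sg_homo phi' phi.
move: h1 h2; rewrite !(E_gain y rho sg_meas sg_bounds) e1 e2.
set S1 := \sum_(i < _) _; set S2 := \sum_(i < _) _; set S := \sum_(i < _) _ => h1 h2.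
(* The increments phi' - psi and phi - phi' are t and 1 - t times phi - psi, and the differences of
   masses add up. *)
have SE : S = S1 / t + S2 / (1 - t).
  rewrite /S /S1 /S2 !mulr_suml -big_split /=; apply: eq_bigr => i _.
  by rewrite !mxE; field; lra.
have s2 : 0 <= S2 / (1 - t) by rewrite divr_ge0// subr_ge0 ltW.
apply: (@le_trans _ _ (S1 / t)); last by rewrite SE lerDl.
rewrite ler_pdivlMr//; apply: le_trans h1; rewrite le_eqVlt; apply/orP; left; apply/eqP.
by rewrite /t; field; lra.
Qed.

(** A positive mass is not carried by a null set. The parameter [P] lets a caller impose one more
    almost sure property on the point. *)
Lemma cell_points psi k : 0 < mass y rho sg psi k ->
  forall P, aes rho P -> exists x, [/\ P x, a < x < b, strictly_best y psi k x & 0 < score y psi k x].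
Proof.
move=> mk P aP.
have [x [[[Px xab] ut] cx]] := E_gt0_ex (intg_cellf y rho sg_meas sg_bounds psi k) mk
  (aes_and (aes_and aP (rl_supp law)) (aes_untied law y_inj psi)).
exists x; move: cx; rewrite /cellf; case: ifP => [bk|]; last by rewrite ltxx.
move=> s0; have wk : winner y psi x = k.
  by apply/eqP/negPn/negP => kw; have := ut k; rewrite eq_sym kw => /(_ isT); rewrite ltNge bk.
split => //.
  by move=> j; rewrite -wk => /ut; rewrite bestE.
by rewrite ltNge; apply/negP => /sg_le0 s1; rewrite s1 ltxx in s0.
Qed.

(** Off ties the cell integrands add up to the weight of the best score; an average below 1 leaves a
    set of positive measure where this weight is not saturated. *)
Lemma mass_sum_lt1 psi : \sum_(i < n.+1) mass y rho sg psi i < 1 ->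
  forall P, aes rho P -> exists x, [/\ P x, a < x < b & sg (best y psi x) < 1].
Proof.
move=> hs P aP.
have iS : intg rho (fun x => \sum_(i < n.+1) cellf y sg psi i x).
  by apply: intg_sum => i; exact: intg_cellf.
have [||x [[[Px xab] ut] cx]] := @E_gt0_ex (fun x => 1 - \sum_(i < n.+1) cellf y sg psi i x) _ _ _
  (aes_and (aes_and aP (rl_supp law)) (aes_untied law y_inj psi)).
- by apply: intgB => //; exact: intg_cst.
- rewrite E_B//; last exact: intg_cst.
  rewrite E_cst E_sum ?subr_gt0// => i; exact: intg_cellf.
exists x; split => //; have := cellf_sum sg (fun=> 1) ut; rewrite mulr1.
under eq_bigr do rewrite mulr1.
by move=> <-; rewrite -subr_gt0.
Qed.

Lemma alpha_le (u : 'I_n.+1 -> R) c : 0 <= c -> (forall i, u i <= c) ->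
  \sum_(i < n.+1) alpha i * u i <= c.
Proof.
move=> c0 uc; apply: (@le_trans _ _ ((\sum_(i < n.+1) alpha i) * c)).
  by rewrite mulr_suml; apply: ler_sum => i _; rewrite ler_wpM2l// ltW.
by rewrite ler_piMl// ltW.
Qed.

Lemma dual_lip psi phi : `|dual phi - dual psi| <= 2 * `|phi - psi|.
Proof.
have h1 : `|\sum_(i < n.+1) alpha i * (phi 0 i - psi 0 i)| <= `|phi - psi|.
  rewrite (le_trans (ler_norm_sum _ _ _))//.
  under eq_bigr do rewrite normrM (gtr0_norm (alpha_gt0 _)).
  by apply: alpha_le => // i; have := coord_le_norm (phi - psi) i; rewrite !mxE.
have h2 : `|\int[rho]_x J (best y phi x) - \int[rho]_x J (best y psi x)| <= `|phi - psi|.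
  rewrite -E_B; [|exact: intg_Jbest|exact: intg_Jbest].
  apply: E_norm_le; first by apply: intgB; exact: intg_Jbest.
  by apply: aesT => x; rewrite (le_trans (J_lip _ _))// best_dist.
rewrite (_ : dual phi - dual psi = \sum_(i < n.+1) alpha i * (phi 0 i - psi 0 i) -
   (\int[rho]_x J (best y phi x) - \int[rho]_x J (best y psi x))).
  by rewrite (le_trans (ler_normB _ _))//; lra.
rewrite /dual.
have -> : \sum_(i < n.+1) alpha i * (phi 0 i - psi 0 i) =
   \sum_(i < n.+1) alpha i * phi 0 i - \sum_(i < n.+1) alpha i * psi 0 i.
  by rewrite -sumrB; apply: eq_bigr => i _; rewrite mulrBr.
ring.
Qed.

Lemma continuous_dual : continuous dual.
Proof.
by apply: (@lip_continuous R _ dual 2) => // u v; rewrite distrC (distrC u) dual_lip.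
Qed.

(* Coercivity: J >= 0 bounds the coordinates of a superlevel set from below, and
   J t >= t - K0 together with \sum alpha < 1 bounds them from above. *)
Lemma dual_maximizer_ex K0 : (forall t, t - K0 <= J t) ->
  exists psi, forall phi, dual phi <= dual psi.
Proof.
move=> JK0; set kappa := dual 0.
have ab := rl_ab law.
pose s := \sum_(i < n.+1) alpha i.
pose C := vmax (fun i => (`|a - y i| + `|b - y i|) ^+ 2).
have up psi k : dual psi <= \sum_(i < n.+1) alpha i * psi 0 i - (psi 0 k - C - K0).
  rewrite /dual lerD2l lerN2 -(E_cst rho (psi 0 k - C - K0)).
  apply: E_le_ae; [exact: intg_cst|exact: intg_Jbest|].
  apply: aes_mp (rl_supp law) => x /andP[ax xb].
  apply: (le_trans _ (JK0 _)); rewrite lerD2r.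
  apply: (le_trans _ (score_le_best y psi k x)); rewrite /score lerD2l lerN2.
  apply: (le_trans _ (vmax_ge (fun i => (`|a - y i| + `|b - y i|) ^+ 2) k)).
  rewrite -[leLHS]real_normK ?num_real// ler_sqr ?nnegrE ?addr_ge0// ler_norml.
  have := ler_norm (- (a - y k)); have := ler_norm (b - y k); rewrite normrN.
  have := normr_ge0 (a - y k); have := normr_ge0 (b - y k); lra.
have up0 psi : dual psi <= \sum_(i < n.+1) alpha i * psi 0 i.
  by rewrite /dual gerBl; apply: E_ge0_ae; [exact: intg_Jbest|exact: aesT].
have [amin amin0 hamin] := pos_lower alpha_gt0.
(* With t the largest coordinate, kappa <= dual psi <= s t - (t - C - K0), hence (1 - s) t <= C + K0
   - kappa. *)
pose P1 : R := `|C + K0 - kappa| / (1 - s).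
have s1 : 0 < 1 - s by rewrite subr_gt0.
have P10 : 0 <= P1 by rewrite divr_ge0// ltW.
pose B : R := P1 + (`|kappa| + P1) / amin.
have B0 : 0 <= B by rewrite addr_ge0// divr_ge0 ?addr_ge0// ltW.
have bnd psi : kappa <= dual psi -> `|psi| <= B.
  move=> hk; have [k hmax] := vmax_attained (fun i => psi 0 i).
  have le_k i : psi 0 i <= psi 0 k by rewrite -hmax; exact: (vmax_ge (fun i => psi 0 i)).
  have kP1 : psi 0 k <= P1.
    rewrite ler_pdivlMr//; have := le_trans hk (up psi k).
    have : \sum_(i < n.+1) alpha i * psi 0 i <= s * psi 0 k.
      by rewrite /s mulr_suml; apply: ler_sum => i _; rewrite ler_wpM2l// ltW.
    have := ler_norm (C + K0 - kappa); lra.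
  apply: norm_le_coord => // i; rewrite ler_norml.
  have iP1 : psi 0 i <= P1 by rewrite (le_trans (le_k i)).
  have q0 : 0 <= (`|kappa| + P1) / amin by rewrite divr_ge0 ?addr_ge0// ltW.
  apply/andP; split; last by rewrite /B; lra.
  have : kappa <= alpha i * psi 0 i + P1.
    apply: (le_trans hk); apply: (le_trans (up0 psi)); rewrite (bigD1 i)//= lerD2l.
    apply: (@le_trans _ _ (\sum_(j < n.+1) alpha j * P1)); last exact: alpha_le.
    rewrite [leRHS](bigD1 i)//= -[leLHS]add0r; apply: lerD.
      exact: mulr_ge0 (ltW (alpha_gt0 i)) P10.
    by apply: ler_sum => j _; rewrite ler_wpM2l ?(ltW (alpha_gt0 j))// (le_trans (le_k j)).
  move=> h.
  have [p0|p0] := leP 0 (psi 0 i); first by rewrite /B; lra.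
  have h2 : alpha i * - psi 0 i <= `|kappa| + P1.
    rewrite mulrN; move: h (ler_norm (- kappa)); rewrite normrN.
    by move: (alpha i * psi 0 i) => z; lra.
  have h3 : amin * - psi 0 i <= alpha i * - psi 0 i.
    by rewrite ler_wpM2r// oppr_ge0 ltW.
  have : - psi 0 i <= (`|kappa| + P1) / amin.
    by rewrite ler_pdivlMr// mulrC (le_trans h3).
  rewrite /B; lra.
have cB : compact [set psi : 'rV[R]_n.+1 | `|psi| <= B].
  apply: bounded_closed_compact.
    by exists B; split; [exact: num_real|move=> x Bx psi /= /le_trans; apply; exact: ltW].
  apply: (@closed_comp _ _ (fun psi : 'rV[R]_n.+1 => `|psi|) [set z : R | z <= B]).
    by move=> psi _; exact: norm_continuous.
  exact: closed_le.
have ne : [set psi : 'rV[R]_n.+1 | `|psi| <= B] !=set0 by exists 0; rewrite /= normr0.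
have [psi _ hpsi] := EVT_max_rV ne cB (continuous_subspaceT continuous_dual).
exists psi => phi; have [hk|hk] := leP kappa (dual phi).
  by apply: hpsi; rewrite inE /=; exact: bnd.
apply: (le_trans (ltW hk)); apply: hpsi; by rewrite inE /= normr0.
Qed.

End Potential.

End Dual.

(** * Maximizers, their masses and the rate of convergence *)

Section Maximizers.
Context {R : realType} {n : nat}.
Variable y : 'I_n.+1 -> R.
Variables (rho : probability (measurableTypeR R) R) (a b m M : R) (dens : R -> R).
Hypothesis law : regular_law rho a b m M dens.
Hypothesis y_inj : injective y.
Variable alpha : 'I_n.+1 -> R.
Hypothesis alpha_gt0 : forall i, 0 < alpha i.
Hypothesis alpha_sum : \sum_(i < n.+1) alpha i < 1.
Implicit Types (psi phi : 'rV[R]_n.+1) (x : R) (e : R).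

Lemma step_le0 (t : R) : t <= 0 -> step t = 0.
Proof. by move=> t0; rewrite /step ltNge t0. Qed.

Lemma vmax_scoreE psi x : vmax (fun i => psi 0 i - `|x - y i| ^+ 2) = best y psi x.
Proof. by congr vmax; apply/funext => i; rewrite /score real_normK ?num_real. Qed.

Lemma KepsE e psi : 0 < e -> Keps rho y alpha e psi = dual y rho alpha (pen e) psi.
Proof.
move=> e0; rewrite /Keps /dual addrC -E_Z; last first.
  have iJ : intg rho (fun x => pen e (best y psi x)).
    apply: (@intg_Jbest _ _ y rho (pen e) (sig e)) => [t|t|s t].
    - exact: sig_bounds.
    - by have [] := pen_bounds t e0.
    - exact: pen_subgradient.
  have -> : (fun x => fstar (e ^- 2 * vmax (fun i => psi 0 i - `|x - y i| ^+ 2))) =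
     (fun x => e ^- 2 * pen e (best y psi x)).
    by apply/funext => x; rewrite vmax_scoreE /pen mulKf// gt_eqF// exprn_gt0.
  exact: intgZ.
by congr (_ - _); apply: eq_E => x; rewrite vmax_scoreE.
Qed.

Lemma KfunE psi : Kfun rho y alpha psi = dual y rho alpha (Num.max 0) psi.
Proof.
rewrite /Kfun /dual addrC; congr (_ + _).
have iJ : intg rho (fun x => Num.max 0 (best y psi x)).
  apply: (@intg_Jbest _ _ y rho (Num.max 0) step) => [t|t|s t].
  - exact: step_bounds.
  - by rewrite le_max lexx.
  - exact: pos_part_subgradient.
rewrite -mulN1r -E_Z//; apply: eq_E => x.
rewrite vmin_vmax mulN1r oppr_max oppr0 -vmax_scoreE.
by congr (Num.min _ (- _)); congr vmax; apply/funext => i; rewrite opprB.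
Qed.

Lemma GepsE e psi : 0 < e -> Geps rho y e psi = \row_i mass y rho (sig e) psi i.
Proof.
move=> e0; apply/rowP => i; rewrite !mxE Rintegral_mkcond; apply: eq_E => x.
rewrite /patch /cellf; have -> : (x \in Lag y psi i) = (best y psi x <= score y psi i x).
  apply/idP/idP; rewrite inE /Lag /=.
    move=> h; apply: vmax_le => j; have := h j; rewrite !real_normK ?num_real// /score; lra.
  move=> h j; have := le_trans (score_le_best y psi j x) h.
  rewrite !real_normK ?num_real// /score; lra.
by case: ifP => // _; rewrite derive1_fstar sig_scale// real_normK ?num_real.
Qed.

Let sb e (e0 : 0 < e) t := sig_bounds t e0.

Lemma reg_maximizer_ex e : 0 < e -> exists psi, is_maximizer setT (Keps rho y alpha e) psi.
Proof.
move=> e0.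
have [||||psi hpsi] := @dual_maximizer_ex _ _ y rho a b m M dens law alpha alpha_gt0 alpha_sum
   (pen e) (sig e) _ _ _ (e ^+ 2 / 3) _.
- by move=> t; exact: sig_bounds.
- by move=> t; have [] := pen_bounds t e0.
- by move=> s t; exact: pen_subgradient.
- by move=> t; have [] := pen_bounds t e0.
by exists psi; split => // phi _; rewrite !KepsE.
Qed.

Lemma reg_maximizer_mass e psi : 0 < e -> is_maximizer setT (Keps rho y alpha e) psi ->
  forall i, mass y rho (sig e) psi i = alpha i.
Proof.
move=> e0 [_ hmax].
apply: (@maximizer_mass _ _ y rho a b m M dens law y_inj alpha (pen e) (sig e) _ _ _ _ _ psi 1 ltr01).
- exact: meas_sig.
- by move=> t; exact: sig_bounds.
- by move=> t; have [] := pen_bounds t e0.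
- by move=> s t; exact: pen_subgradient.
- by move=> t _; exact: pen_expansion.
- by move=> phi _; rewrite -!KepsE//; exact: hmax.
Qed.

(** Positivity of each alpha_k puts a point of positive score in every cell, and a total below 1
    leaves a point under the cap. The constants depend on e and on [psi]. *)
Lemma reg_resolvent e psi : 0 < e -> (forall i, mass y rho (sig e) psi i = alpha i) ->
  exists2 c, 0 < c & exists2 r, 0 < r & forall phi,
    c * Num.min r `|phi - psi| * `|phi - psi| <=
      \sum_(i < n.+1) (mass y rho (sig e) phi i - alpha i) * (phi - psi) 0 i.
Proof.
move=> e0 hm; have [||c c0 [r r0 hr]] := @strong_mono_sig _ _ y rho a b m M dens law y_inj e psi e0.
- move=> k; have [|||x [_ /andP[ax xb] sx px]] := @cell_points _ _ y rho a b m M dens law y_inj (sig e)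
    (meas_sig e) _ _ psi k _ (fun=> True) (aesT _ (fun=> I)).
  + by move=> t; exact: sig_bounds.
  + by move=> t; exact: sig_le0.
  + by rewrite hm.
  by exists x; split => //; rewrite (ltW ax) (ltW xb).
- have [||x [_ /andP[ax xb] hx]] := @mass_sum_lt1 _ _ y rho a b m M dens law y_inj (sig e)
    (meas_sig e) _ psi _ (fun=> True) (aesT _ (fun=> I)).
  + by move=> t; exact: sig_bounds.
  + by under eq_bigr do rewrite hm.
  exists x; rewrite ?(ltW ax) ?(ltW xb)// ltNge; apply/negP => h.
  by rewrite sig_one ?ltxx in hx.
exists c => //; exists r => // phi.
have := @resolvent _ _ y rho a b m M dens law y_inj (sig e) (meas_sig e) (sb e0) (sig_homo e0) psi c r c0 r0 hr phi.
by under eq_bigr do rewrite hm.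
Qed.

(** The total below 1 only yields a point of best score at most 0; choosing it off the null set
    where the score vanishes makes the score negative. *)
Lemma step_resolvent psi : (forall i, mass y rho step psi i = alpha i) ->
  exists2 c, 0 < c & exists2 r, 0 < r & forall phi,
    c * Num.min r `|phi - psi| * `|phi - psi| <=
      \sum_(i < n.+1) (mass y rho step phi i - alpha i) * (phi - psi) 0 i.
Proof.
move=> hm; have [||c c0 [r r0 hr]] := @strong_mono_step _ _ y rho a b m M dens law y_inj psi.
- move=> k; have [|x [_ /andP[ax xb] sx px]] := @cell_points _ _ y rho a b m M dens law y_inj step
    meas_step step_bounds step_le0 psi k _ (fun=> True) (aesT _ (fun=> I)).
    by rewrite hm.
  by exists x; split => //; rewrite (ltW ax) (ltW xb).
- have [|x [Px /andP[ax xb] hx]] := @mass_sum_lt1 _ _ y rho a b m M dens law y_inj step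
    meas_step step_bounds psi _ _ (aes_best_neq0 y law psi).
    by under eq_bigr do rewrite hm.
  exists x; rewrite ?(ltW ax) ?(ltW xb)// lt_neqAle Px /=.
  by rewrite leNgt; apply: contraTN hx => p; rewrite /step p ltxx.
exists c => //; exists r => // phi.
have := @resolvent _ _ y rho a b m M dens law y_inj step meas_step step_bounds step_homo psi c r c0 r0 hr phi.
by under eq_bigr do rewrite hm.
Qed.

Lemma star_mass psi : is_maximizer [set phi : 'rV[R]_n.+1 | forall i, 0 < phi 0 i]
    (Kfun rho y alpha) psi -> forall i, mass y rho step psi i = alpha i.
Proof.
move=> [/= psi0 hmax]; have [r r0 hr] := pos_lower psi0.
apply: (@maximizer_mass _ _ y rho a b m M dens law y_inj alpha (Num.max 0) step _ _ _ _ _ psi r r0).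
- exact: meas_step.
- exact: step_bounds.
- by move=> t; rewrite le_max lexx.
- exact: pos_part_subgradient.
- exact: pos_part_expansion.
- move=> phi hphi; rewrite -!KfunE; apply: hmax => i /=.
  have := hr i; have := coord_le_norm (phi - psi) i; rewrite !mxE => h1 h2.
  have := le_lt_trans h1 hphi; rewrite ltr_norml; lra.
Qed.

Lemma norm_eq0_min (c r : R) psi phi : 0 < c -> 0 < r ->
  c * Num.min r `|phi - psi| * `|phi - psi| <= 0 -> phi = psi.
Proof.
move=> c0 r0; have [->|ne] := eqVneq phi psi; first by [].
have d0 : 0 < `|phi - psi| by rewrite normr_gt0 subr_eq0.
by rewrite leNgt !mulr_gt0// lt_min r0 d0.
Qed.

Lemma reg_unique e psi phi : 0 < e -> (forall i, mass y rho (sig e) psi i = alpha i) ->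
  (forall i, mass y rho (sig e) phi i = alpha i) -> phi = psi.
Proof.
move=> e0 h1 h2; have [c c0 [r r0 /(_ phi)]] := reg_resolvent e0 h1.
by rewrite big1 => [|i _]; [exact: norm_eq0_min|rewrite h2 subrr mul0r].
Qed.

Lemma star_unique psi phi : (forall i, mass y rho step psi i = alpha i) ->
  (forall i, mass y rho step phi i = alpha i) -> phi = psi.
Proof.
move=> h1 h2; have [c c0 [r r0 /(_ phi)]] := step_resolvent h1.
by rewrite big1 => [|i _]; [exact: norm_eq0_min|rewrite h2 subrr mul0r].
Qed.

Lemma intg_annulus c (A B : R) : intg rho (fun x => (A < (x - c) ^+ 2 < B)%R%:R).
Proof.
have mA : measurable_fun setT (fun x => (A < (x - c) ^+ 2 < B)%R%:R : R).
  have -> : (fun x => (A < (x - c) ^+ 2 < B)%R%:R : R) =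
      (fun x => if A < (x - c) ^+ 2 then (if (x - c) ^+ 2 < B then 1 else 0) else 0).
    by apply/funext => x; case: (A < _) => //=; case: (_ < B).
  have msq : measurable_fun setT (fun x : R => (x - c) ^+ 2).
    apply: measurable_funX; apply: measurable_funB; last exact: measurable_cst.
    exact: measurable_id.
  apply: measurable_fun_ifT => //; first exact: measurable_fun_ltr.
  by apply: measurable_fun_ifT => //; exact: measurable_fun_ltr.
by apply: (@intg_bnd _ _ _ 1) => // x; case: (_ < _ < _); rewrite ?normr1 ?normr0.
Qed.

(** Two intervals, one on each side of c. For A <= 0 the convention sqrt A = 0 makes them leave out
    c alone, which is null. *)
Lemma E_annulus c (A B : R) : A <= B ->
  \int[rho]_x (A < (x - c) ^+ 2 < B)%R%:R <= 2 * M * (Num.sqrt B - Num.sqrt A).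
Proof.
move=> AB; have sAB : Num.sqrt A <= Num.sqrt B by rewrite ler_wsqrtr.
apply: (@le_trans _ _ (\int[rho]_x ((c - Num.sqrt B < x < c - Num.sqrt A)%R%:R +
   (c + Num.sqrt A < x < c + Num.sqrt B)%R%:R))).
  apply: E_le_ae.
  - exact: intg_annulus.
  - by apply: intgD; exact: intg_itvoo.
  - apply: aes_mp (rl_pt law c) => x xc.
    have [/andP[h1 h2]|_] := boolP (A < (x - c) ^+ 2 < B); last by rewrite addr_ge0 ?ler0n.
    have B0 : 0 < B by apply: le_lt_trans h2; exact: sqr_ge0.
    have l2 : `|x - c| < Num.sqrt B.
      by rewrite -sqrtr_sqr ltr_sqrt.
    have l1 : Num.sqrt A < `|x - c|.
      by rewrite -sqrtr_sqr ltr_sqrt// exprn_even_gt0//= subr_eq0.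
    have [xc0|xc0] := leP c x.
      rewrite (_ : (c + Num.sqrt A < x < c + Num.sqrt B)) ?lerDr ?ler0n//.
      move: l1 l2; rewrite ger0_norm ?subr_ge0//; lra.
    rewrite (_ : (c - Num.sqrt B < x < c - Num.sqrt A)) ?lerDl ?ler0n//.
    move: l1 l2; rewrite ltr0_norm ?subr_lt0//; lra.
rewrite E_D; [|exact: intg_itvoo|exact: intg_itvoo].
have := rl_up law (c := c - Num.sqrt B) (d := c - Num.sqrt A) ltac:(lra).
have := rl_up law (c := c + Num.sqrt A) (d := c + Num.sqrt B) ltac:(lra).
lra.
Qed.

Lemma sqrtB_le (A B : R) : 0 < B -> A <= B -> Num.sqrt B - Num.sqrt A <= (B - A) / Num.sqrt B.
Proof.
move=> B0 AB; rewrite ler_pdivlMr ?sqrtr_gt0// mulrBl -expr2 sqr_sqrtr ?(ltW B0)//.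
rewrite lerD2l lerN2; have [A0|A0] := leP A 0.
  by rewrite (le_trans A0)// mulr_ge0 ?sqrtr_ge0.
by rewrite -[leLHS]sqr_sqrtr ?(ltW A0)// expr2 ler_wpM2l ?sqrtr_ge0// ler_wsqrtr.
Qed.

(** The weights [step] and [sig e] differ by at most 1, and only at heights strictly between 0 and
    e^2, that is, in an annulus around y_i. *)
Lemma mass_step_sig e psi i : 0 < e ->
  `|mass y rho step psi i - mass y rho (sig e) psi i| <=
    2 * M * (Num.sqrt (psi 0 i) - Num.sqrt (psi 0 i - e ^+ 2)).
Proof.
move=> e0; have e20 : 0 < e ^+ 2 by rewrite exprn_gt0.
have i1 : intg rho (cellf y step psi i) := intg_cellf y rho meas_step step_bounds psi i.
have i2 : intg rho (cellf y (sig e) psi i) := intg_cellf y rho (meas_sig e) (sb e0) psi i.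
rewrite -E_B// (le_trans (E_norm (intgB i1 i2)))//.
have hA : psi 0 i - e ^+ 2 <= psi 0 i by lra.
have h := E_annulus (y i) hA.
apply: le_trans h; apply: E_le; [exact: intg_norm (intgB i1 i2)|exact: intg_annulus|move=> x].
rewrite /cellf; case: ifP => _; last by rewrite subrr normr0 ler0n.
have [t0|t0] := leP (score y psi i x) 0.
  by rewrite step_le0// sig_le0// subrr normr0 ler0n.
rewrite {1}/step t0; have [te|te] := leP (e ^+ 2) (score y psi i x).
  by rewrite sig_one// subrr normr0 ler0n.
rewrite (_ : _ < _ < _); last by move: t0 te; rewrite /score; lra.
have /andP[h1 h2] := sig_bounds (score y psi i x) e0.
by rewrite ger0_norm ?subr_ge0// gerBl.
Qed.

(** As G^eps(phi) = alpha, the pairing in the hypothesis is that of G^0(phi) - G^eps(phi) with phi -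
    psi; bounding it coordinatewise lets one factor |phi - psi| cancel. *)
Lemma rate_first e c r psi phi : 0 < e -> 0 < c ->
  (forall i, mass y rho step psi i = alpha i) -> (forall i, mass y rho (sig e) phi i = alpha i) ->
  c * Num.min r `|phi - psi| * `|phi - psi| <=
      \sum_(i < n.+1) (mass y rho step phi i - alpha i) * (phi - psi) 0 i ->
  forall K, 0 <= K ->
   (forall i, 2 * M * (Num.sqrt (phi 0 i) - Num.sqrt (phi 0 i - e ^+ 2)) <= K) ->
  Num.min r `|phi - psi| <= n.+1%:R * K / c.
Proof.
move=> e0 c0 hs hp hr K K0 hK; rewrite ler_pdivlMr// mulrC.
have [->|ne] := eqVneq phi psi.
  rewrite subrr normr0; apply: (@le_trans _ _ 0); last by rewrite mulr_ge0.
  by rewrite pmulr_rle0// ge_min lexx orbT.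
have d0 : 0 < `|phi - psi| by rewrite normr_gt0 subr_eq0.
rewrite -(ler_pM2r d0) (le_trans hr)//.
apply: (le_trans (ler_norm _)); apply: (le_trans (ler_norm_sum _ _ _)).
apply: (@le_trans _ _ (\sum_(i < n.+1) K * `|phi - psi|)); last first.
  by rewrite sumr_const card_ord -[leLHS]mulr_natl mulrA.
apply: ler_sum => i _; rewrite normrM ler_pM ?coord_le_norm//.
by rewrite -(hp i); apply: (le_trans (mass_step_sig _ _ e0)).
Qed.

Lemma norm2_le (v : 'rV[R]_n.+1) : norm2 v <= n.+1%:R * `|v|.
Proof.
rewrite /norm2 -[leRHS]ger0_norm ?mulr_ge0// -sqrtr_sqr ler_wsqrtr//.
apply: (@le_trans _ _ (\sum_(i < n.+1) `|v| ^+ 2)).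
  apply: ler_sum => i _; rewrite -[leLHS]real_normK ?num_real//.
  by rewrite ler_sqr ?nnegrE// coord_le_norm.
rewrite sumr_const card_ord -[leLHS]mulr_natl exprMn ler_wpM2r ?sqr_ge0//.
by rewrite expr2 ler_peMl// ler1n.
Qed.

(** Two passes. With no information on p = psi_i, the bound sqrt p - sqrt (p - e^2) <= e gives a
    distance O(e). This keeps p above half of a lower bound for the coordinates of psi^* , where the
    same difference is O(e^2). *)
Lemma rate_of_convergence : exists2 eps0, 0 < eps0 & exists C : R, forall psistar,
  is_maximizer [set phi : 'rV[R]_n.+1 | forall i, 0 < phi 0 i] (Kfun rho y alpha) psistar ->
  forall e psi, 0 < e < eps0 -> (forall i, mass y rho (sig e) psi i = alpha i) ->
    norm2 (psi - psistar) <= C * e ^+ 2.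
Proof.
(* The constants precede the maximizer in the statement, so one maximizer is fixed here;
   [star_unique] identifies any other with it, and if there is none the claim is vacuous. *)
have [[star hstar]|no] := pselect (exists psistar,
  is_maximizer [set phi : 'rV[R]_n.+1 | forall i, 0 < phi 0 i] (Kfun rho y alpha) psistar); last first.
  by exists 1 => //; exists 0 => psistar h; exfalso; apply: no; exists psistar.
have ms := star_mass hstar.
have [mu mu0 hmu] := pos_lower hstar.1.
have [c c0 [r r0 hr]] := step_resolvent ms.
have M0 := rl_M law.
pose N : R := n.+1%:R.
have N0 : 0 < N by rewrite ltr0n.
pose C1 := N * (2 * M) / c.
have C10 : 0 < C1 by rewrite divr_gt0 ?mulr_gt0.
(* Makes C1 e smaller than r, so that the minimum in the resolvent bound is the distance itself, and
   smaller than mu / 2, so that the coordinates remain above mu / 2. *)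
pose eps0 := Num.min r (mu / 2) / C1.
have eps00 : 0 < eps0 by rewrite divr_gt0// lt_min r0 divr_gt0.
exists eps0 => //; exists (N * (N * (2 * M / Num.sqrt (mu / 2)) / c)).
move=> psistar hps e psi /andP[e0 ee] he.
have -> : psistar = star by apply: star_unique => //; exact: star_mass.
have hpsi := hr psi.
have C1e : C1 * e < Num.min r (mu / 2) by rewrite mulrC -ltr_pdivlMr.
have first : Num.min r `|psi - star| <= C1 * e.
  have := rate_first e0 c0 ms he hpsi (K := 2 * M * e) _ _.
  rewrite (_ : N * (2 * M * e) / c = C1 * e); last by rewrite /C1; ring.
  apply; first by rewrite !mulr_ge0// ltW.
  move=> i; rewrite ler_pM2l ?mulr_gt0//.
  have := sqrt_dist (psi 0 i) (psi 0 i - e ^+ 2).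
  rewrite subKr (ger0_norm (sqr_ge0 e)) sqrtr_sqr (gtr0_norm e0).
  by apply: le_trans; exact: ler_norm.
have dC : `|psi - star| <= C1 * e.
  move: first; rewrite ge_min => /orP[rC|//].
  by have := lt_le_trans C1e; move=> /(_ r); rewrite ge_min lexx ltNge rC => /(_ isT).
have psi_mu i : mu / 2 <= psi 0 i.
  have h1 : `|(psi - star) 0 i| < mu / 2.
    apply: (le_lt_trans (coord_le_norm _ _)); apply: (le_lt_trans dC); apply: (lt_le_trans C1e).
    by rewrite ge_min lexx orbT.
  have := hmu i; move: h1; rewrite !mxE ltr_norml; lra.
have mu20 : 0 < mu / 2 by rewrite divr_gt0.
have second : Num.min r `|psi - star| <= N * (2 * M * (e ^+ 2 / Num.sqrt (mu / 2))) / c.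
  apply: (rate_first e0 c0 ms he hpsi).
    by rewrite !mulr_ge0 ?sqr_ge0 ?invr_ge0 ?sqrtr_ge0// ltW.
  move=> i; rewrite ler_pM2l ?mulr_gt0//.
  have p0 : 0 < psi 0 i by apply: lt_le_trans (psi_mu i).
  apply: (le_trans (@sqrtB_le (psi 0 i - e ^+ 2) _ p0 ltac:(have := sqr_ge0 e; lra))).
  rewrite subKr ler_wpM2l ?sqr_ge0// lef_pV2 ?posrE ?sqrtr_gt0//.
  exact: ler_wsqrtr.
rewrite min_r in second; last first.
  apply: (le_trans dC); apply: ltW; apply: (lt_le_trans C1e); by rewrite ge_min lexx.
apply: (le_trans (norm2_le _)); rewrite -/N.
rewrite (_ : _ * e ^+ 2 = N * (N * (2 * M * (e ^+ 2 / Num.sqrt (mu / 2))) / c)); last by ring.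
by rewrite ler_pM2l.
Qed.

End Maximizers.

(** * Differentiation of the masses *)

Section InverseSquareRoot.
Context {R : realType}.
Variable rho : probability (measurableTypeR R) R.

Lemma meas_norm_lt (q : R -> R) (s : R) : measurable_fun setT q ->
  measurable_fun setT (fun x => (`|q x| < s)%R%:R : R).
Proof.
move=> mq; have -> : (fun x => (`|q x| < s)%R%:R : R) = (fun x => if `|q x| < s then 1 else 0).
  by apply/funext => x; case: (_ < s).
apply: measurable_fun_ifT => //; apply: measurable_fun_ltr => //.
by apply: measurableT_comp => //.
Qed.

Lemma sum_pow_half N : \sum_(k < N) 2 / 2 ^+ k <= 4 :> R.
Proof.
suff -> : \sum_(k < N) 2 / 2 ^+ k = 4 - 4 / 2 ^+ N :> R.
  by rewrite gerBl divr_ge0// exprn_ge0.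
elim: N => [|N IH]; first by rewrite big_ord0 expr0 divr1 subrr.
rewrite big_ord_recr /= IH exprS; field; by rewrite expf_neq0// lt0r_neq0.
Qed.

(* A dyadic layer-cake estimate: on tau / 4^(k+1) <= |q| < tau / 4^k the integrand is at most
   2^(k+1) / sqrt tau, and the layer has mass at most B tau / 4^k. *)
Lemma inv_sqrt_tail (q : R -> R) (B tau : R) : measurable_fun setT q -> 0 <= B -> 0 < tau ->
  (forall s, 0 < s -> \int[rho]_x (`|q x| < s)%R%:R <= B * s) ->
  intg rho (fun x => if `|q x| < tau then (Num.sqrt `|q x|)^-1 else 0) /\
  \int[rho]_x (if `|q x| < tau then (Num.sqrt `|q x|)^-1 else 0) <= 4 * B * Num.sqrt tau.
Proof.
move=> mq B0 tau0 hB.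
set f := fun x => if _ then _ else _.
have f0 x : 0 <= f x by rewrite /f; case: ifP => // _; rewrite invr_ge0 sqrtr_ge0.
have mabs : measurable_fun setT (fun x => `|q x|) by apply: measurableT_comp.
have mf : measurable_fun setT f.
  apply: measurable_fun_ifT => //; first exact: measurable_fun_ltr.
  have -> : (fun x => (Num.sqrt `|q x|)^-1) = (fun x => `|q x| `^ (- 2^-1)).
    by apply/funext => x; rewrite powRN powR12_sqrt.
  exact: (measurableT_comp (@measurable_powR R (- 2^-1)) mabs).
pose c k : R := 2 ^+ k.+1 / Num.sqrt tau.
pose I k x : R := c k * (`|q x| < tau / 4 ^+ k)%R%:R.
have st0 : 0 < Num.sqrt tau by rewrite sqrtr_gt0.
have c0 k : 0 <= c k by rewrite divr_ge0 ?exprn_ge0// ltW.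
have I0 k x : 0 <= I k x by rewrite mulr_ge0.
have iN k : intg rho (fun x => (`|q x| < tau / 4 ^+ k)%R%:R).
  apply: (@intg_bnd _ _ _ 1); first exact: meas_norm_lt.
  by move=> x; case: (_ < _); rewrite ?normr1 ?normr0.
have iI k : intg rho (I k) by apply: intgZ.
have layer x : exists k, f x <= I k x.
  rewrite /f; case: ifP => [hx|_]; last by exists 0%N.
  (* At a zero of q the integrand is 0, since 0^-1 = 0. *)
  have [->|q0] := eqVneq (q x) 0; first by exists 0%N; rewrite normr0 sqrtr0 invr0.
  have aq : 0 < `|q x| by rewrite normr_gt0.
  have ex : exists k, tau / 4 ^+ k.+1 <= `|q x|.
    exists (Num.truncn (tau / `|q x|)).+1; rewrite ler_pdivrMr ?exprn_gt0// mulrC -ler_pdivrMr//.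
    apply: (le_trans (ltW (truncnS_gt _))); rewrite -natrX ler_nat ltnW// ltnW//.
    by rewrite (leq_trans (ltn_expl _ (isT : 1 < 4)%N))// leq_exp2l.
  have [k hk kmin] := ex_minnP ex; exists k.
  have hk2 : `|q x| < tau / 4 ^+ k.
    case: k kmin {hk} => [|k] kmin; first by rewrite expr0 divr1.
    by rewrite ltNge; apply/negP => /kmin; rewrite ltnn.
  rewrite /I hk2 mulr1 /c -[leLHS]mul1r -[leLHS]/(1 / _) ler_pdivrMr ?sqrtr_gt0//.
  rewrite mulrAC ler_pdivlMr// mul1r -(@ler_sqr _ (Num.sqrt tau)) ?nnegrE ?mulr_ge0 ?exprn_ge0 ?sqrtr_ge0//.
  rewrite exprMn !sqr_sqrtr ?(ltW tau0)// -exprM mulnC exprM (_ : 2 ^+ 2 = 4 :> R); last by ring.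
  by rewrite mulrC -ler_pdivrMr ?exprn_gt0.
have key : (\int[rho]_x (f x)%:E <= (4 * B * Num.sqrt tau)%:E)%E.
  apply: (@le_trans _ _ (\int[rho]_x (\sum_(0 <= k <oo) (I k x)%:E))%E).
    apply: ge0_le_integral => //.
    - by move=> x _; rewrite lee_fin.
    - exact/measurable_EFinP.
    - apply: ge0_emeasurable_sum => k.
        by move=> x _ _; rewrite lee_fin.
      by move=> _; apply/measurable_EFinP; exact: intg_meas (iI k).
    - move=> x _; have [k hk] := layer x.
      apply: (le_trans _ (nneseries_lim_ge k.+1 _)); last by move=> j _ _; rewrite lee_fin.
      rewrite big_nat_recr//= -[leLHS]add0e leeD ?lee_fin//.
      by apply: sume_ge0 => j _; rewrite lee_fin.
  rewrite integral_nneseries//; last 2 first.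
  - by move=> k; apply/measurable_EFinP; exact: intg_meas (iI k).
  - by move=> k x _; rewrite lee_fin.
  apply: lime_le.
    by apply: is_cvg_nneseries => k _ _; apply: integral_ge0 => x _; rewrite lee_fin.
  apply: nearW => N.
  (* Layer k contributes 2^(k+1) / sqrt tau times B tau / 4^k, that is, 2 B sqrt tau / 2^k; the
     geometric series sums to 4 B sqrt tau. *)
  have h k : (\int[rho]_x (I k x)%:E <= ((2 / 2 ^+ k) * (B * Num.sqrt tau))%:E)%E.
    have -> : (\int[rho]_x (I k x)%:E = (\int[rho]_x I k x)%:E)%E.
      by rewrite fineK//; apply: integrable_fin_num => //; exact: iI.
    rewrite lee_fin E_Z//.
    apply: (le_trans (ler_wpM2l (c0 k) (hB (tau / 4 ^+ k) _))); first by rewrite divr_gt0 ?exprn_gt0.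
    rewrite le_eqVlt; apply/orP; left; apply/eqP; rewrite /c -{2}(sqr_sqrtr (ltW tau0)).
    rewrite (_ : 4 ^+ k = 2 ^+ k * 2 ^+ k :> R); last by rewrite -expr2 -exprM mulnC exprM; congr (_ ^+ _); ring.
    have s20 : Num.sqrt tau != 0 by rewrite gt_eqF.
    have p20 : 2 ^+ k != 0 :> R by rewrite expf_neq0// pnatr_eq0.
    by rewrite exprS; field; rewrite ?s20 ?p20.
  apply: (@le_trans _ _ (\sum_(0 <= k < N) ((2 / 2 ^+ k) * (B * Num.sqrt tau))%:E)%E).
    by apply: lee_sum.
  rewrite sumEFin lee_fin -mulr_suml big_mkord.
  rewrite -mulrA ler_wpM2r ?sum_pow_half// mulr_ge0// ltW.
have jf : intg rho f.
  apply/integrableP; split; first exact/measurable_EFinP.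
  apply: (@le_lt_trans _ _ (\int[rho]_x (f x)%:E)%E); last exact: le_lt_trans key (ltry _).
  rewrite le_eqVlt; apply/orP; left; apply/eqP; apply: eq_integral => x _ /=.
  by rewrite ger0_norm.
split => //; rewrite -lee_fin; apply: le_trans key.
by rewrite fineK//; apply: integrable_fin_num.
Qed.

End InverseSquareRoot.

(** * The square root capped at e *)

Section CappedRoot.
Context {R : realType}.
Implicit Types e s t : R.

(** Taking the factor 1 / e out of [sig] leaves e as a mere ceiling: the partial derivatives become
    an indicator and an inverse root, failing only at the heights 0 and e^2. *)
Definition cap e t : R := Num.min (Num.sqrt t) e.
Definition dcap_e e t : R := if e ^+ 2 < t then 1 else 0.
Definition dcap_t e t : R := if 0 < t < e ^+ 2 then (2 * Num.sqrt t)^-1 else 0.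

Lemma sig_cap e t : 0 < e -> sig e t = e^-1 * cap e t.
Proof.
move=> e0; rewrite /cap minr_pMr ?invr_ge0 ?(ltW e0)// mulVf ?gt_eqF//.
by rewrite /sig mulrC.
Qed.

Lemma sqrt_lt_cap e t : 0 < e -> t < e ^+ 2 -> Num.sqrt t < e.
Proof.
move=> e0 te; rewrite -[ltRHS]gtr0_norm// -sqrtr_sqr ltr_sqrt// exprn_gt0//.
Qed.

Lemma cap_lt_sqrt e t : 0 < e -> e ^+ 2 < t -> e < Num.sqrt t.
Proof.
move=> e0 te; rewrite -[ltLHS]gtr0_norm// -sqrtr_sqr ltr_sqrt//.
by apply: lt_trans te; rewrite exprn_gt0.
Qed.

Lemma cap_dist e e' s t : `|cap e s - cap e' t| <= `|e - e'| + `|Num.sqrt s - Num.sqrt t|.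
Proof.
rewrite /cap; move: (Num.sqrt s) (Num.sqrt t) => p q.
have h1 := ler_norm (e - e'); have h2 := ler_norm (- (e - e')).
have h3 := ler_norm (p - q); have h4 := ler_norm (- (p - q)).
rewrite !normrN in h2 h4.
by rewrite ler_norml /Num.min; case: ifP => h5; case: ifP => h6; apply/andP; split; lra.
Qed.

(** The constant involves the base point t alone, whatever the signs, and so dominates all
    difference quotients at t. For t < 0 < s it comes from 2 sqrt(s) sqrt(-t) <= s - t. *)
Lemma sqrt_lip s t : t != 0 -> `|Num.sqrt s - Num.sqrt t| <= `|s - t| / Num.sqrt `|t|.
Proof.
move=> t0; have at0 : 0 < `|t| by rewrite normr_gt0.
rewrite ler_pdivlMr ?sqrtr_gt0//.
have [tp|tn] := leP 0 t.
  have {}tp : 0 < t by rewrite lt_neqAle eq_sym t0.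
  rewrite (gtr0_norm tp); have st0 : 0 < Num.sqrt t by rewrite sqrtr_gt0.
  have [s0|s0] := leP s 0.
    rewrite (ler0_sqrtr s0) sub0r normrN gtr0_norm// -expr2 sqr_sqrtr ?(ltW tp)//.
    by rewrite distrC ger0_norm; lra.
  rewrite -{2}(sqr_sqrtr (ltW s0)) -{3}(sqr_sqrtr (ltW tp)) subr_sqr normrM ler_wpM2l//.
  by rewrite ger0_norm ?addr_ge0 ?sqrtr_ge0// lerDr sqrtr_ge0.
rewrite (ler0_sqrtr (ltW tn)) subr0 (ltr0_norm tn).
have [s0|s0] := leP s 0.
  by rewrite (ler0_sqrtr s0) normr0 mul0r.
rewrite ger0_norm ?sqrtr_ge0// ger0_norm; last lra.
have nt0 : 0 <= - t by lra.
have := sqr_ge0 (Num.sqrt s - Num.sqrt (- t)).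
have hh : 0 <= Num.sqrt s * Num.sqrt (- t) by rewrite mulr_ge0 ?sqrtr_ge0.
rewrite sqrrB sqr_sqrtr ?(ltW s0)// sqr_sqrtr// mulr2n; lra.
Qed.

(** Below 0, above e^2 and in between, one formula for [cap] is valid at all nearby (e', t'); only
    the middle regime leaves a remainder. *)
Lemma cap_expansion e t : 0 < e -> t != 0 -> t != e ^+ 2 -> forall eta, 0 < eta ->
  exists2 r : R, 0 < r & forall e' t' : R, `|e' - e| + `|t' - t| < r ->
  `|cap e' t' - cap e t - (dcap_e e t * (e' - e) + dcap_t e t * (t' - t))|
     <= eta * (`|e' - e| + `|t' - t|).
Proof.
move=> e0 t0 te eta eta0; have e20 : 0 < e ^+ 2 by rewrite exprn_gt0.
have close (r e' t' : R) : `|e' - e| + `|t' - t| < r -> `|e' - e| < r /\ `|t' - t| < r.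
  by have := normr_ge0 (e' - e); have := normr_ge0 (t' - t); split; lra.
have rhs0 e' t' : 0 <= eta * (`|e' - e| + `|t' - t|) by rewrite mulr_ge0 ?addr_ge0// ltW.
rewrite /dcap_e /dcap_t.
have [tn|tp] := ltP t 0.
  exists (Num.min (- t) e); first by rewrite lt_min e0 oppr_gt0 tn.
  move=> e' t' /close; rewrite !lt_min => -[/andP[_ h1] /andP[h2 _]].
  rewrite (ltNge (e ^+ 2)) (ltW (lt_trans tn e20)) (ltNge 0) (ltW tn) /= !mul0r addr0 subr0.
  move: h1 h2; rewrite !ltr_norml => h1 h2.
  have t'n : t' <= 0 by lra.
  have e'p : 0 <= e' by lra.
  rewrite /cap (ler0_sqrtr t'n) (ler0_sqrtr (ltW tn)) (min_l e'p) (min_l (ltW e0)) subrr normr0.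
  exact: rhs0.
have {t0}tp : 0 < t by rewrite lt_neqAle eq_sym t0.
have [th|tl] := ltP (e ^+ 2) t.
  have g0 := cap_lt_sqrt e0 th; rewrite -subr_gt0 in g0.
  have st0 : 0 < Num.sqrt t by rewrite sqrtr_gt0.
  set g := Num.sqrt t - e in g0.
  exists (Num.min (g / 2) (g / 2 * Num.sqrt t)).
    by rewrite lt_min !mulr_gt0 ?invr_gt0.
  move=> e' t' /close; rewrite !lt_min => -[/andP[h1 _] /andP[_ h2]].
  have h3 : `|Num.sqrt t' - Num.sqrt t| < g / 2.
    apply: (le_lt_trans (sqrt_lip t' (lt0r_neq0 tp))).
    by rewrite (gtr0_norm tp) ltr_pdivrMr.
  rewrite (ltNge t) (ltW th) andbF mul1r mul0r addr0.
  move: h1 h3; rewrite !ltr_norml => h1 h3.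
  have a1 : e' <= Num.sqrt t' by rewrite /g in h1 h3; lra.
  have a2 : e <= Num.sqrt t by rewrite -subr_ge0 ltW.
  rewrite /cap (min_r a1) (min_r a2) subrr normr0.
  exact: rhs0.
have {te}tl : t < e ^+ 2 by rewrite lt_neqAle te.
have g0 := sqrt_lt_cap e0 tl; rewrite -subr_gt0 in g0.
have st0 : 0 < Num.sqrt t by rewrite sqrtr_gt0.
set g := e - Num.sqrt t in g0.
exists (Num.min (Num.min (g / 2) (g / 2 * Num.sqrt t)) (Num.min t (eta * (2 * Num.sqrt t) * t))).
  by rewrite !lt_min tp !mulr_gt0 ?invr_gt0.
move=> e' t' /close; rewrite !lt_min => -[/andP[/andP[h1 _] _] /andP[/andP[_ h2] /andP[h4 h5]]].
have h3 : `|Num.sqrt t' - Num.sqrt t| <= `|t' - t| / Num.sqrt t.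
  by have := sqrt_lip t' (lt0r_neq0 tp); rewrite (gtr0_norm tp).
have h3' : `|Num.sqrt t' - Num.sqrt t| < g / 2.
  by apply: (le_lt_trans h3); rewrite ltr_pdivrMr.
have t'0 : 0 <= t' by move: h4; rewrite ltr_norml; lra.
have a1 : Num.sqrt t' <= e' by move: h1 h3'; rewrite !ltr_norml /g; lra.
have a2 : Num.sqrt t <= e by rewrite -subr_ge0 ltW.
rewrite tp tl /= mul0r add0r /cap (min_l a1) (min_l a2).
apply: (@le_trans _ _ (eta * `|t' - t|)); last by rewrite ler_pM2l// lerDr.
(* The remainder of the root is an exact square up to sign, to which the Lipschitz bound [h3]
   applies. *)
have E : Num.sqrt t' - Num.sqrt t - (2 * Num.sqrt t)^-1 * (t' - t) =
   - ((Num.sqrt t' - Num.sqrt t) ^+ 2 / (2 * Num.sqrt t)).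
  rewrite -{2}(sqr_sqrtr t'0) -{3}(sqr_sqrtr (ltW tp)).
  by field; rewrite gt_eqF.
rewrite E normrN normrM (ger0_norm (sqr_ge0 _)) gtr0_norm ?invr_gt0 ?mulr_gt0//.
rewrite ler_pdivrMr ?mulr_gt0//.
apply: (@le_trans _ _ ((`|t' - t| / Num.sqrt t) ^+ 2)).
  by rewrite -[leLHS]real_normK ?num_real// ler_sqr ?nnegrE ?divr_ge0 ?sqrtr_ge0.
rewrite exprMn exprVn sqr_sqrtr ?(ltW tp)// ler_pdivrMr// expr2 -[leRHS]mulrA mulrAC ler_wpM2r//.
apply: ltW; apply: (lt_le_trans h5); rewrite le_eqVlt; apply/orP; left; apply/eqP; ring.
Qed.

Lemma cap_bounds e t : 0 < e -> 0 <= cap e t <= e.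
Proof. by move=> e0; rewrite le_min sqrtr_ge0 (ltW e0)/= ge_min lexx orbT. Qed.

Lemma continuous_cap e : continuous (cap e).
Proof.
move=> t; apply: (@continuous_min R R Num.sqrt (fun=> e)); last exact: cvg_cst.
exact: sqrt_continuous.
Qed.

Lemma meas_cap e : measurable_fun setT (cap e).
Proof. by apply: continuous_measurable_fun; exact: continuous_cap. Qed.

Lemma meas_dcap_e e : measurable_fun setT (dcap_e e).
Proof. by apply: measurable_fun_ifT => //; exact: measurable_fun_ltr. Qed.

Lemma meas_dcap_t e : measurable_fun setT (dcap_t e).
Proof.
have -> : dcap_t e = (fun t => if 0 < t then (if t < e ^+ 2 then 2^-1 * t `^ (- 2^-1) else 0) else 0).
  apply/funext => t; rewrite /dcap_t; have [t0|//] := boolP (0 < t).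
  by rewrite /=; case: ifP => // _; rewrite powRN powR12_sqrt ?(ltW t0)// invfM.
apply: measurable_fun_ifT => //; first exact: measurable_fun_ltr.
apply: measurable_fun_ifT => //; first exact: measurable_fun_ltr.
by apply: measurable_funM => //; exact: measurable_powR.
Qed.

Lemma dcap_t_bounds e t : 0 <= dcap_t e t <= (Num.sqrt `|t|)^-1.
Proof.
rewrite /dcap_t; case: ifP => [/andP[t0 _]|_]; last by rewrite lexx invr_ge0 sqrtr_ge0.
have st0 : 0 < Num.sqrt t by rewrite sqrtr_gt0.
rewrite invr_ge0 mulr_ge0 ?(ltW st0)//= (gtr0_norm t0) lef_pV2 ?posrE ?mulr_gt0//.
by rewrite ler_peMl ?(ltW st0)// ler1n.
Qed.

End CappedRoot.

Section DominatedContinuity.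
Context {R : realType}.
Variable rho : probability (measurableTypeR R) R.

(** The zeroth-order analogue of [E_expansion], by the same passage to a sequence. *)
Lemma E_continuity (T : Type) (sz : T -> R) (F : T -> R -> R) (F0 g : R -> R) (r : R) :
  0 < r -> (forall v, measurable_fun setT (F v)) -> measurable_fun setT F0 -> intg rho g ->
  aes rho (fun x => forall v, sz v < r -> `|F v x| <= g x) ->
  aes rho (fun x => forall eta, 0 < eta -> exists2 s, 0 < s &
    forall v, sz v < s -> `|F v x - F0 x| <= eta) ->
  forall eta, 0 < eta -> exists2 s, 0 < s & forall v, sz v < s ->
    `|\int[rho]_x F v x - \int[rho]_x F0 x| <= eta.
Proof.
move=> r0 mF mF0 ig hF hd eta eta0; apply: contrapT => no.
have bad (k : nat) : exists v, sz v < Num.min r k.+1%:R^-1 /\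
    eta < `|\int[rho]_x F v x - \int[rho]_x F0 x|.
  apply: contrapT => nb; apply: no; exists (Num.min r k.+1%:R^-1).
    by rewrite lt_min r0 invr_gt0 ltr0n.
  move=> v hv; rewrite leNgt; apply/negP => hh; apply: nb; by exists v.
pose v k := projT1 (cid (bad k)).
have [vr vk vb] : [/\ forall k, sz (v k) < r, forall k, sz (v k) < k.+1%:R^-1 &
    forall k, eta < `|\int[rho]_x F (v k) x - \int[rho]_x F0 x|].
  by split => k; rewrite /v; case: cid => /= z []; rewrite lt_min => /andP[].
have cv : (fun k => \int[rho]_x F (v k) x) @ \oo --> \int[rho]_x F0 x.
  apply: (@E_dct _ _ (fun k => F (v k)) F0 g) => //.
    apply: aes_mp hd => x hx; apply/cvgrPdist_le => e e0.
    have [s s0 hs] := hx e e0.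
    have [N hN] : exists N, s^-1 <= N%:R.
      by exists (Num.truncn s^-1).+1; apply/ltW/truncnS_gt.
    exists N => // k /= Nk; rewrite distrC; apply: hs; apply: (lt_le_trans (vk k)).
    rewrite -[s in leRHS]invrK lef_pV2 ?posrE ?invr_gt0 ?ltr0n//.
    by apply: (le_trans hN); rewrite ler_nat (leq_trans Nk).
  by apply: aes_mp hF => x hx k; exact: hx.
move/cvgrPdist_le: cv => /(_ eta eta0) [N _ hN].
by have := hN N (leqnn N); rewrite /= distrC leNgt vb.
Qed.

End DominatedContinuity.

Section LocalConstancy.
Context {R : realType}.
Implicit Types e t : R.

Lemma sqr_cmp_stable e t : 0 < e -> t != e ^+ 2 ->
  exists2 s : R, 0 < s & forall e' t', `|e' - e| + `|t' - t| < s ->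
    (e' ^+ 2 < t') = (e ^+ 2 < t) /\ (t' < e' ^+ 2) = (t < e ^+ 2).
Proof.
move=> e0 te; set g := `|e ^+ 2 - t|.
have g0 : 0 < g by rewrite normr_gt0 subr_eq0 eq_sym.
exists (Num.min 1 (g / (2 * e + 2))).
  by rewrite lt_min ltr01 divr_gt0// addr_gt0// mulr_gt0.
move=> e' t'; rewrite lt_min ltr_pdivlMr ?addr_gt0 ?mulr_gt0// => /andP[h1 h2].
have p1 := normr_ge0 (e' - e); have p2 := normr_ge0 (t' - t).
have h3 : `|e' ^+ 2 - e ^+ 2| <= `|e' - e| * (2 * e + 1).
  rewrite subr_sqr normrM ler_wpM2l// (_ : e' + e = (e' - e) + 2 * e); last by ring.
  by rewrite (le_trans (ler_normD _ _))// (gtr0_norm (_ : 0 < 2 * e)) ?mulr_gt0//; lra.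
have h4 : `|(e' ^+ 2 - t') - (e ^+ 2 - t)| < g.
  apply: (@le_lt_trans _ _ (`|e' ^+ 2 - e ^+ 2| + `|t' - t|)).
    rewrite (_ : _ - _ = (e' ^+ 2 - e ^+ 2) - (t' - t)); last by ring.
    exact: ler_normB.
  have : `|t' - t| <= `|t' - t| * (2 * e + 1) by rewrite ler_peMr//; lra.
  move: h2 h3; rewrite mulrDl; nra.
have [lt1|lt2|eq3] := ltgtP t (e ^+ 2).
- have gE : g = e ^+ 2 - t by rewrite /g gtr0_norm ?subr_gt0.
  move: h4; rewrite gE ltr_norml => /andP[h5 h6].
  by split; [apply/negbTE; rewrite -leNgt|]; lra.
- have gE : g = t - e ^+ 2 by rewrite /g ltr0_norm ?subr_lt0// opprB.
  move: h4; rewrite gE ltr_norml => /andP[h5 h6].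
  by split; [|apply/negbTE; rewrite -leNgt]; lra.
- by rewrite eq3 eqxx in te.
Qed.

Lemma dcap_e_cont e t : 0 < e -> t != e ^+ 2 ->
  exists2 s : R, 0 < s & forall e' t', `|e' - e| + `|t' - t| < s -> dcap_e e' t' = dcap_e e t.
Proof.
move=> e0 te; have [s s0 hs] := sqr_cmp_stable e0 te.
by exists s => // e' t' /hs[h _]; rewrite /dcap_e h.
Qed.

Lemma dcap_t_cont e t : 0 < e -> t != 0 -> t != e ^+ 2 -> forall eta, 0 < eta ->
  exists2 s : R, 0 < s & forall e' t', `|e' - e| + `|t' - t| < s ->
    `|dcap_t e' t' - dcap_t e t| <= eta.
Proof.
move=> e0 t0 te eta eta0; have [s s0 hs] := sqr_cmp_stable e0 te.
have small (r e' t' : R) : `|e' - e| + `|t' - t| < r -> `|t' - t| < r.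
  by have := normr_ge0 (e' - e); lra.
have [tn|tp] := ltP t 0.
  exists (- t); first by rewrite oppr_gt0.
  move=> e' t' /small; rewrite ltr_norml => /andP[_ h].
  rewrite /dcap_t (ltNge 0 t) (ltW tn) (ltNge 0 t') (_ : t' <= 0) /=; last lra.
  by rewrite subrr normr0 ltW.
have {t0}tp : 0 < t by rewrite lt_neqAle eq_sym t0.
have st0 : 2 * Num.sqrt t != 0 by rewrite gt_eqF// mulr_gt0// sqrtr_gt0.
have cont : {for t, continuous (fun t => (2 * Num.sqrt t)^-1)}.
  apply: cvgV => //; apply: cvgM; [exact: cvg_cst|exact: sqrt_continuous].
have /cvgrPdist_le /(_ eta eta0) /nbhs_ballP [r /= r0 hr] := cont.
exists (Num.min (Num.min s r) t); first by rewrite !lt_min s0 r0.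
move=> e' t'; rewrite !lt_min => /andP[/andP[/hs[_ h1] /small h2] /small h3].
rewrite /dcap_t h1 tp (_ : 0 < t') /=; last by move: h3; rewrite ltr_norml; lra.
case: ifP => _; last by rewrite subrr normr0 ltW.
by rewrite distrC; apply: hr; rewrite /ball /= distrC.
Qed.

End LocalConstancy.

(** * Masses on half-lines *)

Section Slice.
Context {R : realType}.
Variables (rho : probability (measurableTypeR R) R) (a b m M : R) (dens : R -> R).
Hypothesis law : regular_law rho a b m M dens.
Variable c : R.
Implicit Types e p u x s : R.

Definition height p x := p - (x - c) ^+ 2.
(* e times the regularized mass that a site c of potential p would have on ]-oo, u];
   [slice_e], [slice_p], [slice_u] are its partial derivatives. *)
Definition slice e p u := \int[rho]_x (if x <= u then cap e (height p x) else 0).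
Definition slice_e e p u := \int[rho]_x (if x <= u then dcap_e e (height p x) else 0).
Definition slice_p e p u := \int[rho]_x (if x <= u then dcap_t e (height p x) else 0).
(** The extension by 0 accommodates ends that lie outside the support. *)
Definition ldens u := if a < u < b then dens u else 0.
Definition slice_u e p u := cap e (height p u) * ldens u.

Lemma meas_height p : measurable_fun setT (height p).
Proof.
apply: measurable_funB => //; apply: measurable_funX; apply: measurable_funB => //.
Qed.

Lemma meas_slice (f : R -> R) p u : measurable_fun setT f ->
  measurable_fun setT (fun x => if x <= u then f (height p x) else 0).
Proof.
move=> mf; apply: measurable_fun_ifT => //; first exact: measurable_fun_ler.
by apply: measurableT_comp => //; exact: meas_height.
Qed.

Lemma aes_height_neq p (z : R) : aes rho (fun x => height p x != z).
Proof.
apply: aes_mp (aes_and (rl_pt law (c + Num.sqrt (p - z))) (rl_pt law (c - Num.sqrt (p - z)))).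
move=> x [h1 h2]; apply/eqP => hx.
have e1 : Num.sqrt (p - z) = `|x - c|.
  by rewrite -sqrtr_sqr; congr Num.sqrt; rewrite -hx /height; ring.
by move: e1; case: (ger0P (x - c)) => _ hs; [move: h1|move: h2]; rewrite hs => /eqP; apply; ring.
Qed.

(** For p > 0 the height crosses 0 with nonzero slope at c +- sqrt p, so the band is an annulus of
    width at most 2 s / sqrt p; at p = 0 the width would be of order sqrt s. *)
Lemma height_band p s : 0 < p -> 0 < s ->
  \int[rho]_x (`|height p x| < s)%R%:R <= 4 * M / Num.sqrt p * s.
Proof.
move=> p0 s0; have M0 := rl_M law.
have sp0 : 0 < Num.sqrt p by rewrite sqrtr_gt0.
have -> : \int[rho]_x (`|height p x| < s)%R%:R =
    \int[rho]_x (p - s < (x - c) ^+ 2 < p + s)%R%:R.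
  apply: eq_E => x; congr (nat_of_bool _)%:R; rewrite ltr_norml /height.
  by apply/idP/idP; lra.
have h1 : p - s <= p + s by lra.
have h2 : 0 < p + s by lra.
apply: (le_trans (E_annulus law c h1)).
have h3 : 2 * M * (Num.sqrt (p + s) - Num.sqrt (p - s)) <= 2 * M * ((p + s - (p - s)) / Num.sqrt (p + s)).
  by rewrite ler_pM2l ?mulr_gt0//; exact: sqrtB_le.
apply: (le_trans h3).
rewrite (_ : 2 * M * _ = 4 * M * s / Num.sqrt (p + s)); last by ring.
rewrite [leRHS]mulrAC ler_wpM2l ?mulr_ge0 ?(ltW M0) ?(ltW s0)//.
by rewrite lef_pV2 ?posrE ?sqrtr_gt0// ler_wsqrtr//; lra.
Qed.

Lemma height_tail p tau : 0 < p -> 0 < tau ->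
  intg rho (fun x => if `|height p x| < tau then (Num.sqrt `|height p x|)^-1 else 0) /\
  \int[rho]_x (if `|height p x| < tau then (Num.sqrt `|height p x|)^-1 else 0)
    <= 16 * M / Num.sqrt p * Num.sqrt tau.
Proof.
move=> p0 tau0; have M0 := rl_M law.
have [||h1 h2] := @inv_sqrt_tail R rho (height p) (4 * M / Num.sqrt p) tau (meas_height p) _ tau0 _.
- by rewrite divr_ge0 ?sqrtr_ge0// mulr_ge0// ltW.
- by move=> s s0; exact: height_band.
by split => //; rewrite (le_trans h2)// le_eqVlt; apply/orP; left; apply/eqP; ring.
Qed.

Lemma intg_inv_sqrt p : 0 < p -> intg rho (fun x => (Num.sqrt `|height p x|)^-1).
Proof.
move=> p0; have [i1 _] := height_tail p0 ltr01.
have mabs : measurable_fun setT (fun x => `|height p x|).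
  by apply: measurableT_comp => //; exact: meas_height.
have mi : measurable_fun setT (fun x => (Num.sqrt `|height p x|)^-1).
  have -> : (fun x => (Num.sqrt `|height p x|)^-1) = (fun x => `|height p x| `^ (- 2^-1)).
    by apply/funext => x; rewrite powRN powR12_sqrt.
  exact: (measurableT_comp (@measurable_powR R (- 2^-1)) mabs).
apply: (@intg_le _ _ _ (fun x => (if `|height p x| < 1 then (Num.sqrt `|height p x|)^-1 else 0) + 1)) => //.
  by apply: intgD => //; exact: intg_cst.
move=> x; rewrite ger0_norm ?invr_ge0 ?sqrtr_ge0//; case: ifP => [_|/negbT]; first by rewrite lerDl.
rewrite -leNgt add0r => h; rewrite invf_le1 ?sqrtr_gt0 ?(lt_le_trans ltr01)//.
by rewrite -sqrtr1 ler_wsqrtr.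
Qed.

Lemma intg_slice e p u : 0 < e -> intg rho (fun x => if x <= u then cap e (height p x) else 0).
Proof.
move=> e0; apply: (@intg_bnd _ _ _ e); first by apply: meas_slice; exact: meas_cap.
move=> x; case: ifP => _; last by rewrite normr0 ltW.
by have /andP[h0 h1] := cap_bounds (height p x) e0; rewrite ger0_norm.
Qed.

Lemma intg_slice_p e p u : 0 < p -> intg rho (fun x => if x <= u then dcap_t e (height p x) else 0).
Proof.
move=> p0; apply: (@intg_le _ _ _ (fun x => (Num.sqrt `|height p x|)^-1)).
- by apply: meas_slice; exact: meas_dcap_t.
- exact: intg_inv_sqrt.
move=> x; have /andP[h0 h1] := dcap_t_bounds e (height p x).
by case: ifP => _; [rewrite ger0_norm|rewrite normr0 (le_trans h0)].
Qed.

Lemma intg_slice_e e p u : intg rho (fun x => if x <= u then dcap_e e (height p x) else 0).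
Proof.
apply: (@intg_bnd _ _ _ 1); first by apply: meas_slice; exact: meas_dcap_e.
by move=> x; rewrite /dcap_e; case: ifP => _; first case: ifP => _; rewrite ?normr0 ?normr1.
Qed.

Lemma slice_expansion_ep e p u : 0 < e -> 0 < p -> forall eta, 0 < eta ->
  exists2 s, 0 < s & forall e' p', `|e' - e| + `|p' - p| < s ->
  `|slice e' p' u - slice e p u - (slice_e e p u * (e' - e) + slice_p e p u * (p' - p))|
    <= eta * (`|e' - e| + `|p' - p|).
Proof.
move=> e0 p0 eta eta0.
pose sz (v : R * R) := `|v.1 - e| + `|v.2 - p|.
(* [E_expansion] wants integrability for every perturbation; replacing a nonpositive e' by e
   achieves it and changes nothing near e. *)
pose cp (e' : R) := if 0 < e' then e' else e.
pose F (v : R * R) x := if x <= u then cap (cp v.1) (height v.2 x) else 0.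
pose F0 x := if x <= u then cap e (height p x) else 0.
pose L (v : R * R) x := (if x <= u then dcap_e e (height p x) else 0) * (v.1 - e) +
   (if x <= u then dcap_t e (height p x) else 0) * (v.2 - p).
(* The 1 dominates the variation in e and, by [sqrt_lip], the inverse root dominates the variation
   in p. *)
pose g x := 1 + (Num.sqrt `|height p x|)^-1.
have cp0 e' : 0 < cp e' by rewrite /cp; case: ifP.
have cpE (v : R * R) : sz v < e -> cp v.1 = v.1.
  rewrite /sz => h; have : `|v.1 - e| < e by have := normr_ge0 (v.2 - p); lra.
  by rewrite ltr_norml => h'; rewrite /cp ifT//; lra.
have hdiff p' x : height p' x - height p x = p' - p by rewrite /height; ring.
have g1 x : 1 <= g x by rewrite /g lerDl invr_ge0 sqrtr_ge0.
have iL v : intg rho (L v).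
  rewrite /L; apply: intgD; under eq_fun do rewrite mulrC; apply: intgZ.
    exact: intg_slice_e.
  exact: intg_slice_p.
have [||||||||s s0 hs] := @E_expansion R rho (R * R)%type sz F L F0 g e e0 _ _ _ _ _ _ _ _ eta eta0.
- by move=> v; rewrite /sz addr_ge0.
- by move=> v; exact: intg_slice.
- exact: intg_slice.
- by move=> v; exact: intg_meas (iL v).
- by apply: intgD; [exact: intg_cst|exact: intg_inv_sqrt].
- apply: aes_mp (aes_height_neq p 0) => x hx v /cpE cv; rewrite /F /F0 cv.
  have gs : 0 <= g x * sz v by rewrite mulr_ge0 ?(le_trans ler01 (g1 x))// /sz addr_ge0.
  case: ifP => _; last by rewrite subrr normr0.
  apply: (le_trans (cap_dist _ _ _ _)).
  rewrite mulrDr; apply: lerD; first by rewrite ler_peMl.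
  apply: (le_trans (sqrt_lip _ hx)); rewrite hdiff mulrC ler_wpM2r//.
  by rewrite /g lerDr.
- move=> v; apply: aesT => x; rewrite /L /sz [leRHS]mulrDr.
  have [d1 d2] : `|if x <= u then dcap_e e (height p x) else 0| <= g x /\
     `|if x <= u then dcap_t e (height p x) else 0| <= g x.
    have /andP[h0 h1] := dcap_t_bounds e (height p x).
    have g0 := le_trans ler01 (g1 x).
    case: ifP => _; last by rewrite normr0.
    split; first by rewrite /dcap_e; case: ifP => _; rewrite ?normr1 ?normr0.
    by rewrite ger0_norm// (le_trans h1)// /g lerDr.
  by rewrite (le_trans (ler_normD _ _))// !normrM lerD// ler_wpM2r.
- apply: aes_mp (aes_and (aes_height_neq p 0) (aes_height_neq p (e ^+ 2))) => x [h1 h2] eta' eta'0.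
  have [r r0 hr] := cap_expansion e0 h1 h2 eta'0.
  exists (Num.min r e); first by rewrite lt_min r0.
  move=> v; rewrite lt_min => /andP[hv /cpE cv]; rewrite /F /F0 /L cv.
  case: ifP => _; last by rewrite !mul0r addr0 !subr0 normr0 mulr_ge0 ?(ltW eta'0)// /sz addr_ge0.
  by have := hr v.1 (height v.2 x); rewrite hdiff; apply.
exists (Num.min s e); first by rewrite lt_min s0.
move=> e' p' ; rewrite lt_min => /andP[h1 h2].
have := hs (e', p') h1; rewrite /F (cpE (e', p') h2) /= /L.
rewrite E_D; last 2 first.
- by under eq_fun do rewrite mulrC; apply: intgZ; exact: intg_slice_e.
- by under eq_fun do rewrite mulrC; apply: intgZ; exact: intg_slice_p.
under [X in _ - (X + _)]eq_E do rewrite mulrC.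
under [X in _ - (_ + X)]eq_E do rewrite mulrC.
rewrite E_Z; last exact: intg_slice_e.
rewrite E_Z; last exact: intg_slice_p.
by rewrite /= [_ * \int[rho]_x _]mulrC [(p' - p) * _]mulrC.
Qed.

End Slice.

Section SliceDerivatives.
Context {R : realType}.
Variables (rho : probability (measurableTypeR R) R) (a b m M : R) (dens : R -> R).
Hypothesis law : regular_law rho a b m M dens.
Variable c : R.
Implicit Types e p u x s : R.

Local Notation hgt := (height c).
Local Notation slc := (slice rho c).
Local Notation slc_e := (slice_e rho c).
Local Notation slc_p := (slice_p rho c).
Local Notation slc_u := (slice_u a b dens c).
Local Notation ldn := (ldens a b dens).

(** Pointwise bounds on the density are recovered from the bounds on interval masses, by comparing
    with short intervals starting at u. *)
Lemma ldens_bound u : 0 <= ldn u <= M.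
Proof.
have M0 := rl_M law; rewrite /ldn; case: ifP => hu; last by rewrite lexx ltW.
suff h eta : 0 < eta -> - eta <= dens u <= M + eta.
  apply/andP; split.
    rewrite leNgt; apply/negP => d0.
    by have /andP[] := h (- dens u / 2) ltac:(lra); lra.
  rewrite leNgt; apply/negP => d0.
  by have /andP[] := h ((dens u - M) / 2) ltac:(lra); lra.
move=> eta0; have [r r0 hr] := rl_loc law hu eta0.
have := hr u (u + r / 2) ltac:(lra) ltac:(rewrite subrr normr0; lra)
  ltac:(rewrite addrAC subrr add0r gtr0_norm; lra).
rewrite addrAC subrr add0r.
have := rl_up law (c := u) (d := u + r / 2) ltac:(lra).
rewrite addrAC subrr add0r.
have : 0 <= \int[rho]_x (u < x < u + r / 2)%R%:R.
  by apply: E_ge0_ae; [exact: intg_itvoo|exact: aesT].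
set I := \int[rho]_x _ => I0 h1; rewrite ler_norml => /andP[h2 h3].
have r20 : 0 < r / 2 by rewrite divr_gt0.
apply/andP; split; rewrite -(ler_pM2r r20); lra.
Qed.

(** Outside [a, b] both the extended density and the masses of nearby intervals vanish. At a and b
    themselves [ldens] may jump. *)
Lemma ldens_local u : u != a -> u != b -> forall eta, 0 < eta ->
  exists2 r, 0 < r & forall d d', d <= d' -> `|d - u| < r -> `|d' - u| < r ->
    `|\int[rho]_x (d < x < d')%R%:R - ldn u * (d' - d)| <= eta * (d' - d).
Proof.
move=> ua ub eta eta0; rewrite /ldn; case: ifP => hu; first exact: (rl_loc law hu eta0).
have out : (u < a) || (b < u).
  have [//|au] := ltP u a; rewrite lt_neqAle eq_sym ub /= leNgt; apply/negP => ub'.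
  by move: hu; rewrite ub' lt_neqAle eq_sym ua au.
exists (Num.min `|u - a| `|u - b|); first by rewrite lt_min !normr_gt0 !subr_eq0 ua.
move=> d d' dd'; rewrite !lt_min => /andP[h1 h2] /andP[h3 h4].
rewrite mul0r subr0 (@E_eq_ae _ _ _ (fun=> 0)); last 3 first.
- exact: meas_itvoo.
- exact: measurable_cst.
- apply: aes_mp (rl_supp law) => x /andP[ax xb].
  rewrite (_ : (d < x < d') = false)//; apply/negbTE/negP => /andP[dx xd].
  have ab := rl_ab law.
  case/orP: out => hout.
    by move: h3; rewrite (ltr0_norm (_ : u - a < 0)) ?subr_lt0// ltr_norml; lra.
  by move: h2; rewrite (gtr0_norm (_ : 0 < u - b)) ?subr_gt0// ltr_norml; lra.
by rewrite E_cst normr0 mulr_ge0 ?(ltW eta0)// subr_ge0.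
Qed.

Lemma height_close p u : forall eta, 0 < eta -> exists2 s, 0 < s &
  forall p' x, `|p' - p| < s -> `|x - u| < s -> `|hgt p' x - hgt p u| <= eta.
Proof.
move=> eta eta0; pose K := 2 * `|u - c| + 2.
have K1 : 0 < K by rewrite /K; have := normr_ge0 (u - c); lra.
exists (Num.min 1 (eta / (2 * K))); first by rewrite lt_min ltr01 divr_gt0// mulr_gt0.
move=> p' x; rewrite !lt_min !ltr_pdivlMr ?mulr_gt0// => /andP[p1 p2] /andP[x1 x2].
have -> : hgt p' x - hgt p u = (p' - p) - (x - u) * ((x - u) + 2 * (u - c)).
  by rewrite /height; ring.
apply: (le_trans (ler_normB _ _)); rewrite normrM.
have h : `|x - u + 2 * (u - c)| <= K.
  apply: (le_trans (ler_normD _ _)); rewrite normrM (gtr0_norm (_ : 0 < 2))// /K; lra.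
have h2 : `|x - u| * `|x - u + 2 * (u - c)| <= `|x - u| * K by rewrite ler_wpM2l.
have h3 : `|p' - p| <= `|p' - p| * K.
  by rewrite ler_peMr// /K; have := normr_ge0 (u - c); lra.
lra.
Qed.

Lemma cap_close e p u : forall eta, 0 < eta -> exists2 s, 0 < s &
  forall e' p' x, `|e' - e| < s -> `|p' - p| < s -> `|x - u| < s ->
   `|cap e' (hgt p' x) - cap e (hgt p u)| <= eta.
Proof.
move=> eta eta0; have e20 : 0 < (eta / 2) ^+ 2 by rewrite exprn_gt0// divr_gt0.
have [s s0 hs] := height_close p u e20.
exists (Num.min s (eta / 2)); first by rewrite lt_min s0 divr_gt0.
move=> e' p' x; rewrite !lt_min => /andP[_ h1] /andP[h2 _] /andP[h3 _].
apply: (le_trans (cap_dist _ _ _ _)).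
suff : Num.sqrt `|hgt p' x - hgt p u| <= eta / 2.
  by have := sqrt_dist (hgt p' x) (hgt p u); lra.
rewrite -(@ler_sqr _ (Num.sqrt _)) ?nnegrE ?sqrtr_ge0 ?divr_ge0 ?(ltW eta0)//.
by rewrite sqr_sqrtr// hs.
Qed.

Lemma sliceB e p u1 u2 : 0 < e -> u1 <= u2 ->
  slc e p u2 - slc e p u1 = \int[rho]_x ((u1 < x < u2)%R%:R * cap e (hgt p x)).
Proof.
move=> e0 u12; rewrite /slice -E_B; [|exact: intg_slice|exact: intg_slice].
apply: E_eq_ae.
- by apply: measurable_funB; apply: meas_slice; exact: meas_cap.
- apply: measurable_funM; first exact: meas_itvoo.
  by apply: measurableT_comp; [exact: meas_cap|exact: meas_height].
apply: aes_mp (aes_and (rl_pt law u1) (rl_pt law u2)) => x [x1 x2].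
have [h1|h1] := ltP x u1.
  by rewrite (ltW h1) (le_trans (ltW h1) u12) subrr (ltNge u1) (ltW h1) mul0r.
have {}h1 : u1 < x by rewrite lt_neqAle eq_sym x1.
rewrite (leNgt x u1) h1 /= subr0 le_eqVlt (negbTE x2) /=.
by case: ifP => _; rewrite ?mul1r ?mul0r.
Qed.

(** The base value is taken at the moved (e', p'), with uniform error, so that this adds up with
    [slice_expansion_ep] to a joint expansion. *)
Lemma slice_expansion_u e p u : 0 < e -> u != a -> u != b -> forall eta, 0 < eta ->
  exists2 s, 0 < s & forall e' p' u', `|e' - e| < s -> `|p' - p| < s -> `|u' - u| < s ->
  `|slc e' p' u' - slc e' p' u - slc_u e p u * (u' - u)| <= eta * `|u' - u|.
Proof.
move=> e0 ua ub eta eta0; have M0 := rl_M law.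
(* Half of eta pays for the variation of the cap, against a mass at most M times the length; the
   other half pays for the local error of the mass, against a cap at most e. *)
have eta1 : 0 < eta / (2 * M) by rewrite divr_gt0// mulr_gt0.
have eta2 : 0 < eta / (2 * e) by rewrite divr_gt0// mulr_gt0.
have [s1 s10 hs1] := cap_close e p u eta1.
have [s2 s20 hs2] := ldens_local ua ub eta2.
exists (Num.min (Num.min s1 s2) e); first by rewrite !lt_min s10 s20.
move=> e' p' u'; rewrite !lt_min => /andP[/andP[e1 _] e3] /andP[/andP[p1 _] _] /andP[/andP[u1 u2] _].
have e'0 : 0 < e' by move: e3; rewrite ltr_norml; lra.
have key lo hi : lo <= hi -> `|lo - u| < s1 -> `|hi - u| < s1 ->
    `|lo - u| < s2 -> `|hi - u| < s2 ->
  `|slc e' p' hi - slc e' p' lo - slc_u e p u * (hi - lo)| <= eta * (hi - lo).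
  move=> lh l1 h1 l2 h2; rewrite sliceB//.
  set C := cap e (hgt p u).
  have iI : intg rho (fun x => (lo < x < hi)%R%:R) by exact: intg_itvoo.
  have iD : intg rho (fun x => (lo < x < hi)%R%:R * (cap e' (hgt p' x) - C)).
    apply: (@intg_le _ _ _ (fun x => eta / (2 * M) * (lo < x < hi)%R%:R)).
    - apply: measurable_funM; first exact: meas_itvoo.
      apply: measurable_funB => //.
      by apply: measurableT_comp; [exact: meas_cap|exact: meas_height].
    - exact: intgZ.
    move=> x; case: (boolP (lo < x < hi)) => [/andP[lx xh]|_]; last by rewrite mul0r mulr0 normr0.
    rewrite mul1r mulr1; apply: hs1 => //.
    by move: l1 h1; rewrite !ltr_norml; lra.
  have -> : \int[rho]_x ((lo < x < hi)%R%:R * cap e' (hgt p' x)) =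
      \int[rho]_x ((lo < x < hi)%R%:R * (cap e' (hgt p' x) - C)) +
      C * \int[rho]_x (lo < x < hi)%R%:R.
    rewrite -E_Z// -E_D//; last exact: intgZ.
    by apply: eq_E => x; ring.
  have I1 : \int[rho]_x (lo < x < hi)%R%:R <= M * (hi - lo) by exact: (rl_up law).
  have b1 : `|\int[rho]_x ((lo < x < hi)%R%:R * (cap e' (hgt p' x) - C))| <= eta / 2 * (hi - lo).
    apply: (le_trans (E_norm iD)).
    apply: (@le_trans _ _ (\int[rho]_x (eta / (2 * M) * (lo < x < hi)%R%:R))).
      apply: E_le; [exact: intg_norm|exact: intgZ|move=> x].
      case: (boolP (lo < x < hi)) => [/andP[lx xh]|_]; last by rewrite mul0r mulr0 normr0.
      rewrite mul1r mulr1; apply: hs1 => //.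
      by move: l1 h1; rewrite !ltr_norml; lra.
    rewrite E_Z//; apply: (le_trans (ler_wpM2l (ltW eta1) I1)).
    by rewrite le_eqVlt; apply/orP; left; apply/eqP; field; rewrite gt_eqF.
  have /andP[C0 C1] : 0 <= C <= e by exact: cap_bounds.
  have b2 : `|C * (\int[rho]_x (lo < x < hi)%R%:R - ldn u * (hi - lo))| <= eta / 2 * (hi - lo).
    rewrite normrM (ger0_norm C0).
    apply: (@le_trans _ _ (e * (eta / (2 * e) * (hi - lo)))).
      by apply: ler_pM => //; exact: hs2.
    by rewrite le_eqVlt; apply/orP; left; apply/eqP; field; rewrite gt_eqF.
  rewrite (_ : _ - slc_u e p u * _ =
     \int[rho]_x ((lo < x < hi)%R%:R * (cap e' (hgt p' x) - C)) +
     C * (\int[rho]_x (lo < x < hi)%R%:R - ldn u * (hi - lo))); last first.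
    by rewrite /slice_u -/C; ring.
  by rewrite (le_trans (ler_normD _ _))//; lra.
have uu1 : `|u - u| < s1 by rewrite subrr normr0.
have uu2 : `|u - u| < s2 by rewrite subrr normr0.
have [le|/ltW le] := leP u u'.
  have := key u u' le uu1 u1 uu2 u2.
  by rewrite [`|u' - u|]ger0_norm ?subr_ge0.
have := key u' u le u1 uu1 u2 uu2.
rewrite [`|u' - u|]ler0_norm ?subr_le0// opprB -normrN.
by congr (`|_| <= _); ring.
Qed.

Lemma slice_expansion e p u : 0 < e -> 0 < p -> u != a -> u != b -> forall eta, 0 < eta ->
  exists2 s, 0 < s & forall e' p' u', `|e' - e| < s -> `|p' - p| < s -> `|u' - u| < s ->
  `|slc e' p' u' - slc e p u -
    (slc_e e p u * (e' - e) + slc_p e p u * (p' - p) + slc_u e p u * (u' - u))|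
    <= eta * (`|e' - e| + `|p' - p| + `|u' - u|).
Proof.
move=> e0 p0 ua ub eta eta0.
have [s1 s10 h1] := slice_expansion_ep law c u e0 p0 eta0.
have [s2 s20 h2] := slice_expansion_u p e0 ua ub eta0.
exists (Num.min (s1 / 2) s2); first by rewrite lt_min divr_gt0.
move=> e' p' u'; rewrite !lt_min => /andP[e1 e2] /andP[p1 p2] /andP[_ u2].
have := h1 e' p' ltac:(lra); have := h2 e' p' u' e2 p2 u2.
set A := _ - _ - _; set B := _ - _ - _; set D := _ - _ - _ => hA hB.
have -> : D = A + B by rewrite /A /B /D; ring.
by rewrite (le_trans (ler_normD _ _))//; lra.
Qed.

Lemma le_stable x u u' : `|u' - u| < `|x - u| -> (x <= u') = (x <= u).
Proof.
have [xu|xu|->] := ltgtP x u; last by rewrite subrr normr0 ltNge normr_ge0.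
  rewrite (ltr0_norm (_ : x - u < 0)) ?subr_lt0// ltr_norml => h.
  by apply/idP/idP; lra.
rewrite (gtr0_norm (_ : 0 < x - u)) ?subr_gt0// ltr_norml => h.
by apply/idP/idP; lra.
Qed.

Lemma lt_stable x u u' : `|u' - u| < `|x - u| ->
  (x < u') = (x < u) /\ (u' < x) = (u < x).
Proof.
have [xu|xu|->] := ltgtP x u; last by rewrite subrr normr0 ltNge normr_ge0.
  rewrite (ltr0_norm (_ : x - u < 0)) ?subr_lt0// ltr_norml => h.
  by split; apply/idP/idP; lra.
rewrite (gtr0_norm (_ : 0 < x - u)) ?subr_gt0// ltr_norml => h.
by split; apply/idP/idP; lra.
Qed.

Let sz e p u (v : R * R * R) := `|v.1.1 - e| + `|v.1.2 - p| + `|v.2 - u|.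

Lemma slice_pointwise (f : R -> R -> R) e p u x : x != u ->
  (forall eta, 0 < eta -> exists2 s, 0 < s & forall e' t', `|e' - e| + `|t' - hgt p x| < s ->
     `|f e' t' - f e (hgt p x)| <= eta) ->
  forall eta, 0 < eta -> exists2 s, 0 < s & forall v, sz e p u v < s ->
   `|(if x <= v.2 then f v.1.1 (hgt v.1.2 x) else 0) -
     (if x <= u then f e (hgt p x) else 0)| <= eta.
Proof.
move=> xu hf eta eta0; have [s s0 hs] := hf eta eta0.
exists (Num.min s `|x - u|); first by rewrite lt_min s0 normr_gt0 subr_eq0.
move=> v; rewrite lt_min /sz => /andP[h1 h2].
have q1 := normr_ge0 (v.1.1 - e); have q2 := normr_ge0 (v.1.2 - p); have q3 := normr_ge0 (v.2 - u).
rewrite (@le_stable x u v.2); last lra.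
case: ifP => _; last by rewrite subrr normr0 ltW.
apply: hs; have -> : hgt v.1.2 x - hgt p x = v.1.2 - p by rewrite /height; ring.
lra.
Qed.

Lemma slice_e_cont e p u : 0 < e -> forall eta, 0 < eta ->
  exists2 s, 0 < s & forall e' p' u', `|e' - e| < s -> `|p' - p| < s -> `|u' - u| < s ->
  `|slc_e e' p' u' - slc_e e p u| <= eta.
Proof.
move=> e0 eta eta0.
have [|||||s s0 hs] := @E_continuity R rho _ (sz e p u)
   (fun v x => if x <= v.2 then dcap_e v.1.1 (hgt v.1.2 x) else 0)
   (fun x => if x <= u then dcap_e e (hgt p x) else 0) (fun=> 1) 1 ltr01 _ _ _ _ _ eta eta0.
- by move=> v; apply: meas_slice; exact: meas_dcap_e.
- by apply: meas_slice; exact: meas_dcap_e.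
- exact: intg_cst.
- apply: aesT => x v _; rewrite /dcap_e.
  by case: ifP => _; first case: ifP => _; rewrite ?normr0 ?normr1.
- apply: aes_mp (aes_and (rl_pt law u) (aes_height_neq law c p (e ^+ 2))) => x [xu xe].
  apply: slice_pointwise => // eta' eta'0; have [s s0 hs] := dcap_e_cont e0 xe.
  by exists s => // e' t' /hs ->; rewrite subrr normr0 ltW.
exists (s / 3); first by rewrite divr_gt0.
by move=> e' p' u' h1 h2 h3; apply: (hs (e', p', u')); rewrite /sz /=; lra.
Qed.

(* Truncating dcap_t at level K changes its integral by O(1/K), uniformly in the parameters. *)
Lemma slice_p_trunc e p u K : 0 < p -> 0 < K ->
  `|slc_p e p u - \int[rho]_x (if x <= u then Num.min (dcap_t e (hgt p x)) K else 0)|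
    <= 16 * M / Num.sqrt p / K.
Proof.
move=> p0 K0; have t0 : 0 < K ^- 2 by rewrite invr_gt0 exprn_gt0.
have [i1 h1] := height_tail law c p0 t0.
have i2 := intg_slice_p law c e u p0.
have mm : measurable_fun setT (fun t : R => Num.min (dcap_t e t) K).
  by apply: measurable_minr => //; exact: meas_dcap_t.
have i3 : intg rho (fun x => if x <= u then Num.min (dcap_t e (hgt p x)) K else 0).
  apply: (@intg_bnd _ _ _ K); first exact: meas_slice mm.
  move=> x; case: ifP => _; last by rewrite normr0 ltW.
  have /andP[d0 _] := dcap_t_bounds e (hgt p x).
  by rewrite ger0_norm ?le_min ?d0 ?(ltW K0)// ge_min lexx orbT.
rewrite /slice_p -E_B//; apply: (le_trans (E_norm (intgB i2 i3))).
rewrite -exprVn sqrtr_sqr gtr0_norm ?invr_gt0// in h1.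
rewrite -exprVn in i1.
apply: le_trans h1; apply: E_le; [exact: intg_norm (intgB i2 i3)|exact: i1|].
move=> x; have /andP[d0 d1] := dcap_t_bounds e (hgt p x).
have rhs0 : 0 <= if `|hgt p x| < K^-1 ^+ 2 then (Num.sqrt `|hgt p x|)^-1 else 0.
  by case: ifP => // _; exact: le_trans d1.
case: ifP => _; last by rewrite subrr normr0.
have [dK|dK] := leP (dcap_t e (hgt p x)) K; first by rewrite subrr normr0.
rewrite ger0_norm ?subr_ge0 ?(ltW dK)//.
have ps : 0 < Num.sqrt `|hgt p x|.
  rewrite lt_neqAle sqrtr_ge0 andbT; apply/eqP => e1.
  by move: d1; rewrite -e1 invr0 leNgt (lt_trans K0 dK).
rewrite ifT.
  by apply: (le_trans _ d1); rewrite gerBl ltW.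
rewrite -[ltLHS](@sqr_sqrtr _ `|hgt p x|)// ltr_sqr ?nnegrE ?(ltW ps) ?invr_ge0 ?(ltW K0)//.
by rewrite -[ltLHS]invrK ltf_pV2 ?posrE ?invr_gt0//; exact: lt_le_trans d1.
Qed.

(** The singularity of [dcap_t] moves with p', so domination is applied to the integrand truncated
    at K. The level K makes the truncation cost at most eta / 3 for every p' >= p / 2. *)
Lemma slice_p_cont e p u : 0 < e -> 0 < p -> forall eta, 0 < eta ->
  exists2 s, 0 < s & forall e' p' u', `|e' - e| < s -> `|p' - p| < s -> `|u' - u| < s ->
  `|slc_p e' p' u' - slc_p e p u| <= eta.
Proof.
move=> e0 p0 eta eta0; have M0 := rl_M law.
have p20 : 0 < p / 2 by rewrite divr_gt0.
pose B := 16 * M / Num.sqrt (p / 2); pose K := 3 * B / eta.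
have B0 : 0 < B by rewrite divr_gt0 ?sqrtr_gt0// mulr_gt0.
have K0 : 0 < K by rewrite divr_gt0// mulr_gt0.
have BK : B / K = eta / 3 by rewrite /K; field; rewrite !gt_eqF.
have eta30 : 0 < eta / 3 by rewrite divr_gt0.
have mm e' : measurable_fun setT (fun t : R => Num.min (dcap_t e' t) K).
  by apply: measurable_minr => //; exact: meas_dcap_t.
have [|||||s s0 hs] := @E_continuity R rho _ (sz e p u)
   (fun v x => if x <= v.2 then Num.min (dcap_t v.1.1 (hgt v.1.2 x)) K else 0)
   (fun x => if x <= u then Num.min (dcap_t e (hgt p x)) K else 0) (fun=> K) 1 ltr01 _ _ _ _ _ _ eta30.
- by move=> v; exact: (meas_slice _ _ _ (mm v.1.1)).
- exact: (meas_slice _ _ _ (mm e)).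
- exact: intg_cst.
- apply: aesT => x v _; case: ifP => _; last by rewrite normr0 ltW.
  have /andP[d0 _] := dcap_t_bounds v.1.1 (hgt v.1.2 x).
  by rewrite ger0_norm ?le_min ?d0 ?(ltW K0)// ge_min lexx orbT.
- apply: aes_mp (aes_and (rl_pt law u) (aes_and (aes_height_neq law c p 0)
    (aes_height_neq law c p (e ^+ 2)))) => x [xu [x0 xe]].
  apply: (@slice_pointwise (fun e t => Num.min (dcap_t e t) K)) => // eta' eta'0.
  have [s s0 hs] := dcap_t_cont e0 x0 xe eta'0.
  exists s => // e' t' /hs; apply: le_trans.
  move: (dcap_t e' t') (dcap_t e (hgt p x)) => k l.
  have := ler_norm (k - l); have := ler_norm (- (k - l)); rewrite normrN ler_norml /Num.min.
  by case: ifP => h1; case: ifP => h2; lra.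
exists (Num.min (s / 3) (p / 2)); first by rewrite lt_min divr_gt0.
move=> e' p' u'; rewrite !lt_min => /andP[h1 _] /andP[h2 h3] /andP[h4 _].
have p'2 : p / 2 <= p' by move: h3; rewrite ltr_norml; lra.
have p'0 : 0 < p' by apply: lt_le_trans p'2.
have tr q : p / 2 <= q -> 16 * M / Num.sqrt q / K <= eta / 3.
  move=> hq; rewrite -BK ler_pM2r ?invr_gt0// ler_pM2l ?mulr_gt0//.
  by rewrite lef_pV2 ?posrE ?sqrtr_gt0 ?(lt_le_trans p20 hq)// ler_wsqrtr.
have t1 := le_trans (slice_p_trunc e' u' p'0 K0) (tr _ p'2).
have t2 := le_trans (slice_p_trunc e u p0 K0) (tr p ltac:(lra)).
have t3 := hs (e', p', u') ltac:(rewrite /sz /=; lra).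
move: t1 t2 t3 => /=; rewrite !ler_norml => /andP[? ?] /andP[? ?] /andP[? ?].
by apply/andP; split; lra.
Qed.

Lemma slice_u_cont e p u : 0 < e -> u != a -> u != b -> forall eta, 0 < eta ->
  exists2 s, 0 < s & forall e' p' u', `|e' - e| < s -> `|p' - p| < s -> `|u' - u| < s ->
  `|slc_u e' p' u' - slc_u e p u| <= eta.
Proof.
move=> e0 ua ub eta eta0; have M0 := rl_M law.
have ld : forall eta, 0 < eta -> exists2 s, 0 < s & forall u', `|u' - u| < s ->
    `|ldn u' - ldn u| <= eta.
  move=> eta' eta'0.
  have n0 : 0 < Num.min `|u - a| `|u - b| by rewrite lt_min !normr_gt0 !subr_eq0 ua.
  have same u' : `|u' - u| < Num.min `|u - a| `|u - b| -> (a < u' < b) = (a < u < b).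
    rewrite lt_min => /andP[]; rewrite -(normrN (u - a)) opprB -(normrN (u - b)) opprB => h1 h2.
    by rewrite (lt_stable h1).1 (lt_stable h2).2.
  case: (boolP (a < u < b)) => hu.
    have /cvgrPdist_le /(_ _ eta'0) /nbhs_ballP [r /= r0 hr] := rl_cont law hu.
    exists (Num.min r (Num.min `|u - a| `|u - b|)); first by rewrite lt_min r0.
    move=> u'; rewrite lt_min => /andP[h1 /same h2]; rewrite /ldens h2 hu distrC.
    by apply: hr; rewrite /ball /= distrC.
  exists (Num.min `|u - a| `|u - b|) => // u' /same h; rewrite /ldens h (negbTE hu).
  by rewrite subrr normr0 ltW.
have eta1 : 0 < eta / 2 / M by rewrite !divr_gt0.
have eta2 : 0 < eta / 2 / e by rewrite !divr_gt0.
have [s1 s10 h1] := cap_close e p u eta1; have [s2 s20 h2] := ld _ eta2.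
exists (Num.min s1 s2); first by rewrite lt_min s10.
move=> e' p' u'; rewrite !lt_min => /andP[e1 _] /andP[p1 _] /andP[u1 u2].
have g1 := h1 e' p' u' e1 p1 u1; have g2 := h2 u' u2.
rewrite /slice_u (_ : _ - _ = (cap e' (hgt p' u') - cap e (hgt p u)) * ldn u' +
   cap e (hgt p u) * (ldn u' - ldn u)); last by ring.
rewrite (le_trans (ler_normD _ _))// !normrM.
have /andP[l0 lM] := ldens_bound u'.
have /andP[c0 c1] := cap_bounds (hgt p u) e0.
rewrite (ger0_norm l0) (ger0_norm c0).
have := ler_pM (normr_ge0 _) l0 g1 lM; have := ler_pM c0 (normr_ge0 _) c1 g2.
rewrite [e * (_ / _)]mulrC !divfK ?gt_eqF//; lra.
Qed.

End SliceDerivatives.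

(** * Cells as intervals *)

Section Faces.
Context {R : realType} {n : nat}.
Variable y : 'I_n.+1 -> R.
Variables (rho : probability (measurableTypeR R) R) (a b m M : R) (dens : R -> R).
Hypothesis law : regular_law rho a b m M dens.
Hypothesis y_incr : forall i j : 'I_n.+1, (i < j)%N -> y i < y j.
Implicit Types (psi phi : 'rV[R]_n.+1) (x e : R) (i j k : 'I_n.+1).

(** The point where sites i and j have equal score, affine in [psi]. *)
Definition face psi i j := (y i + y j) / 2 + (psi 0 i - psi 0 j) / (2 * (y j - y i)).

Lemma score_faceE psi i j x : y i < y j ->
  score y psi i x - score y psi j x = 2 * (y j - y i) * (face psi i j - x).
Proof. by move=> ij; rewrite /score /face; field; rewrite subr_eq0 gt_eqF. Qed.

Lemma score_face_le psi i j x : y i < y j ->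
  (score y psi j x <= score y psi i x) = (x <= face psi i j).
Proof.
move=> ij; rewrite -subr_ge0 score_faceE// pmulr_rge0 ?subr_ge0//.
by rewrite mulr_gt0// subr_gt0.
Qed.

Lemma score_face_ge psi i j x : y i < y j ->
  (score y psi i x <= score y psi j x) = (face psi i j <= x).
Proof.
move=> ij; rewrite -subr_le0 score_faceE// pmulr_rle0 ?subr_le0//.
by rewrite mulr_gt0// subr_gt0.
Qed.

(* The two extreme cells end at sentinels outside the support [a, b]. *)
Definition rend psi i := if (i < n)%N then face psi i (inord i.+1) else b + 1.
Definition lend psi i := if (0 < i)%N then face psi (inord i.-1) i else a - 1.

Lemma y_next i : (i < n)%N -> y i < y (inord i.+1).
Proof. by move=> i_n; apply: y_incr; rewrite inordK. Qed.

Lemma y_prev i : (0 < i)%N -> y (inord i.-1) < y i.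
Proof.
by move=> i0; apply: y_incr; rewrite inordK ?prednK// ltnW.
Qed.

Section Witnesses.
Variables (psi : 'rV[R]_n.+1) (X : 'I_n.+1 -> R).
Hypothesis X_in : forall k, a < X k < b.
Hypothesis X_best : forall k, strictly_best y psi k (X k).

Lemma X_lt_face i j : y i < y j -> X i < face psi i j.
Proof.
move=> ij; have ji : j != i by apply: contraTneq ij => ->; rewrite ltxx.
by rewrite ltNge -score_face_ge// -ltNge; exact: X_best.
Qed.

Lemma face_lt_X i j : y i < y j -> face psi i j < X j.
Proof.
move=> ij; have ij' : i != j by apply: contraTneq ij => ->; rewrite ltxx.
by rewrite ltNge -score_face_le// -ltNge; exact: X_best.
Qed.

Lemma rend_bounds i : X i < rend psi i /\ (rend psi i < b \/ rend psi i = b + 1).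
Proof.
rewrite /rend; case: ifP => i_n.
  split; first exact: X_lt_face (y_next i_n).
  left; apply: (lt_trans (face_lt_X (y_next i_n))).
  by have /andP[] := X_in (inord i.+1).
by split; [have /andP[_ h] := X_in i; lra|right].
Qed.

Lemma lend_bounds i : lend psi i < X i /\ (a < lend psi i \/ lend psi i = a - 1).
Proof.
rewrite /lend; case: ifP => i0.
  split; first exact: face_lt_X (y_prev i0).
  left; apply: lt_trans (X_lt_face (y_prev i0)).
  by have /andP[] := X_in (inord i.-1).
by split; [have /andP[h _] := X_in i; lra|right].
Qed.

(** At a and b the density may jump and a slice need not be differentiable in its end. A face lies
    strictly between witnesses of two adjacent cells, hence inside the support; a sentinel lies
    outside. *)
Lemma rend_neq i : rend psi i != a /\ rend psi i != b.
Proof.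
have ab := rl_ab law; have /andP[ax xb] := X_in i.
by have [h1 [h2|h2]] := rend_bounds i; split; rewrite neq_lt; apply/orP; lra.
Qed.

Lemma lend_neq i : lend psi i != a /\ lend psi i != b.
Proof.
have ab := rl_ab law; have /andP[ax xb] := X_in i.
by have [h1 [h2|h2]] := lend_bounds i; split; rewrite neq_lt; apply/orP; lra.
Qed.

(* The neighbouring faces decide: for j beyond i + 1 the difference score_(i+1) - score_j decreases
   in x and is positive at X_(i+1), which lies beyond the face between i and i + 1. *)
Lemma cellE i x : a < x < b ->
  (best y psi x <= score y psi i x) = (lend psi i <= x <= rend psi i).
Proof.
move=> /andP[ax xb]; apply/idP/idP => [h|/andP[hl hr]].
  have hj j : score y psi j x <= score y psi i x by exact: le_trans (score_le_best _ _ _ _) h.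
  rewrite /lend /rend; apply/andP; split; case: ifP => hi.
  - by rewrite -score_face_ge ?y_prev.
  - lra.
  - by rewrite -score_face_le ?y_next.
  - lra.
apply: vmax_le => j; have [ij|ji|/val_inj ->] := ltngtP i j; last by [].
  have i_n : (i < n)%N by rewrite (leq_trans ij)// -ltnS.
  move: hr; rewrite /rend i_n; set k := inord i.+1 => hr.
  have hk : score y psi k x <= score y psi i x by rewrite score_face_le// y_next.
  have [->//|jk] := eqVneq j k.
  have kj : y k < y j.
    apply: y_incr; rewrite ltn_neqAle inordK// ij andbT; apply: contra_neq jk => e.
    by apply: val_inj; rewrite /= inordK.
  apply: le_trans hk; rewrite score_face_le//.
  apply: (le_trans hr); apply: ltW; apply: (lt_trans (face_lt_X (y_next i_n))); exact: X_lt_face.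
have i0 : (0 < i)%N by rewrite (leq_ltn_trans _ ji).
move: hl; rewrite /lend i0; set k := inord i.-1 => hl.
have kv : k = i.-1 :> nat by rewrite inordK// (leq_ltn_trans (leq_pred _)).
have hk : score y psi k x <= score y psi i x by rewrite score_face_ge// y_prev.
have [->//|jk] := eqVneq j k.
have kj : y j < y k.
  apply: y_incr; rewrite ltn_neqAle kv -ltnS prednK// ji andbT -kv.
  by apply: contra_neq jk => e; exact: val_inj.
apply: le_trans hk; rewrite score_face_ge//.
apply: (le_trans _ hl); apply: ltW; apply: (lt_trans (face_lt_X kj)); exact: X_lt_face (y_prev i0).
Qed.

Lemma mass_slices e i : 0 < e -> mass y rho (sig e) psi i =
  e^-1 * (slice rho (y i) e (psi 0 i) (rend psi i) - slice rho (y i) e (psi 0 i) (lend psi i)).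
Proof.
move=> e0; have lr : lend psi i <= rend psi i.
  by have [h1 _] := rend_bounds i; have [h2 _] := lend_bounds i; exact: ltW (lt_trans h2 h1).
have mI : measurable_fun setT (fun x => (lend psi i < x < rend psi i)%R%:R * cap e (height (y i) (psi 0 i) x)).
  apply: measurable_funM; first exact: meas_itvoo.
  by apply: measurableT_comp; [exact: meas_cap|exact: meas_height].
rewrite (sliceB law)// -E_Z; last first.
  apply: (@intg_bnd _ _ _ e) => // x; have /andP[c0 c1] := cap_bounds (height (y i) (psi 0 i) x) e0.
  case: (_ < x < _); first by rewrite mul1r ger0_norm.
  by rewrite mul0r normr0 ltW.
apply: E_eq_ae.
- by apply: meas_cellf; exact: meas_sig.
- by apply: measurable_funM.
apply: aes_mp (aes_and (rl_supp law) (aes_and (rl_pt law (lend psi i)) (rl_pt law (rend psi i)))).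
move=> x [xab [xl xr]]; rewrite /cellf cellE// !le_eqVlt eq_sym (negbTE xl) (negbTE xr) /=.
case: ifP => _; last by rewrite mul0r mulr0.
by rewrite mul1r sig_cap.
Qed.

End Witnesses.

Definition dface (d : 'rV[R]_n.+1) i j := (d 0 i - d 0 j) / (2 * (y j - y i)).
Definition drend d i := if (i < n)%N then dface d i (inord i.+1) else 0.
Definition dlend d i := if (0 < i)%N then dface d (inord i.-1) i else 0.

Lemma rendB psi phi i : rend phi i - rend psi i = drend (phi - psi) i.
Proof.
rewrite /rend /drend; case: ifP => _; last by rewrite subrr.
by rewrite /face /dface !mxE; ring.
Qed.

Lemma lendB psi phi i : lend phi i - lend psi i = dlend (phi - psi) i.
Proof.
rewrite /lend /dlend; case: ifP => _; last by rewrite subrr.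
by rewrite /face /dface !mxE; ring.
Qed.

Lemma dends_bound : exists2 K : R, 1 <= K & forall d i, `|drend d i| <= K * `|d| /\ `|dlend d i| <= K * `|d|.
Proof.
pose r i := `|(2 * (y (inord i.+1) - y i))^-1|; pose l i := `|(2 * (y i - y (inord i.-1)))^-1|.
exists (1 + 2 * (vmax r + vmax l)).
  by have := vmax_ge r ord0; have := vmax_ge l ord0; rewrite /r /l lerDl => h1 h2;
     rewrite mulr_ge0// addr_ge0// (le_trans _ h1, le_trans _ h2).
move=> d i.
have hr := vmax_ge r i; have hl := vmax_ge l i.
have r0 : 0 <= r i by exact: normr_ge0.
have l0 : 0 <= l i by exact: normr_ge0.
have K0 : 0 <= (1 + 2 * (vmax r + vmax l)) * `|d| by rewrite mulr_ge0//; lra.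
have db j k : `|d 0 j - d 0 k| <= 2 * `|d|.
  by rewrite (le_trans (ler_normB _ _))//; have := coord_le_norm d j; have := coord_le_norm d k; lra.
have fin j k (q : R) : 0 <= q -> 2 * q <= 1 + 2 * (vmax r + vmax l) ->
   `|d 0 j - d 0 k| * q <= (1 + 2 * (vmax r + vmax l)) * `|d|.
  move=> q0 hq; apply: (le_trans (ler_wpM2r q0 (db j k))).
  by rewrite mulrAC ler_wpM2r.
split.
  rewrite /drend; case: ifP => _; last by rewrite normr0.
  by rewrite /dface normrM; apply: fin => //; rewrite /r in hr *; lra.
rewrite /dlend; case: ifP => _; last by rewrite normr0.
by rewrite /dface normrM; apply: fin => //; rewrite /l in hl *; lra.
Qed.

End Faces.

Section InverseFactor.
Context {R : realType}.
Implicit Types e : R.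

Lemma inv_close e e' : 0 < e -> `|e' - e| <= e / 2 ->
  [/\ 0 < e', e'^-1 <= 2 / e & `|e'^-1 - e^-1| <= 2 / e ^+ 2 * `|e' - e|].
Proof.
move=> e0 h; have e'2 : e / 2 <= e' by move: h; rewrite ler_norml; lra.
have e'0 : 0 < e' by apply: lt_le_trans e'2; rewrite divr_gt0.
have h1 : e'^-1 <= 2 / e.
  by rewrite -[leRHS]invrK lef_pV2 ?posrE ?invr_gt0 ?divr_gt0// invf_div.
split => //; rewrite (_ : e'^-1 - e^-1 = - (e'^-1 * e^-1 * (e' - e))); last first.
  by field; rewrite !gt_eqF.
rewrite normrN normrM ler_wpM2r// ger0_norm ?mulr_ge0 ?invr_ge0 ?(ltW e0) ?(ltW e'0)//.
apply: (@le_trans _ _ (2 / e * e^-1)); first by rewrite ler_wpM2r ?invr_ge0 ?(ltW e0).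
by rewrite le_eqVlt; apply/orP; left; apply/eqP; field; rewrite gt_eqF.
Qed.

(** Quotient rule for H / e with explicit remainder: the error of dH, plus a product of two
    first-order terms. *)
Lemma inv_factor_expansion e e' H H' dH : 0 < e -> `|e' - e| <= e / 2 ->
  `|e'^-1 * H' - e^-1 * H - e^-1 * (dH - e^-1 * H * (e' - e))| <=
  2 / e * `|H' - H - dH| + 2 / e ^+ 2 * `|e' - e| * (`|dH| + `|e^-1 * H * (e' - e)|).
Proof.
move=> e0 h; have [e'0 h1 h2] := inv_close e0 h.
have -> : e'^-1 * H' - e^-1 * H - e^-1 * (dH - e^-1 * H * (e' - e)) =
   e'^-1 * (H' - H - dH) + (e'^-1 - e^-1) * (dH - e^-1 * H * (e' - e)).
  by field; rewrite !gt_eqF.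
rewrite (le_trans (ler_normD _ _))//; apply: lerD; rewrite normrM.
  by rewrite ler_wpM2r// ger0_norm// invr_ge0 ltW.
by apply: ler_pM => //; exact: ler_normB.
Qed.

End InverseFactor.

(** * Joint differentiability of the masses in eps and psi *)

Section MassDerivative.
Context {R : realType} {n : nat}.
Variable y : 'I_n.+1 -> R.
Variables (rho : probability (measurableTypeR R) R) (a b m M : R) (dens : R -> R).
Hypothesis law : regular_law rho a b m M dens.
Hypothesis y_incr : forall i j : 'I_n.+1, (i < j)%N -> y i < y j.
Implicit Types (psi phi d : 'rV[R]_n.+1) (x e : R) (i j k : 'I_n.+1).

Local Notation rend := (rend y b).
Local Notation lend := (lend y a).
Local Notation drend := (drend y).
Local Notation dlend := (dlend y).

Definition ecoef e psi i :=
  slice_e rho (y i) e (psi 0 i) (rend psi i) - slice_e rho (y i) e (psi 0 i) (lend psi i).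
Definition pcoef e psi i :=
  slice_p rho (y i) e (psi 0 i) (rend psi i) - slice_p rho (y i) e (psi 0 i) (lend psi i).
Definition rcoef e psi i := slice_u a b dens (y i) e (psi 0 i) (rend psi i).
Definition lcoef e psi i := slice_u a b dens (y i) e (psi 0 i) (lend psi i).

(** The mass is 1 / e times a difference of slices, so differentiating the factor 1 / e contributes
    minus the mass divided by e. *)
Definition mass_e e psi i := e^-1 * (ecoef e psi i - mass y rho (sig e) psi i).
Definition mass_psi e psi d i :=
  e^-1 * (pcoef e psi i * d 0 i + rcoef e psi i * drend d i - lcoef e psi i * dlend d i).

(** Positive coordinates make the inverse root of the height integrable; a point inside every cell
    keeps the faces in order and away from a and b. *)
Definition regular_at psi := (forall i, 0 < psi 0 i) /\
  exists X, (forall k, a < X k < b) /\ forall k, strictly_best y psi k (X k).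

Lemma min_of_scales (P : 'I_n.+1 -> R -> Prop) :
  (forall i s s', P i s -> 0 < s' -> s' <= s -> P i s') ->
  (forall i, exists2 s : R, 0 < s & P i s) -> exists2 s, 0 < s & forall i, P i s.
Proof.
move=> mono h; pose s i := projT1 (cid2 (h i)).
have s0 i : 0 < s i by rewrite /s; case: cid2.
have sP i : P i (s i) by rewrite /s; case: cid2.
have [r r0 hr] := pos_lower s0; exists r => // i; exact: mono (sP i) r0 (hr i).
Qed.

Lemma mass_expansion e psi : 0 < e -> regular_at psi -> forall eta, 0 < eta ->
  exists2 s, 0 < s & forall i e' phi, `|e' - e| < s -> `|phi - psi| < s ->
    `|mass y rho (sig e') phi i - mass y rho (sig e) psi i -
      (mass_e e psi i * (e' - e) + mass_psi e psi (phi - psi) i)|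
    <= eta * (`|e' - e| + `|phi - psi|).
Proof.
move=> e0 [psi0 [X [Xab Xb]]] eta eta0.
apply: (min_of_scales (P := fun i s => forall e' phi, `|e' - e| < s -> `|phi - psi| < s ->
    `|mass y rho (sig e') phi i - mass y rho (sig e) psi i -
      (mass_e e psi i * (e' - e) + mass_psi e psi (phi - psi) i)|
    <= eta * (`|e' - e| + `|phi - psi|))).
  move=> i s s' h s'0 ss' e' phi h1 h2; apply: h; [exact: lt_le_trans h1 ss'|exact: lt_le_trans h2 ss'].
move=> i.
have [r r0 hr] := strictly_best_stable Xb.
have [K K1 hK] := dends_bound y.
have K0 : 0 < K by lra.
(* Two slice errors, each multiplied by 2 / e and 1 + K, must add up to eta / 2. *)
pose eta1 := eta * e / (8 * (1 + K)).
have eta10 : 0 < eta1 by rewrite divr_gt0 ?mulr_gt0//; lra.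
have [Ra Rb] := rend_neq law y_incr Xab Xb i.
have [La Lb] := lend_neq law y_incr Xab Xb i.
have [s1 s10 h1] := slice_expansion law (y i) e0 (psi0 i) Ra Rb eta10.
have [s2 s20 h2] := slice_expansion law (y i) e0 (psi0 i) La Lb eta10.
pose H e psi := slice rho (y i) e (psi 0 i) (rend psi i) - slice rho (y i) e (psi 0 i) (lend psi i).
pose B := `|ecoef e psi i| + `|pcoef e psi i| + K * (`|rcoef e psi i| + `|lcoef e psi i|).
(* Controls the second-order term of [inv_factor_expansion]; the last entry of s makes C |e' - e| at
   most eta / 2. *)
pose C := 2 / e ^+ 2 * (B + `|e^-1 * H e psi|).
have B0 : 0 <= B by rewrite !addr_ge0// mulr_ge0 ?addr_ge0// ltW.
have C0 : 0 <= C by apply: mulr_ge0; [rewrite divr_ge0// sqr_ge0|rewrite addr_ge0].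
pose s := Num.min (Num.min (s1 / K) (s2 / K)) (Num.min (Num.min r (e / 2)) (eta / 2 / (C + 1) / 2)).
exists s.
  have C1 : 0 < C + 1 by lra.
  by rewrite /s !lt_min r0 !divr_gt0.
move=> e' phi; rewrite /s !lt_min => /andP[/andP[e1 e2] /andP[/andP[_ e4] e5]].
move=> /andP[/andP[p1 p2] /andP[/andP[p3 _] p5]].
rewrite !ltr_pdivlMr// in e1 e2 p1 p2.
have Kle u : 0 <= u -> u <= u * K by move=> u0; rewrite ler_peMr.
set de := e' - e in e1 e2 e4 e5 *; set d := phi - psi in p1 p2 p3 p5 *.
have de0 := normr_ge0 de; have d0 := normr_ge0 d.
have [hdr hdl] := hK d i.
have ci := coord_le_norm d i.
have phiB : phi 0 i - psi 0 i = d 0 i by rewrite !mxE.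
have rB : rend phi i - rend psi i = drend d i by exact: rendB.
have lB : lend phi i - lend psi i = dlend d i by exact: lendB.
have dK := Kle _ d0; have deK := Kle _ de0.
(* The same witnesses serve [phi], so its masses are differences of slices at the perturbed ends. *)
have Xb' : forall k, strictly_best y phi k (X k) by apply: hr; exact: ltW.
have e'e : `|e' - e| <= e / 2 by exact: ltW.
have [e'0 _ _] := inv_close e0 e'e.
rewrite (mass_slices law y_incr Xab Xb' i e'0) (mass_slices law y_incr Xab Xb i e0).
rewrite -!/(H _ _).
pose dH := ecoef e psi i * de + (pcoef e psi i * d 0 i + rcoef e psi i * drend d i - lcoef e psi i * dlend d i).
rewrite (_ : mass_e e psi i * de + mass_psi e psi d i = e^-1 * (dH - e^-1 * H e psi * de)); last first.
  by rewrite /mass_e /mass_psi /dH (mass_slices law y_incr Xab Xb i e0) -/(H e psi); ring.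
apply: (le_trans (inv_factor_expansion _ _ _ e0 e'e)); rewrite -/de.
have sK : `|de| + `|d| + K * `|d| <= (1 + K) * (`|de| + `|d|).
  by rewrite mulrDl mul1r mulrDr lerD2l ler_wpDl// mulr_ge0// ltW.
have A1 : `|H e' phi - H e psi - dH| <= 2 * eta1 * ((1 + K) * (`|de| + `|d|)).
  have Kp1 : K * `|d| < s1 by rewrite mulrC.
  have Kp2 : K * `|d| < s2 by rewrite mulrC.
  have := h1 e' (phi 0 i) (rend phi i); rewrite phiB rB -/de => /(_ (le_lt_trans deK e1) (le_lt_trans ci (le_lt_trans dK p1)) (le_lt_trans hdr Kp1)).
  have := h2 e' (phi 0 i) (lend phi i); rewrite phiB lB -/de => /(_ (le_lt_trans deK e2) (le_lt_trans ci (le_lt_trans dK p2)) (le_lt_trans hdl Kp2)).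
  set u := _ - _ - _; set v := _ - _ - _ => hu hv.
  have -> : H e' phi - H e psi - dH = v - u.
    by rewrite /H /dH /u /v /ecoef /pcoef /rcoef /lcoef; ring.
  apply: (le_trans (ler_normB _ _)).
  have bnd z : z <= K * `|d| -> eta1 * (`|de| + `|d 0 i| + z) <= eta1 * ((1 + K) * (`|de| + `|d|)).
    by move=> hz; rewrite ler_pM2l//; apply: le_trans sK; rewrite !lerD.
  by rewrite -mulrA mulr_natl mulr2n; apply: lerD; [exact: le_trans hv (bnd _ hdr)|exact: le_trans hu (bnd _ hdl)].
have A2 : `|dH| <= B * (`|de| + `|d|).
  rewrite /dH; apply: (le_trans (ler_normD _ _)); rewrite normrM.
  have t1 : `|ecoef e psi i| * `|de| <= `|ecoef e psi i| * (`|de| + `|d|) by rewrite ler_wpM2l// lerDl.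
  have t2 : `|pcoef e psi i * d 0 i| <= `|pcoef e psi i| * (`|de| + `|d|).
    by rewrite normrM ler_wpM2l// ler_wpDl.
  have Kd : K * `|d| <= K * (`|de| + `|d|) by rewrite ler_pM2l// lerDr.
  have t3 : `|rcoef e psi i * drend d i| <= `|rcoef e psi i| * (K * (`|de| + `|d|)).
    by rewrite normrM ler_wpM2l// (le_trans hdr).
  have t4 : `|lcoef e psi i * dlend d i| <= `|lcoef e psi i| * (K * (`|de| + `|d|)).
    by rewrite normrM ler_wpM2l// (le_trans hdl).
  rewrite (_ : B * _ = `|ecoef e psi i| * (`|de| + `|d|) + (`|pcoef e psi i| * (`|de| + `|d|) +
     `|rcoef e psi i| * (K * (`|de| + `|d|)) + `|lcoef e psi i| * (K * (`|de| + `|d|)))); last by rewrite /B; ring.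
  apply: lerD => //; apply: (le_trans (ler_normB _ _)); apply: lerD => //.
  by apply: (le_trans (ler_normD _ _)); exact: lerD.
have A3 : `|e^-1 * H e psi * de| <= `|e^-1 * H e psi| * (`|de| + `|d|).
  by rewrite normrM ler_wpM2l// lerDl.
have T1 : 2 / e * `|H e' phi - H e psi - dH| <= eta / 2 * (`|de| + `|d|).
  apply: (le_trans (ler_wpM2l (_ : 0 <= 2 / e) A1)); first by rewrite divr_ge0// ltW.
  rewrite le_eqVlt; apply/orP; left; apply/eqP; rewrite /eta1; field.
  by rewrite !gt_eqF// ltr_wpDl.
have T2 : 2 / e ^+ 2 * `|de| * (`|dH| + `|e^-1 * H e psi * de|) <= C * `|de| * (`|de| + `|d|).
  have -> : C * `|de| * (`|de| + `|d|) =
      2 / e ^+ 2 * `|de| * ((B + `|e^-1 * H e psi|) * (`|de| + `|d|)) by rewrite /C; ring.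
  apply: ler_wpM2l; last by rewrite mulrDl; exact: lerD.
  by apply: mulr_ge0 => //; rewrite divr_ge0// sqr_ge0.
have T3 : C * `|de| <= eta / 2.
  have C1 : 0 < C + 1 by rewrite ltr_wpDl.
  have dC : `|de| * (C + 1) <= eta / 2 / 2.
    by move: (ltW e5); rewrite mulrAC ler_pdivlMr.
  rewrite mulrC; apply: (le_trans (ler_wpM2l de0 (_ : C <= C + 1))); first by rewrite lerDl.
  by apply: (le_trans dC); rewrite ler_piMr// ?invf_le1// ?ler1n// divr_ge0// ltW.
apply: (le_trans (lerD T1 (le_trans T2 (ler_wpM2r (addr_ge0 de0 d0) T3)))).
by rewrite -mulrDl -splitr.
Qed.

End MassDerivative.

(** * The curve of maximizers *)

Section ImplicitCurve.
Context {R : realType} {n : nat}.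
Implicit Types (A : 'M[R]_n.+1) (v B : 'rV[R]_n.+1) (e : R).

Lemma mulmx_bound A : exists2 K : R, 0 < K & forall v, `|v *m A| <= K * `|v|.
Proof.
exists (1 + \sum_(j < n.+1) \sum_(k < n.+1) `|A k j|).
  by rewrite ltr_pwDl// sumr_ge0// => j _; rewrite sumr_ge0.
move=> v; apply: norm_le_coord => [|j].
  by rewrite mulr_ge0// addr_ge0// sumr_ge0// => j _; rewrite sumr_ge0.
rewrite mxE (le_trans (ler_norm_sum _ _ _))//.
apply: (@le_trans _ _ (\sum_(k < n.+1) `|A k j| * `|v|)).
  by apply: ler_sum => k _; rewrite normrM mulrC ler_wpM2l// coord_le_norm.
rewrite -mulr_suml ler_wpM2r// ler_wpDl// [leRHS](bigD1 j)//= lerDl.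
by rewrite sumr_ge0// => i _; rewrite sumr_ge0.
Qed.

Lemma unitmx_lower A : A \in unitmx -> exists2 K : R, 0 < K & forall v, `|v| <= K * `|v *m A|.
Proof.
move=> uA; have [K K0 hK] := mulmx_bound (invmx A); exists K => // v.
by rewrite -{1}(mulmxK uA v).
Qed.

Lemma unitmx_ker0 A : (forall v, v *m A = 0 -> v = 0) -> A \in unitmx.
Proof.
move=> h; rewrite -row_free_unit -kermx_eq0; apply/rowV0P => v /sub_kermxP; exact: h.
Qed.

(** The curve is given and continuous, so only its linearization remains. The term eta |d| is first
    absorbed through the inverse of A, giving |d| = O(|e' - e|); fed back, this turns the remainder
    into o(|e' - e|). *)
Lemma implicit_derivative (G : R -> 'rV[R]_n.+1 -> 'rV[R]_n.+1) (psi : R -> 'rV[R]_n.+1) e A B :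
  A \in unitmx ->
  (forall eta, 0 < eta -> exists2 s, 0 < s & forall e' phi, `|e' - e| < s -> `|phi - psi e| < s ->
    `|G e' phi - G e (psi e) - ((e' - e) *: B + (phi - psi e) *m A)| <=
    eta * (`|e' - e| + `|phi - psi e|)) ->
  (forall eta, 0 < eta -> exists2 s, 0 < s & forall e', `|e' - e| < s -> `|psi e' - psi e| < eta) ->
  (exists2 s, 0 < s & forall e', `|e' - e| < s -> G e' (psi e') = G e (psi e)) ->
  forall eta, 0 < eta -> exists2 s, 0 < s & forall e', `|e' - e| < s ->
    `|psi e' - psi e - (e' - e) *: (- (B *m invmx A))| <= eta * `|e' - e|.
Proof.
move=> uA hG hpsi [s0 s00 hs0] eta eta0.
have [K K0 hK] := unitmx_lower uA.
pose L := 1 + 2 * K * (`|B| + 1).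
have L0 : 0 < L by rewrite ltr_pwDl// !mulr_ge0 ?addr_ge0// ltW.
(* The entry 1 / (2 K) serves the absorption and eta / (K L) the final bound, L being the constant
   in |e' - e| + |d| <= L |e' - e|. *)
pose eta1 := Num.min (Num.min 1 (2 * K)^-1) (eta / (K * L)).
have eta10 : 0 < eta1 by rewrite /eta1 !lt_min ltr01 invr_gt0 divr_gt0// !mulr_gt0.
have [eta11 [etaK etaL]] : eta1 <= 1 /\ K * eta1 <= 2^-1 /\ K * eta1 * L <= eta.
  have K20 : 0 < 2 * K by rewrite mulr_gt0.
  split; first by rewrite /eta1 !ge_min lexx.
  split.
    have : eta1 <= (2 * K)^-1 by rewrite /eta1 !ge_min lexx orbT.
    by rewrite invfM -ler_pdivlMl// mulrC.
  have : eta1 <= eta / (K * L) by rewrite /eta1 !ge_min lexx !orbT.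
  by rewrite ler_pdivlMr ?mulr_gt0// mulrA (mulrC eta1).
have [s1 s10 hs1] := hG _ eta10.
have [s2 s20 hs2] := hpsi _ s10.
exists (Num.min s0 (Num.min s1 s2)); first by rewrite !lt_min s00 s10.
move=> e'; rewrite !lt_min => /and3P[e0 e1 e2].
have := hs1 e' (psi e') e1 (hs2 _ e2).
rewrite hs0// subrr sub0r normrN.
set d := psi e' - psi e => hd.
have Bd : `|(e' - e) *: B| = `|e' - e| * `|B| by rewrite normrZ.
have hdA : `|d *m A| <= `|(e' - e) *: B + d *m A| + `|e' - e| * `|B|.
  by rewrite -Bd; have := ler_normB ((e' - e) *: B + d *m A) ((e' - e) *: B); rewrite addrAC subrr add0r.
have d1 : `|d| <= K * `|d *m A| := hK d.
have lin : `|d| <= 2 * K * (`|B| + 1) * `|e' - e|.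
  have t1 := le_trans hdA (lerD hd (lexx _)).
  have t2 := le_trans d1 (ler_wpM2l (ltW K0) t1).
  have t3 : K * eta1 * `|d| <= 2^-1 * `|d| by rewrite ler_wpM2r.
  have t4 : K * eta1 * `|e' - e| <= K * `|e' - e|.
    by rewrite -mulrA ler_pM2l// ler_piMl.
  move: t2 t3 t4; clear; move: (`|d|) (`|e' - e|) (`|B|) => /= D E N; lra.
have -> : d - (e' - e) *: (- (B *m invmx A)) = ((e' - e) *: B + d *m A) *m invmx A.
  by rewrite mulmxDl mulmxK// -scalemxAl scalerN opprK addrC.
apply: (le_trans (hK _)); rewrite mulmxKV//.
apply: (le_trans (ler_wpM2l (ltW K0) hd)).
have -> : K * (eta1 * (`|e' - e| + `|d|)) = K * eta1 * (`|e' - e| + `|d|) by ring.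
apply: (@le_trans _ _ (K * eta1 * (L * `|e' - e|))); last by rewrite mulrA ler_wpM2r.
by apply: ler_wpM2l; [rewrite mulr_ge0 ?ltW|rewrite mulrDl mul1r lerD2l].
Qed.

(** Only the inverse of A(e) is estimated: w(e') A(e') = - B(e') is compared with the equation at e
    through A(e), and the term in w(e') - w(e) is absorbed. *)
Lemma implicit_derivative_continuous (A : R -> 'M[R]_n.+1) (B : R -> 'rV[R]_n.+1) e :
  (exists2 s, 0 < s & forall e', `|e' - e| < s -> A e' \in unitmx) ->
  (forall eta, 0 < eta -> exists2 s, 0 < s & forall e', `|e' - e| < s ->
     (forall v, `|v *m A e' - v *m A e| <= eta * `|v|) /\ `|B e' - B e| <= eta) ->
  forall eta, 0 < eta -> exists2 s, 0 < s & forall e', `|e' - e| < s ->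
    `|- (B e' *m invmx (A e')) - - (B e *m invmx (A e))| <= eta.
Proof.
move=> [s0 s00 hs0] hAB eta eta0.
have uA : A e \in unitmx by apply: hs0; rewrite subrr normr0.
have [K K0 hK] := unitmx_lower uA.
pose w e := - (B e *m invmx (A e)).
have wA e' : A e' \in unitmx -> w e' *m A e' = - B e' by move=> u; rewrite mulNmx mulmxKV.
have W0 : 0 < 1 + `|w e| by rewrite ltr_pwDl.
pose eta1 := Num.min (2 * K)^-1 (eta / (2 * K * (1 + `|w e|))).
have K20 : 0 < 2 * K by rewrite mulr_gt0.
have eta10 : 0 < eta1 by rewrite /eta1 !lt_min invr_gt0 K20 divr_gt0// mulr_gt0.
have [s1 s10 hs1] := hAB _ eta10.
exists (Num.min s0 s1); first by rewrite lt_min s00.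
move=> e'; rewrite lt_min => /andP[e0 e1]; rewrite -!/(w _).
have [hA hB] := hs1 _ e1.
have eqA : (w e' - w e) *m A e = - (B e' - B e) - (w e' *m A e' - w e' *m A e).
  rewrite mulmxBl (wA _ uA) (wA _ (hs0 _ e0)); move: (w e' *m A e) => X.
  by apply/rowP => i; rewrite !mxE; ring.
have h1 : `|w e' - w e| <= K * (eta1 + eta1 * `|w e'|).
  apply: (le_trans (hK _)); rewrite ler_pM2l// eqA (le_trans (ler_normB _ _))// normrN.
  by apply: lerD.
have {}h1 : `|w e' - w e| <= K * eta1 + K * eta1 * `|w e'| by rewrite -mulrA -mulrDr.
have h2 : `|w e'| <= `|w e' - w e| + `|w e|.
  by have := ler_normD (w e' - w e) (w e); rewrite subrK.
have k1 : K * eta1 <= 2^-1.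
  have : eta1 <= (2 * K)^-1 by rewrite /eta1 !ge_min lexx.
  by rewrite invfM -ler_pdivlMl// mulrC.
have k2 : 2 * (K * eta1) * (1 + `|w e|) <= eta.
  have : eta1 <= eta / (2 * K * (1 + `|w e|)) by rewrite /eta1 !ge_min lexx !orbT.
  rewrite ler_pdivlMr ?mulr_gt0//.
  by have -> : eta1 * (2 * K * (1 + `|w e|)) = 2 * (K * eta1) * (1 + `|w e|) by ring.
have k3 : K * eta1 * `|w e'| <= K * eta1 * (`|w e' - w e| + `|w e|).
  by rewrite ler_wpM2l// mulr_ge0 ?ltW.
have k4 : K * eta1 * `|w e' - w e| <= 2^-1 * `|w e' - w e| by rewrite ler_wpM2r.
move: h1 k2 k3 k4; clear; move: (`|w e' - w e|) (`|w e|) (`|w e'|) (K * eta1) => /= a b c d.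
lra.
Qed.

End ImplicitCurve.

Section NormNeighbourhoods.
Context {R : realType}.

Lemma near_norm (U : normedModType R) (u : U) (P : U -> Prop) :
  (\forall v \near u, P v) <-> exists2 s : R, 0 < s & forall v, `|v - u| < s -> P v.
Proof.
split.
  move=> /nbhs_ballP[s /= s0 hs]; exists s => // v vu; apply: hs.
  by rewrite -ball_normE /= distrC.
move=> [s s0 hs]; apply/nbhs_ballP; exists s => // v; rewrite -ball_normE /= distrC.
exact: hs.
Qed.

Lemma cvg_le_dist (U V : normedModType R) (f : U -> V) u l :
  f @ u --> l <-> forall eta : R, 0 < eta ->
    exists2 s : R, 0 < s & forall v, `|v - u| < s -> `|f v - l| <= eta.
Proof.
split=> [/cvgrPdist_le h eta /h/near_norm[s s0 hs]|h].
  by exists s => // v /hs; rewrite distrC.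
apply/cvgrPdist_le => eta /h[s s0 hs]; apply/near_norm; exists s => // v /hs.
by rewrite distrC.
Qed.

End NormNeighbourhoods.

Section RowForms.
Context {R : realType} {n : nat}.

Lemma row_form (f : 'rV[R]_n.+1 -> R) : (forall (c : R) u v, f (c *: u + v) = c * f u + f v) ->
  forall d, f d = \sum_(j < n.+1) d 0 j * f (delta_mx 0 j).
Proof.
move=> fL d; have f0 : f 0 = 0.
  have := fL 1 0 0; rewrite scale1r addr0 mul1r => /eqP.
  by rewrite -subr_eq subrr eq_sym => /eqP.
rewrite {1}[d]row_sum_delta; elim/big_rec2: _ => // j _ u _ <-; exact: fL.
Qed.

End RowForms.

(** * Matrix form of the mass derivative *)

Section MassField.
Context {R : realType} {n : nat}.
Variable y : 'I_n.+1 -> R.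
Variables (rho : probability (measurableTypeR R) R) (a b m M : R) (dens : R -> R).
Hypothesis law : regular_law rho a b m M dens.
Hypothesis y_incr : forall i j : 'I_n.+1, (i < j)%N -> y i < y j.
Implicit Types (psi phi d : 'rV[R]_n.+1) (x e : R) (i j k : 'I_n.+1).

Local Notation rcoef := (rcoef y a b dens).
Local Notation lcoef := (lcoef y a b dens).
Local Notation pcoef := (pcoef y rho a b).
Local Notation ecoef := (ecoef y rho a b).
Local Notation mass_psi := (mass_psi y rho a b dens).
Local Notation mass_e := (mass_e y rho a b).

Definition masses sg psi : 'rV[R]_n.+1 := \row_i mass y rho sg psi i.
Definition masses_e e psi : 'rV[R]_n.+1 := \row_i mass_e e psi i.
(** Row j is the derivative along the j-th coordinate, as in the convention of ['J]. *)
Definition masses_psi e psi : 'M[R]_n.+1 := \matrix_(j, i) mass_psi e psi (delta_mx 0 j) i.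

Lemma masses_psiE e psi d i : (d *m masses_psi e psi) 0 i = mass_psi e psi d i.
Proof.
rewrite (row_form (f := fun d => mass_psi e psi d i)).
  by rewrite mxE; apply: eq_bigr => j _; rewrite mxE.
move=> c u v; rewrite /mass_psi /drend /dlend /dface.
by case: ifP => _; case: ifP => _; rewrite !mxE; ring.
Qed.

Lemma masses_expansion e psi : 0 < e -> regular_at y a b psi -> forall eta, 0 < eta ->
  exists2 s, 0 < s & forall e' phi, `|e' - e| < s -> `|phi - psi| < s ->
    `|masses (sig e') phi - masses (sig e) psi -
      ((e' - e) *: masses_e e psi + (phi - psi) *m masses_psi e psi)|
    <= eta * (`|e' - e| + `|phi - psi|).
Proof.
move=> e0 reg eta eta0; have [s s0 hs] := mass_expansion law y_incr e0 reg eta0.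
exists s => // e' phi h1 h2; apply: norm_le_coord => [|i].
  by rewrite mulr_ge0 ?addr_ge0// ltW.
apply: le_trans (hs i e' phi h1 h2); rewrite -masses_psiE.
move: (_ *m _) => Y; rewrite le_eqVlt; apply/orP; left; apply/eqP; congr `|_|.
by rewrite !mxE; ring.
Qed.

(** Uniform in t although the root has unbounded slope: where neither weight is capped, the
    difference is sqrt t / e' times (e - e') / e, and sqrt t <= e'. *)
Lemma sig_dist e e' t : 0 < e -> 0 < e' -> `|sig e' t - sig e t| <= `|e' - e| / e.
Proof.
move=> e0 e'0; have lo f : 0 < f -> t <= f ^+ 2 -> Num.sqrt t <= f.
  by move=> f0 tf; rewrite -[leRHS]gtr0_norm// -sqrtr_sqr ler_wsqrtr.
have hi f : 0 < f -> f ^+ 2 <= t -> f <= Num.sqrt t.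
  by move=> f0 tf; rewrite -[leLHS]gtr0_norm// -sqrtr_sqr ler_wsqrtr.
have r0 := sqrtr_ge0 t.
case: (leP t (e ^+ 2)) => te; case: (leP t (e' ^+ 2)) => te'.
- have re' := lo _ e'0 te'; rewrite !sig_sqrt//; move: re' r0; set r := Num.sqrt t => re' r0.
  have -> : r / e' - r / e = (r / e') * ((e - e') / e) by field; rewrite !gt_eqF.
  rewrite normrM (ger0_norm (_ : 0 <= r / e')) ?divr_ge0 ?(ltW e'0)// normrM distrC.
  by rewrite normfV (gtr0_norm e0) ler_piMl ?divr_ge0 ?(ltW e0)// ler_pdivrMr// mul1r.
- have re := lo _ e0 te; have re' := hi _ e'0 (ltW te').
  rewrite (sig_sqrt e0 te) (sig_one e'0 (ltW te')); move: re re' r0; set r := Num.sqrt t => re re' r0.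
  have -> : 1 - r / e = (e - r) / e by field; rewrite gt_eqF.
  rewrite ger0_norm ?divr_ge0 ?subr_ge0 ?(ltW e0)// ler_pM2r ?invr_gt0// distrC ger0_norm; lra.
- have re := hi _ e0 (ltW te); have re' := lo _ e'0 te'.
  rewrite (sig_sqrt e'0 te') (sig_one e0 (ltW te)); move: re re' r0; set r := Num.sqrt t => re re' r0.
  have -> : r / e' - 1 = - ((e' - r) / e') by field; rewrite gt_eqF.
  rewrite normrN ger0_norm ?divr_ge0 ?subr_ge0 ?(ltW e'0)//.
  apply: ler_pM; rewrite ?invr_ge0 ?subr_ge0 ?(ltW e'0)//; first by rewrite ger0_norm; lra.
  by rewrite lef_pV2 ?posrE//; lra.
- by rewrite (sig_one e0 (ltW te)) (sig_one e'0 (ltW te')) subrr normr0 divr_ge0// ltW.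
Qed.

Lemma mass_dist e e' psi i : 0 < e -> 0 < e' ->
  `|mass y rho (sig e') psi i - mass y rho (sig e) psi i| <= `|e' - e| / e.
Proof.
move=> e0 e'0.
have ic f : 0 < f -> intg rho (cellf y (sig f) psi i).
  by move=> f0; apply: intg_cellf => [|t]; [exact: meas_sig|exact: sig_bounds].
rewrite -E_B; [|exact: ic|exact: ic].
apply: E_norm_le; first by apply: intgB; exact: ic.
apply: aesT => x; rewrite /cellf; case: ifP => _; first exact: sig_dist.
by rewrite subrr normr0 divr_ge0// ltW.
Qed.

(** Along a kernel vector the masses would move by o(t), whereas strong monotonicity forces a change
    of order t. *)
Lemma masses_psi_unit e psi : 0 < e -> regular_at y a b psi ->
  (exists2 c, 0 < c & exists2 r, 0 < r & forall phi,
    c * Num.min r `|phi - psi| * `|phi - psi| <=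
      \sum_(i < n.+1) (mass y rho (sig e) phi i - mass y rho (sig e) psi i) * (phi - psi) 0 i) ->
  masses_psi e psi \in unitmx.
Proof.
move=> e0 reg [c c0 [r r0 hr]]; apply: unitmx_ker0 => v vA.
apply/eqP/negPn/negP => v0; have nv0 : 0 < `|v| by rewrite normr_gt0.
have N0 : 0 < n.+1%:R :> R by rewrite ltr0n.
(* The n + 1 coordinate errors then add up to half of c only. *)
pose eta := c / (2 * n.+1%:R).
have eta0 : 0 < eta by rewrite divr_gt0// mulr_gt0.
have [s s0 hs] := masses_expansion e0 reg eta0.
pose t := Num.min r s / 2 / `|v|.
have m0 : 0 < Num.min r s by rewrite lt_min r0.
have t0 : 0 < t by rewrite !divr_gt0.
have nt : `|t *: v| = Num.min r s / 2 by rewrite normrZ gtr0_norm// divfK// gt_eqF.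
have [tr ts] : `|t *: v| < r /\ `|t *: v| < s.
  have : Num.min r s <= r by rewrite ge_min lexx.
  have : Num.min r s <= s by rewrite ge_min lexx orbT.
  by rewrite nt; split; lra.
have := hs e (psi + t *: v); have := hr (psi + t *: v).
rewrite (addrC psi) addrK (min_idPr (ltW tr)) => h1.
rewrite subrr normr0 scale0r !add0r => /(_ s0 ts).
rewrite -scalemxAl vA scaler0 subr0 => h2.
have : c * `|t *: v| * `|t *: v| <= n.+1%:R * (eta * `|t *: v|) * `|t *: v|.
  apply: (le_trans h1); rewrite -mulrA mulr_natl -[X in _ *+ X]card_ord -sumr_const.
  apply: ler_sum => i _; apply: (le_trans (ler_norm _)); rewrite normrM.
  apply: ler_pM => //; last exact: coord_le_norm.
  by apply: le_trans h2; apply: le_trans (coord_le_norm _ i); rewrite !mxE.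
have T0 : 0 < `|t *: v| by rewrite nt divr_gt0.
rewrite ler_pM2r// mulrA ler_pM2r//.
have -> : n.+1%:R * eta = c / 2 by rewrite /eta; field; rewrite gt_eqF.
lra.
Qed.

End MassField.

(** * Continuity and speed of the curve *)

Section MaximizerCurve.
Context {R : realType} {n : nat}.
Variable y : 'I_n.+1 -> R.
Variables (rho : probability (measurableTypeR R) R) (a b m M : R) (dens : R -> R).
Hypothesis law : regular_law rho a b m M dens.
Hypothesis y_incr : forall i j : 'I_n.+1, (i < j)%N -> y i < y j.
Hypothesis y_inj : injective y.
Variable alpha : 'I_n.+1 -> R.
Hypothesis alpha_gt0 : forall i, 0 < alpha i.
Hypothesis alpha_sum : \sum_(i < n.+1) alpha i < 1.
Variable psi : R -> 'rV[R]_n.+1.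
Hypothesis psi_mass : forall e, 0 < e -> forall i, mass y rho (sig e) (psi e) i = alpha i.
Implicit Types (e : R) (i j k : 'I_n.+1).

Lemma near_pos e : 0 < e -> exists2 s : R, 0 < s & forall e', `|e' - e| < s -> 0 < e'.
Proof.
move=> e0; exists (e / 2) => [|e' /ltW h]; first by rewrite divr_gt0.
by have [] := inv_close e0 h.
Qed.

(** Positive masses put a point of positive score in every cell; a score never exceeds its
    coordinate of the potential, which is therefore positive. *)
Lemma mass_regular e phi : 0 < e -> (forall i, mass y rho (sig e) phi i = alpha i) ->
  regular_at y a b phi.
Proof.
move=> e0 hm.
have pts k : exists x, (a < x < b /\ strictly_best y phi k x) /\ 0 < score y phi k x.
  have [|||x [_ axb sx px]] := @cell_points _ _ y rho a b m M dens law y_inj (sig e)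
    (meas_sig e) _ _ phi k _ (fun=> True) (aesT _ (fun=> I)).
  + by move=> t; exact: sig_bounds.
  + by move=> t; exact: sig_le0.
  + by rewrite hm.
  by exists x.
split=> [i|].
  have [x [_]] := pts i; rewrite /score subr_gt0; apply: le_lt_trans; exact: sqr_ge0.
by exists (fun k => projT1 (cid (pts k))); split => k; case: cid => x /= [[]].
Qed.

(** Strong monotonicity at e is tested at psi e'. As psi e' has masses alpha for the weight of e',
    the pairing sees only the change of weight, at most |e' - e| / e per coordinate. *)
Lemma curve_continuous e : 0 < e -> psi @ e --> psi e.
Proof.
move=> e0; have [c c0 [r r0 hr]] := reg_resolvent law y_inj alpha_gt0 alpha_sum e0 (psi_mass e0).
apply/cvg_le_dist => eta eta0.
have N0 : 0 < n.+1%:R :> R by rewrite ltr0n.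
have q0 : 0 < Num.min r eta by rewrite lt_min r0.
exists (Num.min (e / 2) (c * Num.min r eta / n.+1%:R * e)).
  by rewrite lt_min divr_gt0// mulr_gt0// divr_gt0// mulr_gt0.
move=> e'; rewrite lt_min => /andP[h1 h2].
have [e'0 _ _] := inv_close e0 (ltW h1).
have := hr (psi e'); set d := psi e' - psi e => hd.
rewrite leNgt; apply/negP => eta_d.
have D0 : 0 < `|d| := lt_trans eta0 eta_d.
have up : c * Num.min r `|d| * `|d| <= n.+1%:R * (`|e' - e| / e) * `|d|.
  apply: (le_trans hd); rewrite -mulrA mulr_natl -[X in _ *+ X]card_ord -sumr_const.
  apply: ler_sum => i _; apply: (le_trans (ler_norm _)); rewrite normrM.
  apply: ler_pM => //; last exact: coord_le_norm.
  by rewrite -(psi_mass e'0 i) distrC; exact: mass_dist.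
move: up; rewrite ler_pM2r// leNgt => /negP; apply.
have hq : c * Num.min r eta <= c * Num.min r `|d|.
  by rewrite ler_pM2l// le_min !ge_min lexx/= (ltW eta_d) orbT.
apply: lt_le_trans hq; rewrite mulrC -ltr_pdivlMr// ltr_pdivrMr//.
Qed.

Lemma compose_continuous (F : R -> R -> R -> R) (p q : R -> R) e :
  (forall eta, 0 < eta -> exists2 s, 0 < s & forall e' p' u',
     `|e' - e| < s -> `|p' - p e| < s -> `|u' - q e| < s -> `|F e' p' u' - F e (p e) (q e)| <= eta) ->
  p @ e --> p e -> q @ e --> q e ->
  (fun e' => F e' (p e') (q e')) @ e --> F e (p e) (q e).
Proof.
move=> hF /cvg_le_dist hp /cvg_le_dist hq; apply/cvg_le_dist => eta /hF[s s0 hs].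
have s2 : 0 < s / 2 by rewrite divr_gt0.
have lts x : x <= s / 2 -> x < s by move=> h; apply: (le_lt_trans h); rewrite ltr_pdivrMr// mulr2n mulrDr mulr1 ltrDl.
have [s1 s10 h1] := hp _ s2; have [s3 s30 h3] := hq _ s2.
exists (Num.min s (Num.min s1 s3)); first by rewrite !lt_min s0 s10.
move=> e'; rewrite !lt_min => /and3P[e1 e2 e3].
by apply: hs => //; apply: lts; [exact: h1|exact: h3].
Qed.

Lemma curve_coord e i : 0 < e -> (fun e' => psi e' 0 i) @ e --> psi e 0 i.
Proof.
move=> /curve_continuous/cvg_le_dist h; apply/cvg_le_dist => eta /h[s s0 hs].
exists s => // e' /hs; apply: le_trans; apply: le_trans (coord_le_norm _ i).
by rewrite !mxE.
Qed.

Lemma curve_ends e i : 0 < e ->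
  (fun e' => rend y b (psi e') i) @ e --> rend y b (psi e) i /\
  (fun e' => lend y a (psi e') i) @ e --> lend y a (psi e) i.
Proof.
move=> /curve_continuous/cvg_le_dist h; have [K K1 hK] := dends_bound y.
have K0 : 0 < K by apply: lt_le_trans K1.
split; apply/cvg_le_dist => eta eta0; have /h[s s0 hs] : 0 < eta / K by rewrite divr_gt0.
  exists s => // e' /hs; rewrite rendB ler_pdivlMr// mulrC; apply: le_trans.
  by have [] := hK (psi e' - psi e) i.
exists s => // e' /hs; rewrite lendB ler_pdivlMr// mulrC; apply: le_trans.
by have [] := hK (psi e' - psi e) i.
Qed.

Lemma curve_coefs e i : 0 < e ->
  [/\ (fun e' => ecoef y rho a b e' (psi e') i) @ e --> ecoef y rho a b e (psi e) i,
      (fun e' => pcoef y rho a b e' (psi e') i) @ e --> pcoef y rho a b e (psi e) i,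
      (fun e' => rcoef y a b dens e' (psi e') i) @ e --> rcoef y a b dens e (psi e) i &
      (fun e' => lcoef y a b dens e' (psi e') i) @ e --> lcoef y a b dens e (psi e) i].
Proof.
move=> e0; have [psi0 [X [Xab Xb]]] := mass_regular e0 (psi_mass e0).
have [Ra Rb] := rend_neq law y_incr Xab Xb i.
have [La Lb] := lend_neq law y_incr Xab Xb i.
have cp := @curve_coord e i e0; have [cr cl] := @curve_ends e i e0.
split.
- apply: cvgB.
    exact: (compose_continuous (slice_e_cont law (y i) _ _ e0) cp cr).
  exact: (compose_continuous (slice_e_cont law (y i) _ _ e0) cp cl).
- apply: cvgB.
    exact: (compose_continuous (slice_p_cont law (y i) _ e0 (psi0 i)) cp cr).
  exact: (compose_continuous (slice_p_cont law (y i) _ e0 (psi0 i)) cp cl).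
- exact: (compose_continuous (slice_u_cont law (y i) _ e0 Ra Rb) cp cr).
- exact: (compose_continuous (slice_u_cont law (y i) _ e0 La Lb) cp cl).
Qed.

Let Mpsi e := masses_psi y rho a b dens e (psi e).
Let Me e := masses_e y rho a b e (psi e).

Lemma curve_entries e i j : 0 < e ->
  (fun e' => Mpsi e' j i) @ e --> Mpsi e j i /\ (fun e' => Me e' 0 i) @ e --> Me e 0 i.
Proof.
move=> e0; have [ce cp cr cl] := @curve_coefs e i e0.
have cV : (fun e' : R => e'^-1) @ e --> e^-1 by apply: cvgV; [rewrite gt_eqF|exact: cvg_id].
split.
  under eq_fun do rewrite mxE; rewrite /Mpsi mxE /mass_psi.
  apply: cvgM => //; apply: cvgB; last by apply: cvgM => //; exact: cvg_cst.
  by apply: cvgD; apply: cvgM => //; exact: cvg_cst.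
(* Along the curve the masses are constant, so alpha replaces them in [mass_e]; this is valid for e'
   > 0, whence the passage through equality near e. *)
have ea : (fun e' => e'^-1 * (ecoef y rho a b e' (psi e') i - alpha i)) @ e --> Me e 0 i.
  rewrite /Me mxE /mass_e psi_mass//; apply: cvgM => //; apply: cvgB => //; exact: cvg_cst.
apply: cvg_trans ea; apply: near_eq_cvg.
have : \forall e' \near e, e'^-1 * (ecoef y rho a b e' (psi e') i - alpha i) = Me e' 0 i.
  by apply/near_norm; have [s s0 hs] := near_pos e0; exists s => // e' /hs e'0; rewrite /Me mxE /mass_e psi_mass.
by [].
Qed.

Lemma curve_field_continuous e : 0 < e -> forall eta, 0 < eta ->
  exists2 s, 0 < s & forall e', `|e' - e| < s ->
     (forall v : 'rV[R]_n.+1, `|v *m Mpsi e' - v *m Mpsi e| <= eta * `|v|) /\ `|Me e' - Me e| <= eta.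
Proof.
move=> e0 eta eta0.
have N0 : 0 < n.+1%:R :> R by rewrite ltr0n.
have etaN : 0 < eta / n.+1%:R by rewrite divr_gt0.
have [s1 s10 h1] : exists2 s : R, 0 < s & forall i j e', `|e' - e| < s ->
    `|Mpsi e' j i - Mpsi e j i| <= eta / n.+1%:R.
  apply: (min_of_scales (P := fun i s => forall j e', `|e' - e| < s ->
    `|Mpsi e' j i - Mpsi e j i| <= eta / n.+1%:R)) => [i s s' h _ ss' j e' hs'|i].
    by apply: h; exact: lt_le_trans ss'.
  apply: (min_of_scales (P := fun j s => forall e', `|e' - e| < s ->
    `|Mpsi e' j i - Mpsi e j i| <= eta / n.+1%:R)) => [j s s' h _ ss' e' hs'|j].
    by apply: h; exact: lt_le_trans ss'.
  by have [/cvg_le_dist/(_ _ etaN)] := @curve_entries e i j e0.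
have [s2 s20 h2] : exists2 s : R, 0 < s & forall i e', `|e' - e| < s ->
    `|Me e' 0 i - Me e 0 i| <= eta.
  apply: (min_of_scales (P := fun i s => forall e', `|e' - e| < s ->
    `|Me e' 0 i - Me e 0 i| <= eta)) => [i s s' h _ ss' e' hs'|i].
    by apply: h; exact: lt_le_trans ss'.
  by have [_ /cvg_le_dist/(_ _ eta0)] := @curve_entries e i i e0.
exists (Num.min s1 s2); first by rewrite lt_min s10.
move=> e'; rewrite lt_min => /andP[e1 e2]; split=> [v|].
  rewrite -mulmxBr; apply: norm_le_coord => [|i]; first by rewrite mulr_ge0// ltW.
  rewrite mxE (le_trans (ler_norm_sum _ _ _))//.
  have -> : eta * `|v| = \sum_(k < n.+1) `|v| * (eta / n.+1%:R).
    by rewrite sumr_const card_ord -mulr_natl; field; rewrite gt_eqF.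
  apply: ler_sum => k _; rewrite normrM ler_pM ?coord_le_norm// !mxE.
  by have := h1 i k _ e1; rewrite /Mpsi !mxE.
apply: norm_le_coord => [|i]; first exact: ltW.
by have := h2 i _ e2; rewrite !mxE.
Qed.

Definition curve_speed e := - (Me e *m invmx (Mpsi e)).

Lemma curve_unit e : 0 < e -> Mpsi e \in unitmx.
Proof.
move=> e0; apply: (masses_psi_unit law y_incr e0 (mass_regular e0 (psi_mass e0))).
have [c c0 [r r0 hr]] := reg_resolvent law y_inj alpha_gt0 alpha_sum e0 (psi_mass e0).
exists c => //; exists r => // phi; apply: le_trans (hr phi) _.
by rewrite le_eqVlt; apply/orP; left; apply/eqP/eq_bigr => i _; rewrite psi_mass.
Qed.

Lemma curve_expansion e : 0 < e -> forall eta, 0 < eta ->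
  exists2 s, 0 < s & forall e', `|e' - e| < s ->
    `|psi e' - psi e - (e' - e) *: curve_speed e| <= eta * `|e' - e|.
Proof.
move=> e0; apply: (implicit_derivative (G := fun e phi => masses y rho (sig e) phi)).
- exact: curve_unit.
- move=> eta eta0; exact: (masses_expansion law y_incr e0 (mass_regular e0 (psi_mass e0)) eta0).
- move=> eta eta0; have eta2 : 0 < eta / 2 by rewrite divr_gt0.
  have /cvg_le_dist/(_ _ eta2)[s s0 hs] := curve_continuous e0.
  exists s => // e' /hs h; apply: (le_lt_trans h); lra.
- have [s s0 hs] := near_pos e0; exists s => // e' /hs e'0.
  by apply/rowP => i; rewrite !mxE !psi_mass.
Qed.

Lemma curve_speed_continuous e : 0 < e -> curve_speed @ e --> curve_speed e.
Proof.
move=> e0; apply/cvg_le_dist; apply: implicit_derivative_continuous.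
- by have [s s0 hs] := near_pos e0; exists s => // e' /hs; exact: curve_unit.
- exact: curve_field_continuous.
Qed.

End MaximizerCurve.

(** * Derivatives from first-order expansions *)

Section Expansions.
Context {R : realType}.

Lemma expansion_derivative (V : normedModType R) (f : R -> V) (e : R) (l : V) :
  (forall eta : R, 0 < eta -> exists2 s : R, 0 < s & forall e', `|e' - e| < s ->
    `|f e' - f e - (e' - e) *: l| <= eta * `|e' - e|) ->
  derivable f e 1 /\ derive1 f e = l.
Proof.
move=> hf.
have key : (fun h => h^-1 *: ((f \o shift e) (h *: 1) - f e)) @ 0^' --> l.
  apply/cvgrPdist_le => eta eta0; have [s s0 hs] := hf _ eta0.
  suff : \forall h \near (0 : R), h != 0 -> `|l - h^-1 *: ((f \o shift e) (h *: 1) - f e)| <= eta.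
    by rewrite near_withinE.
  apply/near_norm; exists s => // h; rewrite subr0 => hs' h0 /=.
  have hn : 0 < `|h| by rewrite normr_gt0.
  have -> : h *: (1 : R) = h by exact: mulr1.
  have := hs (h + e); rewrite addrK => /(_ hs').
  rewrite mulrC -ler_pdivrMl// -normfV -normrZ scalerBr scalerA mulVf ?scale1r// => hle.
  by rewrite distrC.
split; first by apply/cvg_ex; exists l.
by rewrite derive1E; apply: cvg_lim => //.
Qed.

Lemma expansion_diff (V W : normedModType R) (f : V -> W) (df : {linear V -> W}) x (K : R) :
  0 < K -> (forall v, `|df v| <= K * `|v|) ->
  (forall eta : R, 0 < eta -> exists2 s : R, 0 < s & forall v, `|v - x| < s ->
    `|f v - f x - df (v - x)| <= eta * `|v - x|) ->
  differentiable f x /\ ('d f x = df :> (V -> W)).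
Proof.
move=> K0 hK hf.
have dfc : continuous df.
  move=> u; apply/cvg_le_dist => eta eta0; exists (eta / K) => [|v].
    by rewrite divr_gt0.
  rewrite ltr_pdivlMr// mulrC => /ltW h; rewrite -linearB; exact: le_trans h.
have o : f \o shift x = cst (f x) + df +o_ 0 id.
  apply/eqaddoP => eta /hf[s s0 hs]; apply/near_norm; exists s => // h.
  rewrite subr0 => hh; have := hs (h + x); rewrite addrK => /(_ hh) /=.
  by rewrite /= !fctE /= opprD addrA.
have dE := diff_unique dfc o.
split => //; apply/diff_locallyP; rewrite dE; split => //.
Qed.

Lemma expansion_jacobian (p q : nat) (f : 'rV[R]_p.+1 -> 'rV[R]_q.+1) x (A : 'M[R]_(p.+1, q.+1)) (K : R) :
  0 < K -> (forall v : 'rV[R]_p.+1, `|v *m A| <= K * `|v|) ->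
  (forall eta : R, 0 < eta -> exists2 s : R, 0 < s & forall v, `|v - x| < s ->
    `|f v - f x - (v - x) *m A| <= eta * `|v - x|) ->
  differentiable f x /\ 'J f x = A.
Proof.
move=> K0 hK hf; have [dfx dE] := expansion_diff (df := mulmxr A) K0 hK hf; split => //.
rewrite /jacobian; apply/row_matrixP => i; rewrite !rowE mul_rV_lin1 /= dE.
by [].
Qed.

Definition rowdot n (g v : 'rV[R]_n.+1) : R := \sum_(i < n.+1) g 0 i * v 0 i.

Lemma rowdot_linear n (g : 'rV[R]_n.+1) : linear (rowdot g : 'rV[R]_n.+1 -> R^o).
Proof.
move=> c u v; rewrite /rowdot scaler_sumr -big_split; apply: eq_bigr => i _.
by rewrite !mxE /GRing.scale/=; ring.
Qed.

HB.instance Definition _ n (g : 'rV[R]_n.+1) :=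
  GRing.isLinear.Build R 'rV[R]_n.+1 R^o _ (rowdot g) (rowdot_linear g).

Lemma rowdot_delta n (g : 'rV[R]_n.+1) i : rowdot g (delta_mx 0 i) = g 0 i.
Proof.
rewrite /rowdot (bigD1 i)//= big1 ?addr0; first by rewrite mxE !eqxx mulr1.
by move=> j ji; rewrite mxE (negPf ji) andbF mulr0.
Qed.

Lemma rowdot_bound n (g v : 'rV[R]_n.+1) : `|rowdot g v| <= (1 + \sum_(i < n.+1) `|g 0 i|) * `|v|.
Proof.
rewrite mulrDl mul1r ler_wpDl// (le_trans (ler_norm_sum _ _ _))// mulr_suml.
by apply: ler_sum => i _; rewrite normrM ler_wpM2l// coord_le_norm.
Qed.

Lemma expansion_gradient n (f : 'rV[R]_n.+1 -> R) x (g : 'rV[R]_n.+1) :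
  (forall eta : R, 0 < eta -> exists2 s : R, 0 < s & forall v, `|v - x| < s ->
    `|f v - f x - rowdot g (v - x)| <= eta * `|v - x|) ->
  differentiable f x /\ gradient f x = g.
Proof.
move=> hf.
have K0 : 0 < 1 + \sum_(i < n.+1) `|g 0 i| by rewrite ltr_pwDl// sumr_ge0.
have [dfx dE] := @expansion_diff _ R^o f (rowdot g) x _ K0 (rowdot_bound g) hf.
split => //; apply/rowP => i; rewrite mxE deriveE// dE; exact: rowdot_delta.
Qed.

End Expansions.

(** * Derivatives of the regularized functional and of its masses *)

Section RegularizedCalculus.
Context {R : realType} {n : nat}.
Variable y : 'I_n.+1 -> R.
Variables (rho : probability (measurableTypeR R) R) (a b m M : R) (dens : R -> R).
Hypothesis law : regular_law rho a b m M dens.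
Hypothesis y_incr : forall i j : 'I_n.+1, (i < j)%N -> y i < y j.
Hypothesis y_inj : injective y.
Variable alpha : 'I_n.+1 -> R.
Implicit Types (e : R) (phi : 'rV[R]_n.+1).

Lemma Keps_gradient e phi : 0 < e ->
  differentiable (Keps rho y alpha e) phi /\
  gradient (Keps rho y alpha e) phi = \row_i alpha i - Geps rho y e phi.
Proof.
move=> e0; apply: expansion_gradient => eta eta0.
have [||||s s0 hs] := @dual_expansion _ _ y rho a b m M dens law y_inj alpha (pen e) (sig e)
  (meas_sig e) _ _ _ _ phi eta eta0.
- by move=> t; exact: sig_bounds.
- by move=> t; have [] := pen_bounds t e0.
- by move=> s t; exact: pen_subgradient.
- by move=> t _; exact: pen_expansion.
exists s => // v /hs; rewrite !KepsE//; congr (`|_ - _| <= _).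
by apply: eq_bigr => i _; rewrite GepsE// !mxE.
Qed.

Lemma Geps_jacobian e phi : 0 < e -> regular_at y a b phi ->
  differentiable (Geps rho y e) phi /\ 'J (Geps rho y e) phi = masses_psi y rho a b dens e phi.
Proof.
move=> e0 reg; have [K K0 hK] := mulmx_bound (masses_psi y rho a b dens e phi).
apply: (expansion_jacobian K0 hK) => eta eta0.
have [s s0 hs] := masses_expansion law y_incr e0 reg eta0.
exists s => // v hv; have := hs e v; rewrite !GepsE// subrr normr0 scale0r !add0r; exact.
Qed.

(** The gradient is alpha - G^eps at every potential, so its expansion is that of the masses with
    the sign reversed. *)
Lemma Keps_hessian e phi : 0 < e -> regular_at y a b phi ->
  differentiable (gradient (Keps rho y alpha e)) phi /\
  hessian (Keps rho y alpha e) phi = - masses_psi y rho a b dens e phi.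
Proof.
move=> e0 reg; have [K K0 hK] := mulmx_bound (- masses_psi y rho a b dens e phi).
apply: (expansion_jacobian K0 hK) => eta eta0.
have [s s0 hs] := masses_expansion law y_incr e0 reg eta0.
exists s => // v hv; have := hs e v; rewrite subrr normr0 scale0r !add0r => /(_ s0 hv).
rewrite !(Keps_gradient _ e0).2 !GepsE// -normrN; congr (`|_| <= _).
by rewrite mulmxN; move: (_ *m _) => X; apply/rowP => i; rewrite !mxE; ring.
Qed.

Lemma Geps_derive_eps e phi : 0 < e -> regular_at y a b phi ->
  derivable (fun e => Geps rho y e phi) e 1 /\
  derive1 (fun e => Geps rho y e phi) e = masses_e y rho a b e phi.
Proof.
move=> e0 reg; apply: expansion_derivative => eta eta0.
have [s s0 hs] := masses_expansion law y_incr e0 reg eta0.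
have [r r0 hr] := near_pos e0.
exists (Num.min s r); first by rewrite lt_min s0.
move=> e'; rewrite lt_min => /andP[h1 h2]; have e'0 := hr _ h2.
have := hs e' phi h1; rewrite !GepsE// subrr normr0 mul0mx !addr0; exact.
Qed.

End RegularizedCalculus.

Theorem theorem17 (R : realType)
  (rho : probability (measurableTypeR R) R) (dens : R -> R)
  (rho_ac : rho `<< (@lebesgue_measure R))
  (rho_dens : is_density rho dens)
  (spt_interval : is_interval (spt rho))
  (spt_bounded : bounded_set (spt rho))
  (dens_cont : {within spt rho, continuous dens})
  (rho_min rho_max : R) (rho_min_gt0 : 0 < rho_min) (rho_max_gt0 : 0 < rho_max)
  (dens_bounds : forall x, spt rho x -> rho_min <= dens x <= rho_max)
  (n : nat) (y : 'I_n.+1 -> R)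
  (y_incr : forall i j : 'I_n.+1, (i < j)%N -> y i < y j)
  (alpha : 'I_n.+1 -> R) (alpha_gt0 : forall i, 0 < alpha i)
  (alpha_sum : \sum_(i < n.+1) alpha i < 1) :
  exists (eps0 : R) (psi : R -> 'rV[R]_n.+1), 0 < eps0 /\
  [/\ (* (1) *)
      forall eps : R, 0 < eps < eps0 ->
        unique (is_maximizer setT (Keps rho y alpha eps)) (psi eps),
      (* (2), with the row-vector convention of ['J] *)
      forall eps : R, 0 < eps < eps0 ->
        [/\ derivable psi eps 1 /\ {for eps, continuous (derive1 psi)},
            differentiable (Geps rho y eps) (psi eps) /\
              derivable (fun e => Geps rho y e (psi eps)) eps 1,
            derive1 psi eps *m 'J (Geps rho y eps) (psi eps)
              + derive1 (fun e => Geps rho y e (psi eps)) eps = 0,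
            (\forall phi \near psi eps,
                differentiable (Keps rho y alpha eps) phi) /\
              differentiable (gradient (Keps rho y alpha eps)) (psi eps) &
            'J (Geps rho y eps) (psi eps)
              = - hessian (Keps rho y alpha eps) (psi eps)]
    & (* (3) *)
      exists C : R, forall psistar : 'rV[R]_n.+1,
        is_maximizer [set phi : 'rV[R]_n.+1 | forall i, 0 < phi 0 i]
          (Kfun rho y alpha) psistar ->
        forall eps : R, 0 < eps < eps0 ->
          norm2 (psi eps - psistar) <= C * eps ^+ 2].

Proof.
have [a [b law]] := regular_law_ex rho_ac rho_dens spt_interval spt_bounded dens_cont
  rho_min_gt0 rho_max_gt0 dens_bounds.
have y_inj : injective y.
  move=> i j; case: (ltngtP i j) => [/y_incr|/y_incr|/val_inj->//] h yij;
    by rewrite yij ltxx in h.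
(* The default 0 for e <= 0 makes the curve a total function of e, from which [cid] selects. *)
have exmax e : exists phi, 0 < e -> is_maximizer setT (Keps rho y alpha e) phi.
  have [e0|] := boolP (0 < e); last by exists 0.
  by have [phi ?] := reg_maximizer_ex y law alpha_gt0 alpha_sum e0; exists phi.
pose psi e := projT1 (cid (exmax e)).
have psi_max e : 0 < e -> is_maximizer setT (Keps rho y alpha e) (psi e).
  by rewrite /psi; case: cid.
have psi_mass e : 0 < e -> forall i, mass y rho (sig e) (psi e) i = alpha i.
  by move=> e0; exact (reg_maximizer_mass law y_inj e0 (psi_max e e0)).
have speed e : 0 < e -> derivable psi e 1 /\ derive1 psi e = curve_speed y rho a b dens psi e.
  move=> e0; apply: expansion_derivative => eta eta0.
  exact: (curve_expansion law y_incr y_inj alpha_gt0 alpha_sum psi_mass e0 eta0).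
(* The rate supplies both the threshold and the constant. *)
have [eps0 eps00 [C hC]] := rate_of_convergence law y_inj alpha_gt0 alpha_sum.
exists eps0, psi; split => //; split => [e /andP[e0 _]|e /andP[e0 _]|].
- split; first exact: psi_max.
  move=> phi hphi; symmetry; apply: (reg_unique law y_inj alpha_gt0 alpha_sum e0 (psi_mass e e0)).
  exact (reg_maximizer_mass law y_inj e0 hphi).
- have reg := mass_regular law y_inj alpha_gt0 e0 (psi_mass e e0).
  have [dG JG] := Geps_jacobian law y_incr e0 reg.
  have [dE DE] := Geps_derive_eps law y_incr e0 reg.
  have [dK HK] := Keps_hessian law y_incr y_inj alpha e0 reg.
  have [dpsi Dpsi] := speed e e0.
  split.
  + split; first exact: dpsi.
    suff: derive1 psi @ e --> derive1 psi e by []; rewrite Dpsi.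
    apply: cvg_trans (curve_speed_continuous law y_incr y_inj alpha_gt0 alpha_sum psi_mass e0).
    (* The formula for the derivative is known at positive e', which covers a neighbourhood of e. *)
    apply: near_eq_cvg.
    have : \forall e' \near e, curve_speed y rho a b dens psi e' = derive1 psi e'.
      apply/near_norm; have [s s0 hs] := near_pos e0; exists s => // e' /hs e'0.
      by have [_ ->] := speed e' e'0.
    by [].
  + by split; [exact: dG|exact: dE].
  + rewrite JG DE Dpsi /curve_speed mulNmx mulmxKV; first by rewrite addNr.
    exact: (curve_unit law y_incr y_inj alpha_gt0 alpha_sum psi_mass e0).
  + split; last exact: dK.
    by apply/near_norm; exists 1 => // phi _; have [] := Keps_gradient law y_inj alpha phi e0.
  + by rewrite JG HK opprK.
- exists C => psistar hstar e he; apply: hC => //.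
  by case/andP: he => e0 _; exact: psi_mass.
Qed.
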